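(* Let $n\ge 3$, let $[a,b]\subset\mathbb R$ be a compact interval and let $F=(f_1,\dots,f_n):[a,b]\to\mathbb R^n$ be a nonconstant Lipschitz map whose image $\Gamma_F:=F([a,b])$ is a Lipschitz triangulable curve such that $\pi_1(\Gamma_F)$ is isomorphic to the free group with $m$ generators for some $m\in\mathbb N$, $m\ge1$. Let $C_1,\dots,C_m\subset\Gamma_F$ be images of simple closed Lipschitz curves which generate the group $H_1(\Gamma_F)$, let $C:=\bigcup_{1\le j\le m}C_j$, and let $h_1,\dots,h_k:[0,1]\to C$ be Lipschitz curves forming a triangulation $\mathcal T$ of $C$, with $\gamma_i:=h_i([0,1])$, $1\le i\le k$. Assume that there exist pairwise disjoint open cubes $K_1,\dots,K_k\subset\mathbb R^n$ with centers $c_i\in\gamma_i$ and natural numbers $s_i\in[1,n]$, $1\le i\le k$, such that for each $i$: (a) $K_i\cap\gamma_i$ is connected and $K_i\cap\gamma_j=\emptyset$ for all $j\neq i$; (b) the restriction to $K_i\cap\gamma_i$ of the projection $\pi_{s_i}:\mathbb R^n\to\mathbb R^n$, $\pi_{s_i}(x_1,\dots,x_n):=(0,\dots,0,x_{s_i},0,\dots,0)$, is injective. Let $\bar N_{\mathcal T}$ be the natural number defined in the context from these data. Then there exists a number $\widetilde N\in\mathbb N$ such that $$\max\left\{\left\lfloor\sqrt[n]{\tfrac{m}{n}}-1\right\rfloor,\,1\right\}\le\widetilde N\le\bar N_{\mathcal T}$$ and for every Lipschitz map $G=(g_1,\dots,g_n):[a,b]\to\mathbb R^n$ with $G(a)=G(b)$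 and $G([a,b])\subset\Gamma_F$, each moment from $g_1,\dots,g_n$ can be expressed as a finite linear combination, with real coefficients depending on $\Gamma_F$ only, of $m$ moments from the family $$\int_a^b g_1(t)^{d_1}\cdots g_n(t)^{d_n}\,g_i'(t)\,dt\quad\text{with}\quad d_j\in\mathbb Z_+,\ \max_{1\le j\le n}d_j\le\widetilde N,\quad 1\le i\le n .$$
   Context: $\mathbb Z_+$ denotes the nonnegative integers. A moment from Lipschitz functions $g_1,\dots,g_n$ on $[a,b]$ is an expression $\int_a^b g_1(t)^{d_1}\cdots g_n(t)^{d_n}g_i'(t)\,dt$ with $1\le i\le n$ and all $d_j\in\mathbb Z_+$. ''Coefficients depending on $\Gamma_F$ only'' means: for each moment (i.e. each choice of exponents and of $i$), the coefficients and the $m$ moments used do not depend on $G$. A compact set $\Gamma\subset\mathbb R^n$ is a Lipschitz triangulable curve if it is the union of finitely many arcs $\gamma_i$ such that for $i\ne j$ the intersection $\gamma_i\cap\gamma_j$ is either empty or consists of at most one of their endpoints, and each $\gamma_i$ is parameterized by a Lipschitz map $h_i:[0,1]\to\gamma_i\subset\mathbb R^n$ whose inverse $h_i^{-1}:\gamma_i\to[0,1]$ is locally Lipschitz apart from the endpoints. Such a family $\{h_i\}$ is said to form a triangulation of $\Gamma$. All cubes have sides parallel to the coordinate axes; the radius of a cube is half of its sidelength. For a cube $K_i$ with center $c_i$, $\frac12K_i:=\frac12(K_i-c_i)+c_i$. Definition of $\bar N_{\mathcal T}$. Let $r_i$ be the radius of $K_i$ and let $l_i$ be the linear measure of the set $\pi_{s_i}\bigl(\frac12K_i\cap\gamma_i\bigr)$.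 Put $r_{\mathcal T}:=\min_{1\le i\le k}r_i$, $l_{\mathcal T}:=\min_{1\le i\le k}l_i$ (which is $>0$). Let $L_i:=\int_0^1\|h_i'(t)\|_{\ell_1^n}\,dt$, where $\|(x_1,\dots,x_n)\|_{\ell_1^n}:=\sum_{j=1}^n|x_j|$, and $L_{\mathcal T}:=\max_{1\le i\le k}L_i$. Let $d_{\Gamma_F}$ be the radius of the minimal closed cube containing $C$. Then $$\bar N_{\mathcal T}:=\left\lfloor\frac{2\pi n\,L_{\mathcal T}\,d_{\Gamma_F}}{r_{\mathcal T}\,l_{\mathcal T}}\right\rfloor+1 .$$ *)

(* Defs.v *)
From HB Require Import structures.
From mathcomp Require Export all_boot all_order all_algebra.
From mathcomp Require Export all_classical all_reals all_analysis.

Set Implicit Arguments.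
Unset Strict Implicit.
Unset Printing Implicit Defensive.

Import Order.TTheory GRing.Theory Num.Theory.
Import numFieldNormedType.Exports.

Local Open Scope classical_set_scope.
Local Open Scope ring_scope.

(* A map from the standard simplex (or from [0, 1]) to a subset [X] of a space
   [T] is represented by a total function, of which only the restriction to the
   simplex matters: the notions below never depend on the other values. *)

Section AlgebraicTopology.
Context {R : realType} {T : topologicalType}.
Implicit Types (X : set T) (x : T) (f g : R -> T).

Definition path_in X f : Prop :=
  {within `[0, 1], continuous f} /\ f @` `[0, 1] `<=` X.

Definition loop_at X x f : Prop := [/\ path_in X f, f 0 = x & f 1 = x].

Definition loop_mul f g : R -> T :=
  fun t => if t <= 2^-1 then f (2 * t) else g (2 * t - 1).

(* Homotopy of loops relative to the endpoints; in [H (s, t)], [s] is the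
   parameter along the loop and [t] is the time of the deformation. *)
Definition loop_homotopic X x f g : Prop :=
  exists H : R * R -> T,
    [/\ {within `[0, 1] `*` `[0, 1], continuous H},
        H @` (`[0, 1] `*` `[0, 1]) `<=` X,
        forall s, s \in `[0, 1] -> H (s, 0) = f s /\ H (s, 1) = g s
      & forall t, t \in `[0, 1] -> H (0, t) = x /\ H (1, t) = x].

(* The free group on [I] is the set of words in the letters [(i, true)] (the
   generator i) and [(i, false)] (its inverse), modulo [free_equiv], with
   concatenation as product. *)
Inductive free_equiv (I : Type) : seq (I * bool) -> seq (I * bool) -> Prop :=
| free_refl u : free_equiv u u
| free_sym u v : free_equiv u v -> free_equiv v u
| free_trans u v w : free_equiv u v -> free_equiv v w -> free_equiv u w
| free_cancel u v i b : free_equiv (u ++ (i, b) :: (i, ~~ b) :: v) (u ++ v).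

(* The group pi_1(X, x) (loops modulo homotopy, with product [loop_mul]) is
   isomorphic to the free group with m generators.  [Phi] is the isomorphism,
   given on representatives: the third clause says that it is well defined and
   injective on classes, the fourth one that it is surjective. *)
Definition pi1_isom_free X x (m : nat) : Prop :=
  exists Phi : seq ('I_m * bool) -> R -> T,
    [/\ forall w, loop_at X x (Phi w),
        forall u v,
          loop_homotopic X x (Phi (u ++ v)) (loop_mul (Phi u) (Phi v)),
        forall u v, loop_homotopic X x (Phi u) (Phi v) <-> free_equiv u v
      & forall f, loop_at X x f -> exists w, loop_homotopic X x f (Phi w)].

(* Singular chains are formal integer combinations of singular simplices,
   represented as finitely supported integer functions on simplices:
   [simplex0 x] and [simplex1 f] are the basis elements x and f. *)
Definition simplex0 x : T -> int := fun y => Posz `[< x = y >].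

Definition simplex1 f : (R -> T) -> int :=
  fun g => Posz `[< {in `[0, 1], f =1 g} >].

Definition triangle : set (R * R) :=
  [set u | [/\ 0 <= u.1, 0 <= u.2 & u.1 + u.2 <= 1]].

Definition singular2 X (tau : R * R -> T) : Prop :=
  {within triangle, continuous tau} /\ tau @` triangle `<=` X.

Definition boundary1 f : T -> int := simplex0 (f 1) - simplex0 (f 0).

Definition boundary2 (tau : R * R -> T) : (R -> T) -> int :=
  simplex1 (fun t => tau (1 - t, t)) - simplex1 (fun t => tau (0, t))
  + simplex1 (fun t => tau (t, 0)).

Definition is_boundary X (z : (R -> T) -> int) : Prop :=
  exists (q : nat) (b : 'I_q -> int) (tau : 'I_q -> R * R -> T),
    (forall l, singular2 X (tau l)) /\
    z = \sum_(l < q) boundary2 (tau l) *~ b l.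

(* The classes of the closed curves c_1, ..., c_m generate the (integral)
   singular homology group H_1(X): every singular 1-cycle
   a_1 f_1 + ... + a_p f_p of X is homologous to an integer combination of
   the cycles c_j. *)
Definition generate_H1 X (m : nat) (c : 'I_m -> R -> T) : Prop :=
  forall (p : nat) (a : 'I_p -> int) (f : 'I_p -> R -> T),
    (forall i, path_in X (f i)) ->
    \sum_(i < p) boundary1 (f i) *~ a i = 0 ->
    exists e : 'I_m -> int,
      is_boundary X (\sum_(i < p) simplex1 (f i) *~ a i
                     - \sum_(j < m) simplex1 (c j) *~ e j).

End AlgebraicTopology.

(* R^n is ['rV[R]_n]; the library norm is the maximum norm, which defines the
   same Lipschitz maps as the Euclidean one. *)

Section LipschitzCurves.
Context {R : realType} {n : nat}.
Implicit Types (G h : R -> 'rV[R]_n) (X : set 'rV[R]_n).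

Definition lipschitz_map (a b : R) G : Prop := [lipschitz G t | t in `[a, b]].

Definition simple_closed_lipschitz h : Prop :=
  [/\ lipschitz_map 0 1 h, h 0 = h 1 & {in `[0, 1[ &, injective h}].

Definition lipschitz_arc h : Prop :=
  [/\ lipschitz_map 0 1 h, {in `[0, 1] &, injective h}
    & [locally [lipschitz pinv (`[0, 1] : set R) h x
               | x in (h @` `[0, 1]) `\` [set h 0; h 1]]]].

(* Two distinct arcs meet at most in one point, an endpoint of both. *)
Definition lipschitz_triangulation (k : nat) (h : 'I_k -> R -> 'rV[R]_n) X
    : Prop :=
  [/\ forall i, lipschitz_arc (h i),
      X = \bigcup_(i in [set: 'I_k]) (h i @` `[0, 1])
    & forall i j, i != j ->
        let I := (h i @` `[0, 1]) `&` (h j @` `[0, 1]) in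
        I = set0 \/
        exists p, [/\ I = [set p], [set h i 0; h i 1] p & [set h j 0; h j 1] p]].

Definition lipschitz_triangulable X : Prop :=
  compact X /\
  exists (k : nat) (h : 'I_k -> R -> 'rV[R]_n), lipschitz_triangulation h X.

(* The derivative exists almost everywhere on [a, b] when G is Lipschitz there;
   the conventional value of [derive1] elsewhere does not affect integrals. *)
Definition moment (a b : R) G (d : {ffun 'I_n -> nat}) (i : 'I_n) : R :=
  \int[lebesgue_measure]_(t in `[a, b])
    ((\prod_(j < n) G t 0 j ^+ d j) * derive1 (fun u => G u 0 i) t).

Definition cube (c : 'rV[R]_n) (r : R) : set 'rV[R]_n :=
  [set x | forall j, `|x 0 j - c 0 j| < r].

Definition closed_cube (c : 'rV[R]_n) (r : R) : set 'rV[R]_n :=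
  [set x | forall j, `|x 0 j - c 0 j| <= r].

Definition axis_proj (s : 'I_n) (x : 'rV[R]_n) : 'rV[R]_n :=
  \row_j (if j == s then x 0 j else 0).

(* Linear measure of a subset of the s-th coordinate axis. *)
Definition axis_measure (s : 'I_n) (A : set 'rV[R]_n) : R :=
  fine (lebesgue_measure [set x 0 s | x in A]).

Definition l1_length h : R :=
  \int[lebesgue_measure]_(t in `[0, 1])
    (\sum_(j < n) `|derive1 (fun u => h u 0 j) t|).

Definition min_cube_radius X : R :=
  inf [set r : R | 0 <= r /\ exists c, X `<=` closed_cube c r].

(* [inf] and [sup] are taken over finite families, so they are the minimum and
   the maximum; (1/2) K_i is the cube with center c_i and radius r_i / 2. *)
Definition Nbar (k : nat) (X : set 'rV[R]_n) (h : 'I_k -> R -> 'rV[R]_n)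
    (c : 'I_k -> 'rV[R]_n) (r : 'I_k -> R) (s : 'I_k -> 'I_n) : int :=
  let l i := axis_measure (s i)
    (axis_proj (s i) @` (cube (c i) (r i / 2) `&` (h i @` `[0, 1]))) in
  let rT := inf (range r) in
  let lT := inf (range l) in
  let LT := sup (range (fun i => l1_length (h i))) in
  Num.floor (2 * pi * n%:R * LT * min_cube_radius X / (rT * lT)) + 1.

End LipschitzCurves.

(* Main.v *)
Require Import Defs.
From HB Require Import structures.
From mathcomp Require Import measurable_realfun ring lra zify.
Import Order.TTheory GRing.Theory Num.Theory.
Import numFieldNormedType.Exports.
Local Open Scope classical_set_scope.
Local Open Scope ring_scope.
Set Implicit Arguments.
Unset Strict Implicit.
Unset Printing Implicit Defensive.

(** Each moment is the value on Lipschitz paths of a real singular 1-cocycle of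
    Gamma, so its values on loops are determined by those on c_1, ..., c_m; it is
    enough to find m moments of degree at most Nbar whose matrix on the c_j is
    invertible, that is, to show that no nontrivial combination of the c_j
    annihilates all of them.  For cocycles, such a combination is equivalent to a
    combination of the arcs h_i, with coefficients alpha_i.  Integrate over it the
    1-form whose s-th coefficient is a signed sum of bumps supported in the cubes
    K_i with s_i = s: by injectivity of the projections, the result is at least
    the sum of the |alpha_i| l_i.  A polynomial of degree at most N in each
    variable approximates an M-Lipschitz function on a cube of radius d within
    n M d pi / (N + 2) (product Korovkin kernels), so the result is also at most
    the sum of the |alpha_i| times a number smaller than l_T as soon as N = Nbar.
    Hence all alpha_i vanish, and so do all the cocycles of the combination,
    among them the exponent sums of the free group pi_1(Gamma); the latter
    separate the c_j because these generate H_1(Gamma). *)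

Lemma stieltjes_null_dominates (R : realType) (g : cumulative R R) (M : R) :
  0 < M -> (forall x y, x <= y -> g y - g x <= M * (y - x)) ->
  lebesgue_stieltjes_measure g `<< @lebesgue_measure R.
Proof.
move=> M0 gM; apply/null_content_dominatesP => A mA A0.
apply/eqP; rewrite eq_le measure_ge0 andbT.
apply/lee_addgt0Pr => e e0; rewrite add0e.
have eM : 0 < e / M by rewrite divr_gt0.
have : (ereal_inf [set (\sum_(0 <= k <oo) wlength (R := R) idfun (B k))%E
   | B in measurable_cover (T := ocitv_type R) A] < (e / M)%:E)%E.
  have -> : ereal_inf [set (\sum_(0 <= k <oo) wlength (R := R) idfun (B k))%E
     | B in measurable_cover (T := ocitv_type R) A] = 0%E := A0.
  by rewrite lte_fin.
move=> /ereal_inf_lt[_ [B cB <-] Be].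
rewrite /lebesgue_stieltjes_measure /measure_extension /mu_ext.
apply: ge_ereal_inf; exists (\sum_(0 <= k <oo) wlength (R := R) g (B k))%E; first by exists B.
have -> : e = M * (e / M) by rewrite mulrC divfK ?gt_eqF.
apply: (@le_trans _ _ (M%:E * \sum_(0 <= k <oo) wlength (R := R) idfun (B k))%E); last first.
  by rewrite EFinM lee_pmul2l ?lte_fin// ltW.
rewrite -nneseriesZl//.
apply: lee_nneseries => i _; first by move=> _; apply: wlength_ge0.
have [mB _] := cB; have := mB i.
rewrite /measurable /= => /ocitvP[->|[x xy ->]].
  by rewrite !wlength0 mule0.
rewrite (wlength_itv_bnd g _ _ (ltW xy)) (wlength_itv_bnd idfun _ _ (ltW xy)).
by rewrite -EFinM lee_fin; apply: gM; rewrite ltW.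
Qed.

(* No measurability is assumed of [f] and [g]: the lemma is meant for the
   pointwise derivative of a Lipschitz function. *)
Section integral_off_null.
Import HBNNSimple.

Lemma integral_eq_off_null d (T : measurableType d) (R : realType)
    (mu : {measure set T -> \bar R}) (D N : set T) (f g : T -> \bar R) :
  measurable N -> mu N = 0%E -> (forall x, D x -> ~ N x -> f x = g x) ->
  (\int[mu]_(x in D) f x = \int[mu]_(x in D) g x)%E.
Proof.
move=> mN N0 fg.
have H : forall F G : T -> \bar R, (forall x, (0 <= G x)%E) ->
  (forall x, ~ N x -> F x = G x) ->
  (ereal_sup [set sintegral mu h | h in [set h : {nnsfun T >-> R} | forall x, (h x)%:E <= F x]] <=
  ereal_sup [set sintegral mu h | h in [set h : {nnsfun T >-> R} | forall x, (h x)%:E <= G x]])%E.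
  move=> F G G0 FG; apply: ge_ereal_sup => _ [h hF <-].
  have mNC : measurable (~` N) by exact: measurableC.
  pose h' := proj_nnsfun h mNC.
  have -> : sintegral mu h = sintegral mu h'.
    rewrite -!integralT_nnsfun; apply: ae_eq_integral => //.
    - by apply/measurable_EFinP; exact: measurable_funP.
    - by apply/measurable_EFinP; exact: measurable_funP.
    - exists N; split => // x /= /not_implyP[_ hx]; apply: contrapT => Nx; apply: hx.
      by rewrite /h' /= mindicE mem_set// mulr1.
  apply: ereal_sup_ubound; exists h' => //= x.
  rewrite /h' /= mindicE; have [xN|xN] := boolP (x \in ~` N).
    by rewrite mulr1 -FG; [exact: hF|rewrite inE in xN].
  by rewrite mulr0 G0.
have E : forall F G : T -> \bar R, (forall x, (0 <= G x)%E) -> (forall x, (0 <= F x)%E) ->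
  (forall x, ~ N x -> F x = G x) ->
  (ereal_sup [set sintegral mu h | h in [set h : {nnsfun T >-> R} | forall x, (h x)%:E <= F x]] =
  ereal_sup [set sintegral mu h | h in [set h : {nnsfun T >-> R} | forall x, (h x)%:E <= G x]])%E.
  move=> F G F0 G0 FG; apply/eqP; rewrite eq_le; apply/andP; split; apply: H => //.
  by move=> x /FG.
have P x : ~ N x -> (f \_ D) x = (g \_ D) x.
  by move=> Nx; rewrite !patchE; case: ifPn => //; rewrite inE => Dx; exact: fg.
rewrite /integral; congr (_ - _)%E; apply: E => // x Nx.
- by rewrite !funeposE P.
- by rewrite !funenegE P.
Qed.

End integral_off_null.

(* Adding [2 M (x - a)] makes [u] increasing; after normalization it is the
   distribution function of a measure dominated by the Lebesgue measure, whose
   Radon-Nikodym derivative gives back [u'] almost everywhere. *)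
Lemma lipschitz_derive_density (R : realType) (a b M : R) (u : R -> R) :
  a < b -> 0 < M ->
  (forall x y, x \in `[a, b] -> y \in `[a, b] -> `|u y - u x| <= M * `|y - x|) ->
  exists (f : R -> R) (N : set R) (C : R),
    [/\ lebesgue_measure.-integrable `[a, b] (EFin \o f),
        measurable N /\ lebesgue_measure N = 0%E,
        forall t, a < t < b -> ~ N t -> derive1 u t = f t &
        forall x y, a <= x -> x <= y -> y <= b ->
        \int[lebesgue_measure]_(t in `[x, y]) f t = u y - u x /\
        \int[lebesgue_measure]_(t in `[x, y]) `|f t| <= C * (y - x)].
Proof.
move=> ab M0 uM.
pose cl x := Num.max a (Num.min b x).
have clab x : cl x \in `[a, b].
  by rewrite /cl in_itv /= le_max lexx /= ge_max (ltW ab) /= ge_min lexx.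
have clid x : x \in `[a, b] -> cl x = x.
  by rewrite /cl in_itv /= => /andP[ax xb]; rewrite (min_idPr _)// (max_idPr _).
have cl_homo x y : x <= y -> 0 <= cl y - cl x <= y - x.
  rewrite /cl => xy.
  case: (leP b x) => ?; case: (leP b y) => ?; case: (leP a b) => ?;
    case: (leP a x) => ?; case: (leP a y) => ?; lra.
pose D := u b - u a + 2 * M * (b - a).
have aab : a \in `[a, b] by rewrite in_itv /= lexx ltW.
have bab : b \in `[a, b] by rewrite in_itv /= lexx ltW.
have D0 : 0 < D.
  have := uM _ _ aab bab; rewrite (gtr0_norm (x := b - a)) ?subr_gt0// ler_norml => /andP[h _].
  have : 0 < M * (b - a) by rewrite mulr_gt0// subr_gt0.
  by rewrite /D; lra.
pose g x := (u (cl x) - u a + 2 * M * (cl x - a)) / D.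
have gE x : x \in `[a, b] -> D * g x = u x - u a + 2 * M * (x - a).
  by move=> xab; rewrite /g clid// mulrCA divff ?gt_eqF// mulr1.
have g_inc x y : x <= y -> 0 <= g y - g x <= 3 * M / D * (y - x).
  move=> xy; have /andP[c0 c1] := cl_homo _ _ xy.
  have := uM _ _ (clab x) (clab y); rewrite (ger0_norm c0) ler_norml => /andP[h1 h2].
  have -> : g y - g x = ((u (cl y) - u (cl x)) + 2 * M * (cl y - cl x)) / D.
    by rewrite /g -mulrBl; congr (_ / _); ring.
  have M1 : 0 <= M * (cl y - cl x) by rewrite mulr_ge0// ltW.
  have M2 : M * (cl y - cl x) <= M * (y - x) by rewrite ler_wpM2l// ltW.
  apply/andP; split; first by apply: divr_ge0; [lra|exact: ltW].
  by rewrite [leRHS]mulrAC ler_wpM2r ?invr_ge0 ?(ltW D0)//; lra.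
have K0 : 0 < 3 * M / D by rewrite divr_gt0// mulr_gt0.
have g_cont : continuous g.
  move=> x; apply/cvgrPdist_le => e e0; near=> y.
  have yx : 3 * M / D * `|x - y| <= e.
    rewrite mulrC -ler_pdivlMr//; near: y.
    by apply: cvgr_dist_le => //; rewrite divr_gt0.
  apply: le_trans yx; have [xy|/ltW yx] := leP x y.
    have /andP[h1 h2] := g_inc _ _ xy.
    by rewrite distrC (ger0_norm h1) distrC (ger0_norm (x := y - x)) ?subr_ge0.
  have /andP[h1 h2] := g_inc _ _ yx.
  by rewrite (ger0_norm h1) (ger0_norm (x := x - y)) ?subr_ge0.
have g_nd : nondecreasing g.
  by move=> x y /g_inc/andP[]; rewrite subr_ge0.
have gNy : g @ -oo --> (0 : R).
  apply: cvg_near_cst; near=> x.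
  rewrite /g; have -> : cl x = a.
    have xa : x <= a by near: x; apply: nbhs_ninfty_le; exact: num_real.
    by rewrite /cl (min_idPr _) ?(le_trans xa) ?(ltW ab)// (max_idPl _).
  by rewrite !subrr mulr0 addr0 mul0r.
have gy : g @ +oo --> (1 : R).
  apply: cvg_near_cst; near=> x.
  rewrite /g; have -> : cl x = b.
    have xa : b <= x by near: x; apply: nbhs_pinfty_ge; exact: num_real.
    by rewrite /cl (min_idPl _)// (max_idPr _) ?ltW.
  by rewrite /D divff ?gt_eqF.
pose G : cumulativeBounded (0:R) (1:R) := HB.pack g
  (isCumulative.Build R _ R g g_nd (right_continuousW g_cont))
  (isCumulativeBounded.Build R 0 1 g gNy gy).
have Gdom : lebesgue_stieltjes_measure G `<< @lebesgue_measure R.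
  apply: (stieltjes_null_dominates K0) => x y xy.
  by have /andP[] := g_inc _ _ xy.
have [phi [phi0 phifin phiint phiE]] := radon_nikodym_sigma_finite
  (mu := @lebesgue_measure R) (nu := lebesgue_stieltjes_measure G) Gdom.

pose f0 := fine \o phi.
have f0E : EFin \o f0 = phi by apply/funext => x; rewrite /f0 /= fineK.
have if0 : lebesgue_measure.-integrable setT (EFin \o f0) by rewrite f0E.
have mI (i : interval R) : measurable [set` i] by exact: measurable_itv.
have ifi (i : interval R) : lebesgue_measure.-integrable [set` i] (EFin \o f0).
  exact: integrableS if0.
have f0int x y : x <= y -> \int[lebesgue_measure]_(t in `]x, y]) f0 t = g y - g x.
  move=> xy; rewrite /Rintegral.
  have -> : (\int[lebesgue_measure]_(t in `]x, y]) (f0 t)%:E)%E =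
     (\int[lebesgue_measure]_(t in `]x, y]) phi t)%E.
    by rewrite -f0E.
  rewrite -phiE//= /lebesgue_stieltjes_measure /measure_extension.
  rewrite measurable_mu_extE/=; last exact: is_ocitv.
  by rewrite (wlength_itv_bnd g _ _ xy).
pose F x := \int[lebesgue_measure]_(t in `]-oo, x]) f0 t.
have FE x : a <= x -> F x = g x - g a + F a.
  move=> ax; rewrite -f0int// -(@Rintegral_itvB _ f0 -oo%O (BRight x) a)//.
  by rewrite subrK.
have icst r x y : lebesgue_measure.-integrable `[x, y] (EFin \o (fun _ : R => r)).
  apply: continuous_compact_integrable; first exact: segment_compact.
  by apply: continuous_subspaceT => z; exact: cvg_cst.
have idc r x y : lebesgue_measure.-integrable `[x, y] (EFin \o (fun t : R => D * f0 t + r)).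
  apply/(eq_integrable _ (fun t => D%:E * (EFin \o f0) t + r%:E)%E) => //.
  apply: integrableD => //; first by apply: integrableZl.
  exact: icst.
have [N [mN N0 NF]] := FTC1Ny (fun y => ifi `]-oo, y]) (open_integrable_locally openT if0).
exists (fun t => D * f0 t - 2 * M), N, (5 * M); split => //.
- move=> t /andP[at_ tb] Nt.
  have [dF FfE] : derivable F t 1 /\ derive1 F t = f0 t.
    by apply: contrapT => h; apply: Nt; exact: NF.
  have dE : is_derive t 1 F (f0 t) by apply: (DeriveDef dF); rewrite -derive1E FfE.
  rewrite derive1E (@near_eq_derive _ _ _ _ (fun x => D * F x + (u a + 2 * M * a - D * F a) - 2 * M * x)); last first.
    near=> x.
    have /andP[/ltW ax /ltW xb] : a < x < b.
      have : x \in `]a, b[ by near: x; apply: near_in_itvoo; rewrite in_itv /= at_ tb.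
      by rewrite in_itv.
    have xab : x \in `[a, b] by rewrite in_itv /= ax xb.
    by rewrite FE// mulrDr mulrBr !gE//; lra.
  have h := is_deriveB (is_deriveD (is_deriveZ D dE) (is_derive_cst (u a + 2 * M * a - D * F a) t 1))
     (is_deriveZ (2 * M) (is_derive_id t 1)).
  transitivity (D *: f0 t + 0 - (2 * M) *: (1 : R)); last by rewrite addr0 /GRing.scale /= mulr1.
  exact: (@derive_val _ _ _ _ _ _ _ h).
- move=> x y ax xy yb.
  have xab : x \in `[a, b] by rewrite in_itv /= ax (le_trans xy).
  have yab : y \in `[a, b] by rewrite in_itv /= yb (le_trans ax).
  have icf : lebesgue_measure.-integrable `[x, y] (EFin \o (fun t : R => D * f0 t)).
    by apply/(eq_integrable _ (fun t => D%:E * (EFin \o f0) t)%E) => //; apply: integrableZl.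
  have c1 : \int[lebesgue_measure]_(t in `[x, y]) (2 * M) = 2 * M * (y - x).
    rewrite Rintegral_cst//= lebesgue_measure_itv /= lte_fin; case: ltP => // yx.
    have -> : x = y by apply/eqP; rewrite eq_le xy yx.
    by rewrite subrr.
  have c2 : \int[lebesgue_measure]_(t in `[x, y]) (D * f0 t) = D * (g y - g x).
    by rewrite RintegralZl// -f0int// Rintegral_itv_obnd_cbnd.
  have c3 : D * (g y - g x) = u y - u x + 2 * M * (y - x).
    by rewrite mulrBr !gE//; lra.
  split; first by rewrite RintegralB// c1 c2 c3; lra.
  apply: (@le_trans _ _ (\int[lebesgue_measure]_(t in `[x, y]) (D * f0 t + 2 * M))).
    apply: le_Rintegral => //.
    + apply: (integrable_norm (f := fun t => D * f0 t - 2 * M)).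
    + exact: idc.
    + move=> t _; rewrite ler_norml.
      have : 0 <= D * f0 t by rewrite mulr_ge0 ?(ltW D0)// fine_ge0.
      by move=> ?; apply/andP; split; lra.
  rewrite RintegralD// c1 c2 c3.
  have := uM _ _ xab yab; rewrite (ger0_norm (x := y - x)) ?subr_ge0// ler_norml => /andP[h1 h2].
  lra.
Unshelve. all: by end_near. Qed.

(** * Line integrals along Lipschitz curves *)

Definition lip (R : realType) (V : normedModType R) (a b M : R) (g : R -> V) :=
  forall x y, x \in `[a, b] -> y \in `[a, b] -> `|g y - g x| <= M * `|y - x|.

Lemma lipschitz_mapP (R : realType) (n : nat) (a b : R) (G : R -> 'rV[R]_n) :
  lipschitz_map a b G <-> exists2 M, 0 < M & lip a b M G.
Proof.
split.
  rewrite /lipschitz_map /lipschitz_on => GL.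
  near (pinfty_nbhs R) => M; exists M => // x y xab yab.
  have : dominated_by (self_sub id) M (self_sub G) (globally (`[a, b] `*` `[a, b])).
    by near: M.
  by move=> /(_ (y, x)) /=; apply; split => /=.
move=> [M M0 GM]; rewrite /lipschitz_map /lipschitz_on; near=> K.
move=> [x y] /= [xab yab]; apply: le_trans (GM _ _ yab xab) _.
by rewrite ler_wpM2r//; near: K; apply: nbhs_pinfty_ge; exact: num_real.
Unshelve. all: by end_near. Qed.

Lemma norm_coord_le (R : realType) (n : nat) (x : 'rV[R]_n) (s : 'I_n) :
  `|x 0 s| <= `|x|.
Proof.
rewrite [leRHS]/Num.Def.normr /= mx_normrE.
exact: (le_bigmax _ (fun ij : 'I_1 * 'I_n => `|x ij.1 ij.2|) (0, s)).
Qed.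

Lemma norm_le_coord (R : realType) (n : nat) (x : 'rV[R]_n) (e : R) :
  0 <= e -> (forall s, `|x 0 s| <= e) -> `|x| <= e.
Proof.
move=> e0 xe; rewrite [leLHS]/Num.Def.normr /= mx_normrE.
by apply/bigmax_leP; split=> // -[i j] _ /=; rewrite ord1.
Qed.

Lemma lip_coord (R : realType) (n : nat) (a b M : R) (G : R -> 'rV[R]_n) (s : 'I_n) :
  lip a b M G -> lip a b M (fun t => G t 0 s).
Proof.
move=> GM x y xab yab; apply: le_trans (GM _ _ xab yab).
by have := norm_coord_le (G y - G x) s; rewrite !mxE.
Qed.

Lemma within_continuousP (R : realType) (U V : normedModType R) (A : set U) (f : U -> V) :
  {within A, continuous f} <->
  forall x, A x -> forall e, 0 < e ->
    exists2 d, 0 < d & forall y, A y -> `|x - y| < d -> `|f x - f y| < e.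
Proof.
split.
  move=> /subspace_continuousP fc x Ax e e0.
  have := fc x Ax => /cvgrPdist_lt /(_ e e0).
  rewrite near_withinE => /nbhs_normP[d /= d0 H].
  by exists d => // y Ay xy; apply: H.
move=> H; apply/subspace_continuousP => x Ax.
apply/cvgrPdist_lt => e e0; have [d d0 Hd] := H x Ax e e0.
rewrite near_withinE; apply/nbhs_normP; exists d => //= y xy Ay.
exact: Hd.
Qed.

Lemma lip_within_continuous (R : realType) (V : normedModType R) (a b M : R) (g : R -> V) :
  0 < M -> lip a b M g -> {within `[a, b], continuous g}.
Proof.
move=> M0 gM; apply/within_continuousP => x xab e e0.
exists (e / M) => [|y yab xy]; first by rewrite divr_gt0.
apply: le_lt_trans (gM y x yab xab) _.
by rewrite mulrC -ltr_pdivlMr.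
Qed.

(* [W] is a primitive of the Stieltjes form w du.  The quadratic error term
   determines [W] up to a constant, and is preserved by Lipschitz changes of
   parameter. *)
Definition is_prim (R : realType) (a b : R) (w u W : R -> R) :=
  exists C, forall x y, x \in `[a, b] -> y \in `[a, b] ->
    `|W y - W x - w x * (u y - u x)| <= C * (y - x) ^+ 2.

Lemma quad_const (R : realType) (a b C eta : R) (D : R -> R) : a <= b -> 0 < eta ->
  (forall x y, a <= x -> x <= y -> y <= b -> y - x < eta ->
     `|D y - D x| <= C * (y - x) ^+ 2) -> D b = D a.
Proof.
move=> ab eta0 DC; apply/eqP; rewrite -subr_eq0 -normr_le0.
apply/ler_addgt0Pr => e e0; rewrite add0r.
pose N := (Num.trunc ((b - a) / eta) + Num.trunc (`|C| * (b - a) ^+ 2 / e)).+1.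
have N0 : 0 < N%:R :> R by rewrite ltr0n.
have N1 : (b - a) / N%:R < eta.
  rewrite ltr_pdivrMr// mulrC -ltr_pdivrMr//; apply: lt_le_trans (truncnS_gt _) _.
  by rewrite ler_nat /N ltnS leq_addr.
have N2 : `|C| * (b - a) ^+ 2 / N%:R <= e.
  rewrite ler_pdivrMr// [leRHS]mulrC -ler_pdivrMr//; apply: ltW; apply: lt_le_trans (truncnS_gt _) _.
  by rewrite ler_nat /N ltnS leq_addl.
pose t i := a + (b - a) * i%:R / N%:R.
have tS i : t i.+1 - t i = (b - a) / N%:R by rewrite /t -natr1; ring.
have -> : D b - D a = \sum_(0 <= i < N) (D (t i.+1) - D (t i)).
  rewrite (@telescope_sumr _ _ _ (D \o t))//= /t mulr0 mul0r addr0 mulfK ?gt_eqF//.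
  by rewrite [a + _]addrC subrK.
apply: le_trans (ler_norm_sum _ _ _) _.
apply: le_trans N2; rewrite big_mkord.
have -> : `|C| * (b - a) ^+ 2 / N%:R = \sum_(i < N) (`|C| * ((b - a) / N%:R) ^+ 2).
  rewrite sumr_const card_ord -mulr_natr expr_div_n.
  by field; rewrite gt_eqF.
apply: ler_sum => i _; rewrite -(tS i).
have st : 0 <= t i.+1 - t i by rewrite tS divr_ge0// subr_ge0.
apply: le_trans (DC _ _ _ _ _ _) _.
- by rewrite /t lerDl divr_ge0// mulr_ge0// subr_ge0.
- by rewrite -subr_ge0.
- rewrite /t -lerBrDl -mulrA ler_piMr ?subr_ge0// ler_pdivrMr// mul1r ler_nat.
  exact: ltn_ord.
- by rewrite tS.
- by rewrite ler_wpM2r ?sqr_ge0// ler_norm.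
Qed.

Lemma is_prim_unique (R : realType) (a b : R) (w u W W' : R -> R) : a <= b ->
  is_prim a b w u W -> is_prim a b w u W' -> W b - W a = W' b - W' a.
Proof.
move=> ab [C H] [C' H'].
suff : (W \- W') b = (W \- W') a by rewrite /=; lra.
apply: (quad_const (eta := 1) (C := C + C') ab) => // x y ax xy yb _.
have xab : x \in `[a, b] by rewrite in_itv /= ax (le_trans xy).
have yab : y \in `[a, b] by rewrite in_itv /= yb (le_trans ax).
have -> : (W \- W') y - (W \- W') x =
  (W y - W x - w x * (u y - u x)) - (W' y - W' x - w x * (u y - u x)) by rewrite /=; ring.
rewrite mulrDl; apply: le_trans (ler_normB _ _) _.
by apply: lerD; [exact: H|exact: H'].
Qed.

Lemma is_prim_comp (R : realType) (a b c d K M S : R) (w u W s : R -> R) :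
  0 <= K -> 0 <= M -> lip a b K w -> lip a b M u ->
  (forall t, t \in `[c, d] -> s t \in `[a, b]) -> lip c d S s ->
  is_prim a b w u W -> is_prim c d (w \o s) (u \o s) (W \o s).
Proof.
move=> K0 M0 wK uM sab sS [C H]; exists (`|C| * S ^+ 2) => x y xcd ycd /=.
apply: le_trans (H _ _ (sab _ xcd) (sab _ ycd)) _.
rewrite -mulrA; apply: le_trans (ler_wpM2r (sqr_ge0 _) (ler_norm C)) _.
rewrite ler_wpM2l// -exprMn -[leLHS]real_normK ?num_real// -[leRHS]real_normK ?num_real//.
rewrite ler_sqr ?nnegrE// normrM.
apply: le_trans (sS _ _ xcd ycd) _.
by rewrite ler_wpM2r// ler_norm.
Qed.

Lemma is_prim_comb (R : realType) (I : finType) (a b : R) (l : I -> R) (w W : I -> R -> R) (u : R -> R) :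
  (forall i, is_prim a b (w i) u (W i)) ->
  is_prim a b (fun t => \sum_i l i * w i t) u (fun t => \sum_i l i * W i t).
Proof.
move=> /choice[C H]; exists (\sum_i `|l i| * C i) => x y xab yab.
have -> : \sum_i l i * W i y - \sum_i l i * W i x - (\sum_i l i * w i x) * (u y - u x) =
   \sum_i l i * (W i y - W i x - w i x * (u y - u x)).
  rewrite mulr_suml -!sumrB; apply: eq_bigr => i _; ring.
apply: le_trans (ler_norm_sum _ _ _) _.
rewrite mulr_suml; apply: ler_sum => i _.
by rewrite normrM -mulrA ler_wpM2l// H.
Qed.

Definition cint (R : realType) (n : nat) (phi : 'rV[R]_n -> R) (s : 'I_n) (a b : R)
    (g : R -> 'rV[R]_n) : R :=
  \int[lebesgue_measure]_(t in `[a, b]) (phi (g t) * derive1 (fun u => g u 0 s) t).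

Section LipschitzIntegrals.
Context {R : realType}.
Local Notation mu := (@lebesgue_measure R).

Lemma integrable_lip_mul (a b K : R) (w f : R -> R) : 0 < K ->
  lip a b K w -> mu.-integrable `[a, b] (EFin \o f) ->
  mu.-integrable `[a, b] (EFin \o (fun t => w t * f t)).
Proof.
move=> K0 wK intf.
have wc := lip_within_continuous K0 wK.
apply: (@integrableMr _ (measurableTypeR R) R mu `[a, b]%classic _ w (EFin \o f)) => //.
- by apply: subspace_continuous_measurable_fun.
- have := continuous_compact wc (segment_compact (a := a) (b := b)).
  move=> /compact_bounded; rewrite /bounded_set /bounded_near.
  apply: filterS => M H x xab; apply: H; exact: imageP.
Qed.

Lemma integrable_scale (D : set R) (c : R) (f : R -> R) : measurable D ->
  mu.-integrable D (EFin \o f) -> mu.-integrable D (EFin \o (fun t => c * f t)).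
Proof. move=> mD intf; exact: (@integrableZl _ (measurableTypeR R) R mu D mD c (EFin \o f)). Qed.

Lemma Rintegral_eq_off_null (N D : set R) (f g : R -> R) : measurable N -> mu N = 0%E ->
  (forall x, D x -> ~ N x -> f x = g x) ->
  \int[mu]_(x in D) f x = \int[mu]_(x in D) g x.
Proof.
move=> mN N0 fg; rewrite /Rintegral; congr fine.
by apply: (@integral_eq_off_null _ (measurableTypeR R) R mu D N) => // x Dx Nx; rewrite fg.
Qed.

Lemma null_setU_pts (N : set R) (a b : R) : measurable N -> mu N = 0%E ->
  measurable (N `|` [set a; b]) /\ mu (N `|` [set a; b]) = 0%E.
Proof.
move=> mN N0.
have mab : measurable [set a; b] by apply: measurableU.
split; first exact: measurableU.
rewrite (@measureU0 _ (measurableTypeR R) R mu)//.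
by rewrite (@measureU0 _ (measurableTypeR R) R mu)//; exact: lebesgue_measure_set1.
Qed.

Lemma Rintegral_cc_split (a x y : R) (f : R -> R) : a <= x -> x <= y ->
  mu.-integrable `[a, y] (EFin \o f) ->
  \int[mu]_(t in `[a, y]) f t - \int[mu]_(t in `[a, x]) f t = \int[mu]_(t in `[x, y]) f t.
Proof.
move=> ax xy intf; rewrite Rintegral_itvB// ?bnd_simp// Rintegral_itv_obnd_cbnd//.
apply: integrableS intf => //.
by move=> z /=; rewrite !in_itv /= => /andP[h1 ->]; rewrite (le_trans ax) ?ltW.
Qed.

Lemma lip_integral_prim (a b M K : R) (w u : R -> R) : a < b -> 0 < M -> 0 < K ->
  lip a b M u -> lip a b K w ->
  is_prim a b w u (fun z => \int[mu]_(t in `[a, z]) (w t * derive1 u t)).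
Proof.
move=> ab M0 K0 uM wK.
have [f [N [C [intf [mN N0] Nf fint]]]] := lipschitz_derive_density ab M0 uM.
pose N' := N `|` [set a; b].
have [mN' N'0] := null_setU_pts a b mN N0.
have WE z : z <= b -> \int[mu]_(t in `[a, z]) (w t * derive1 u t) = \int[mu]_(t in `[a, z]) (w t * f t).
  move=> zb; apply: (Rintegral_eq_off_null mN' N'0) => x /=; rewrite in_itv /= => /andP[ax xz].
  move=> /not_orP[Nx /not_orP[/= xa xb]]; rewrite Nf//.
  rewrite !lt_neqAle ax (le_trans xz zb) !andbT; apply/andP; split; apply/eqP; congruence.
have intwf := integrable_lip_mul K0 wK intf.
have subI x y : a <= x -> y <= b -> `[x, y]%classic `<=` `[a, b]%classic.
  by move=> ax yb z /=; rewrite !in_itv /= => /andP[h1 h2]; rewrite (le_trans ax) ?(le_trans h2).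
have intS (g : R -> R) x y : a <= x -> y <= b -> mu.-integrable `[a, b] (EFin \o g) -> mu.-integrable `[x, y] (EFin \o g).
  by move=> ax yb; apply: integrableS; [exact: measurable_itv|exact: measurable_itv|exact: subI].
have key x y : a <= x -> x <= y -> y <= b ->
   `|\int[mu]_(t in `[a, y]) (w t * derive1 u t) - \int[mu]_(t in `[a, x]) (w t * derive1 u t) -
     w x * (u y - u x)| <= K * C * (y - x) ^+ 2.
  move=> ax xy yb; have xb := le_trans xy yb.
  rewrite !WE// Rintegral_cc_split//; last by apply: intS.
  have [<- fC] := fint x y ax xy yb.
  have ifxy := intS _ _ _ ax yb intf.
  rewrite -RintegralZl//.
  have iwx : mu.-integrable `[x, y] (EFin \o (fun t => w x * f t)).
    by apply: integrable_scale.
  have iwf := intS _ _ _ ax yb intwf.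
  rewrite -RintegralB//.
  have id : mu.-integrable `[x, y] (EFin \o (fun t => w t * f t - w x * f t)).
    exact: (@integrableB _ (measurableTypeR R) R mu `[x, y]%classic _ _ _ iwf iwx).
  apply: le_trans (le_normr_Rintegral _ id) _ => //.
  have inf : mu.-integrable `[x, y] (EFin \o (fun t => `|f t|)) by exact: (integrable_norm ifxy).
  apply: (@le_trans _ _ (\int[mu]_(t in `[x, y]) (K * (y - x) * `|f t|))).
    apply: le_Rintegral => //.
    - exact: (integrable_norm id).
    - exact: (@integrable_scale `[x, y]%classic (K * (y - x)) (fun t => `|f t|)).
    move=> t /=; rewrite in_itv /= => /andP[xt ty].
    rewrite -mulrBl normrM ler_wpM2r//.
    apply: le_trans (wK _ _ _ _) _; rewrite ?in_itv /= ?ax ?(le_trans xt) ?(le_trans ax) ?(le_trans ty)//.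
    by rewrite ler_pM2l// ger0_norm ?subr_ge0// lerD2r.
  rewrite RintegralZl//.
  have -> : K * C * (y - x) ^+ 2 = K * (y - x) * (C * (y - x)) by ring.
  by rewrite ler_wpM2l// mulr_ge0 ?subr_ge0// ltW.
exists (`|K * C| + K * M) => x y.
have [xy|yx] := leP x y.
  rewrite !in_itv /= => /andP[ax xb] /andP[ay yb].
  apply: le_trans (key x y ax xy yb) _; rewrite ler_wpM2r ?sqr_ge0//.
  by apply: ler_wpDr (ler_norm _); rewrite mulr_ge0 ?ltW.
move=> xab yab; have := xab; have := yab; rewrite !in_itv /= => /andP[ay yb] /andP[ax xb].
pose W z := \int[mu]_(t in `[a, z]) (w t * derive1 u t); rewrite -/(W x) -/(W y).
have -> : W y - W x - w x * (u y - u x) =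
   - (W x - W y - w y * (u x - u y)) + (w x - w y) * (u x - u y) by ring.
apply: le_trans (ler_normD _ _) _; rewrite normrN [leRHS]mulrDl; apply: lerD.
  apply: le_trans (key y x ay (ltW yx) xb) _.
  by rewrite -[in leRHS]sqrrN opprB ler_wpM2r ?sqr_ge0// ler_norm.
rewrite normrM -real_normK ?num_real// expr2 mulrACA.
by apply: ler_pM => //; rewrite distrC; [exact: wK|exact: uM].
Qed.

Lemma Rintegral_pt (a : R) (f : R -> R) : \int[mu]_(t in `[a, a]) f t = 0.
Proof. by rewrite set_itv1 Rintegral_set1. Qed.

Lemma cint_prim (n : nat) (phi : 'rV[R]_n -> R) (s : 'I_n) (a b M K : R) (g : R -> 'rV[R]_n) :
  a < b -> 0 < M -> 0 < K -> lip a b M g -> lip a b K (phi \o g) ->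
  is_prim a b (phi \o g) (fun t => g t 0 s) (fun z => cint phi s a z g).
Proof. by move=> ab M0 K0 gM pK; apply: (lip_integral_prim ab M0 K0) => //; exact: lip_coord. Qed.

Lemma Rintegral_bigsum (I : finType) (D : set R) (f : I -> R -> R) : measurable D ->
  (forall i, mu.-integrable D (EFin \o f i)) ->
  \int[mu]_(t in D) (\sum_i f i t) = \sum_i \int[mu]_(t in D) f i t.
Proof.
move=> mD intf.
suff H : forall r : seq I, mu.-integrable D (EFin \o (fun t => \sum_(i <- r) f i t)) /\
  \int[mu]_(t in D) (\sum_(i <- r) f i t) = \sum_(i <- r) \int[mu]_(t in D) f i t.
  by have [] := H (index_enum I).
elim=> [|i r [IH1 IH2]].
  split.
    rewrite (_ : EFin \o _ = cst 0%E); first exact: integrable0.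
    by apply/funext => t; rewrite /= big_nil.
  rewrite big_nil /Rintegral.
  by under eq_integral do rewrite big_nil; rewrite integral0.
have E : (fun t => \sum_(j <- i :: r) f j t) = (fun t => f i t + \sum_(j <- r) f j t).
  by apply/funext => t; rewrite big_cons.
rewrite E big_cons; split.
  exact: (@integrableD _ (measurableTypeR R) R mu D mD _ _ (intf i) IH1).
by rewrite RintegralD// IH2.
Qed.

Lemma cint_l1_bound (n : nat) (phi : 'I_n -> 'rV[R]_n -> R) (M K e : R) (h : R -> 'rV[R]_n) :
  0 < M -> 0 < K -> lip 0 1 M h -> (forall s, lip 0 1 K (phi s \o h)) ->
  (forall s t, t \in `[0, 1] -> `|phi s (h t)| <= e) ->
  `|\sum_s cint (phi s) s 0 1 h| <= e * l1_length h.
Proof.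
move=> M0 K0 hM pK pe.
have /choice[f /choice[N H]] : forall s, exists (f : R -> R) (N : set R),
  [/\ mu.-integrable `[0, 1] (EFin \o f), measurable N, mu N = 0%E &
  forall t, 0 < t < 1 -> ~ N t -> derive1 (fun u => h u 0 s) t = f t].
  move=> s; have [f [N [C [? [? ?] ? _]]]] := lipschitz_derive_density (@ltr01 R) M0 (lip_coord s hM).
  by exists f, N.
pose F k := if insub k is Some s then N s else set0.
have mF k : measurable (F k) by rewrite /F; case: insubP => // s _ _; have [] := H s.
have F0 k : mu (F k) = 0%E by rewrite /F; case: insubP => // s _ _; have [] := H s.
pose NN := \bigcup_k F k.
have mNN : measurable NN by exact: bigcup_measurable.
have NN0 : mu NN = 0%E.
  apply/eqP; rewrite eq_le measure_ge0 andbT.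
  have -> : (0 = \sum_(0 <= i <oo) mu (F i))%E by rewrite eseries0.
  exact: measure_sigma_subadditive.
have NNs s t : N s t -> NN t by move=> Nt; exists s => //=; rewrite /F valK.
have [mN' N'0] := null_setU_pts 0 1 mNN NN0.
have inI s t : `[0, 1]%classic t -> ~ (NN `|` [set 0; 1]) t -> derive1 (fun u => h u 0 s) t = f s t.
  move=> /=; rewrite in_itv /= => /andP[t0 t1] /not_orP[Nt /not_orP[/= x0 x1]].
  have [_ _ _ ->//] := H s; last by move=> /NNs.
  by apply/andP; split; rewrite lt_neqAle ?t0 ?t1 andbT; [rewrite eq_sym|]; apply/eqP.
have intf s : mu.-integrable `[0, 1] (EFin \o f s) by have [] := H s.
have intaf s : mu.-integrable `[0, 1] (EFin \o (fun t => `|f s t|)) by exact: (integrable_norm (intf s)).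
have -> : l1_length h = \sum_s \int[mu]_(t in `[0, 1]) `|f s t|.
  rewrite -(Rintegral_bigsum (f := fun s t => `|f s t|))//; apply: (Rintegral_eq_off_null mN' N'0) => t t01 Nt.
  by apply: eq_bigr => s _; rewrite inI.
rewrite mulr_sumr; apply: le_trans (ler_norm_sum _ _ _) _; apply: ler_sum => s _.
have -> : cint (phi s) s 0 1 h = \int[mu]_(t in `[0, 1]) (phi s (h t) * f s t).
  by apply: (Rintegral_eq_off_null mN' N'0) => t t01 Nt; rewrite inI.
have intpf := integrable_lip_mul K0 (pK s) (intf s).
apply: le_trans (le_normr_Rintegral _ intpf) _ => //.
rewrite -RintegralZl//; apply: le_Rintegral => //.
- exact: (integrable_norm intpf).
- exact: (@integrable_scale `[0, 1]%classic e (fun t => `|f s t|)).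
- by move=> t t01 /=; rewrite normrM ler_wpM2r// pe.
Qed.

Lemma bump_integral_ge (L M : R) (u B W : R -> R) (S : set R) :
  0 < L -> 0 < M -> lip 0 1 L B -> lip 0 1 M u -> is_prim 0 1 B u W ->
  (forall t, t \in `[0, 1] -> 0 <= B t <= 1) ->
  S `<=` `[0, 1] -> (forall t, S t -> B t = 1) ->
  (forall x y, x \in `[0, 1] -> y \in `[0, 1] -> x <= y -> 0 < B x -> 0 < B y -> u x <= u y) ->
  (mu [set u t | t in S] <= (W 1 - W 0)%:E)%E.
Proof.
move=> L0 M0 BL uM [C WC] B01 S01 SB umono.
apply/lee_addgt0Pr => e e0; rewrite -EFinD.
pose K := `|C| + L * M.
have K0 : 0 < K by rewrite ltr_wpDl// mulr_gt0.
pose N := (Num.trunc L + Num.trunc (K / e)).+1.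
have N0 : 0 < N%:R :> R by rewrite ltr0n.
have NL : L / N%:R < 1.
  rewrite ltr_pdivrMr// mul1r; apply: lt_le_trans (truncnS_gt _) _.
  by rewrite ler_nat /N ltnS leq_addr.
have NK : K / N%:R <= e.
  rewrite ler_pdivrMr// [leRHS]mulrC -ler_pdivrMr//; apply: ltW; apply: lt_le_trans (truncnS_gt _) _.
  by rewrite ler_nat /N ltnS leq_addl.
pose t i : R := i%:R / N%:R.
have tS i : t i.+1 = t i + N%:R^-1 by rewrite /t -natr1 mulrDl mul1r.
have Ni0 : 0 < N%:R^-1 :> R by rewrite invr_gt0.
have t01 i : (i <= N)%N -> t i \in `[0, 1].
  by move=> iN; rewrite in_itv /= divr_ge0//= ler_pdivrMr// mul1r ler_nat.
pose hit i := `[< exists2 x, S x & t i <= x <= t i.+1 >].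
have tD i : t i.+1 - t i = N%:R^-1 by rewrite tS addrC addKr.
have tle i : t i <= t i.+1 by rewrite tS lerDl ltW.
have Bclose i x : (i < N)%N -> t i <= x <= t i.+1 -> `|x - t i| <= N%:R^-1 /\ x \in `[0, 1].
  move=> iN /andP[ix xi]; have := t01 _ iN; have := t01 _ (ltnW iN).
  rewrite !in_itv /= => /andP[h1 h2] /andP[h3 h4]; split; last by apply/andP; split; lra.
  by rewrite ger0_norm ?subr_ge0// lerBlDl -tS.
have hitB i x : (i < N)%N -> hit i -> t i <= x <= t i.+1 -> 0 < B x.
  move=> iN /asboolP[z Sz zi] xi.
  have [_ x01] := Bclose _ _ iN xi; have [_ z01] := Bclose _ _ iN zi.
  have := BL z x z01 x01; rewrite (SB _ Sz) => BB.
  have zx : `|x - z| <= N%:R^-1.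
    by rewrite ler_norml; move: xi zi; rewrite tS => /andP[? ?] /andP[? ?]; apply/andP; split; lra.
  have : `|B x - 1| < 1.
    by apply: le_lt_trans BB _; apply: le_lt_trans NL; rewrite ler_pM2l.
  by rewrite ltr_norml => /andP[h _]; lra.
pose m i := if hit i then u (t i.+1) - u (t i) else 0.
have m0 i : (i < N)%N -> 0 <= m i.
  move=> iN; rewrite /m; case: ifP => // hi; rewrite subr_ge0.
  by apply: umono; rewrite ?t01 ?(ltnW iN)//; apply: (hitB i) => //; rewrite ?lexx tle.
have step i : (i < N)%N -> m i <= W (t i.+1) - W (t i) + K / N%:R ^+ 2.
  move=> iN; have ti := t01 _ (ltnW iN); have tSi := t01 _ iN.
  have := WC _ _ ti tSi; rewrite tD => h.
  have {}h : B (t i) * (u (t i.+1) - u (t i)) <= W (t i.+1) - W (t i) + `|C| / N%:R ^+ 2.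
    have := ler_wpM2r (sqr_ge0 N%:R^-1) (ler_norm C); rewrite exprVn => h'.
    by move: h; rewrite ler_norml exprVn => /andP[h _]; lra.
  have uN : `|u (t i.+1) - u (t i)| <= M / N%:R.
    by apply: le_trans (uM _ _ ti tSi) _; rewrite tD gtr0_norm.
  have BN : `|B (t i.+1) - B (t i)| <= L / N%:R.
    by apply: le_trans (BL _ _ ti tSi) _; rewrite tD gtr0_norm.
  have LMN : L * M / N%:R ^+ 2 = (L / N%:R) * (M / N%:R) by field; rewrite gt_eqF.
  suff : m i <= B (t i) * (u (t i.+1) - u (t i)) + L * M / N%:R ^+ 2.
    by rewrite /K mulrDl; lra.
  rewrite LMN /m; case: ifPn => hi.
    have [z Sz zi] : exists2 x, S x & t i <= x <= t i.+1 by exact/asboolP.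
    have [zN z01] := Bclose _ _ iN zi.
    have := BL _ _ ti z01; rewrite (SB _ Sz) => BB.
    have m0i : 0 <= u (t i.+1) - u (t i) by have := m0 i iN; rewrite /m hi.
    have : `|1 - B (t i)| <= L / N%:R by apply: le_trans BB _; rewrite ler_pM2l.
    rewrite ler_norml => /andP[_ h1]; have := uN; rewrite (ger0_norm m0i) => h2.
    have : (1 - B (t i)) * (u (t i.+1) - u (t i)) <= L / N%:R * (M / N%:R).
      by apply: (le_trans (ler_wpM2r m0i h1)); rewrite ler_wpM2l// divr_ge0 ?ltW.
    by lra.
  have /andP[B0 B1] := B01 _ ti.
  have LM0 : 0 <= L / N%:R * (M / N%:R) by rewrite mulr_ge0// divr_ge0 ?ltW.
  have [Bi|Bi] := ltP 0 (B (t i)); last first.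
    by have -> : B (t i) = 0 by [lra]; rewrite mul0r add0r.
  have [BSi|BSi] := ltP 0 (B (t i.+1)).
    have := umono _ _ ti tSi (tle i) Bi BSi; rewrite -subr_ge0 => u0.
    by rewrite addr_ge0// mulr_ge0.
  have /andP[BS0 _] := B01 _ tSi.
  have BS : B (t i.+1) = 0 by lra.
  move: BN; rewrite BS sub0r normrN ger0_norm// => BN.
  rewrite -lerBlDr sub0r -normrN in uN *.
  have : `|B (t i) * (u (t i.+1) - u (t i))| <= L / N%:R * (M / N%:R).
    rewrite normrM (ger0_norm B0); apply: ler_pM => //; by rewrite -normrN.
  by rewrite ler_norml => /andP[].
pose E i := if hit i then `[u (t i), u (t i.+1)]%classic else set0.
have cover : [set u t | t in S] `<=` \big[setU/set0]_(i < N) E i.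
  move=> _ [x Sx <-]; have := S01 _ Sx; rewrite /= in_itv /= => /andP[x0 x1].
  have [i iN xi] : exists2 i, (i < N)%N & t i <= x <= t i.+1.
    have [x1'|x1'] := ltP x 1; last first.
      exists N.-1 => //; rewrite /t /=; have -> : x = 1 by lra.
      by rewrite divff ?gt_eqF// lexx andbT ler_pdivrMr// mul1r ler_nat.
    exists (Num.trunc (x * N%:R)).
      have /truncn_itv/andP[h _] : 0 <= x * N%:R by rewrite mulr_ge0.
      by rewrite -(ltr_nat R); apply: le_lt_trans h _; rewrite gtr_pMl.
    have /truncn_itv/andP[h1 h2] : 0 <= x * N%:R by rewrite mulr_ge0.
    by rewrite /t ler_pdivrMr// ler_pdivlMr// h1 ltW.
  have hi : hit i by apply/asboolP; exists x.
  rewrite -(bigcup_mkord N E); exists i => //=; rewrite /E hi /= in_itv /=.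
  have /andP[h1 h2] := xi.
  have [_ x01] := Bclose _ _ iN xi.
  by apply/andP; split; apply: umono => //; rewrite ?t01 ?(ltnW iN)//; apply: (hitB i) => //; rewrite ?lexx ?tle.
have mE i : measurable (E i) by rewrite /E; case: ifP => _ //; exact: measurable_itv.
have muE i : (i < N)%N -> mu (E i) = (m i)%:E.
  move=> iN; have := m0 i iN; rewrite /E /m; case: ifP => _; last by rewrite measure0.
  rewrite lebesgue_measure_itv /= lte_fin subr_ge0 => uu; case: ltP => // uu'.
  by have -> : u (t i.+1) - u (t i) = 0 by lra.
apply: (@le_trans _ _ (mu (\big[setU/set0]_(i < N) E i))).
  exact: (@le_mu_ext _ (ocitv_type R) R (wlength idfun) _ _ cover).
apply: (@le_trans _ _ (\sum_(i < N) mu (E i))%E).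
  elim: (N) => [|k IH]; first by rewrite !big_ord0 measure0.
  rewrite !big_ord_recr /=.
  apply: (@le_trans _ _ (mu (\big[setU/set0]_(i < k) E i) + mu (E k))%E).
    apply: (@measureU2 _ (measurableTypeR R) R mu); last exact: mE.
    by apply: (@bigsetU_measurable _ (measurableTypeR R)) => i _; exact: mE.
  by rewrite leeD2r.
rewrite (eq_bigr (fun i : 'I_N => (m i)%:E)); last by move=> i _; rewrite muE.
rewrite sumEFin lee_fin.
have -> : W 1 - W 0 = \sum_(0 <= i < N) (W (t i.+1) - W (t i)).
  by rewrite (@telescope_sumr _ _ _ (W \o t))//= /t mul0r divff ?gt_eqF.
rewrite big_mkord; apply: (@le_trans _ _ (\sum_(i < N) (W (t i.+1) - W (t i) + K / N%:R ^+ 2))).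
  by apply: ler_sum => i _; apply: step.
rewrite big_split /= lerD2l sumr_const card_ord -[leLHS]mulr_natr.
apply: le_trans NK; have -> // : K / N%:R ^+ 2 * N%:R = K / N%:R by field; rewrite gt_eqF.
Qed.

End LipschitzIntegrals.

Lemma I0 {R : realType} : (0 : R) \in `[0, 1]. Proof. by rewrite in_itv /= lexx ler01. Qed.
Lemma I1 {R : realType} : (1 : R) \in `[0, 1]. Proof. by rewrite in_itv /= lexx ler01. Qed.

Lemma within_continuous_comp (R : realType) (U W V : normedModType R) (A : set U) (B : set W) (f : W -> V) (g : U -> W) :
  {within B, continuous f} -> {within A, continuous g} -> (forall x, A x -> B (g x)) ->
  {within A, continuous (f \o g)}.
Proof.
move=> /within_continuousP fc /within_continuousP gc AB; apply/within_continuousP => x Ax e e0.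
have [d d0 fd] := fc _ (AB _ Ax) e e0.
have [d' d'0 gd] := gc _ Ax d d0.
by exists d' => // y Ay xy; apply: fd; [exact: AB|exact: gd].
Qed.

Lemma within_continuous_pair (R : realType) (U W1 W2 : normedModType R) (A : set U) (f : U -> W1) (g : U -> W2) :
  {within A, continuous f} -> {within A, continuous g} -> {within A, continuous (fun z => (f z, g z))}.
Proof.
move=> /within_continuousP fc /within_continuousP gc; apply/within_continuousP => x Ax e e0.
have [d d0 fd] := fc _ Ax e e0; have [d' d'0 gd] := gc _ Ax e e0.
exists (Num.min d d') => [|y Ay]; first by rewrite lt_min d0.
rewrite lt_min => /andP[/(fd _ Ay) h1 /(gd _ Ay) h2].
by rewrite /Num.norm /= gt_max h1.
Qed.

Lemma continuous_pair (R : realType) (U W1 W2 : normedModType R) (f : U -> W1) (g : U -> W2) :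
  continuous f -> continuous g -> continuous (fun z => (f z, g z)).
Proof. by move=> fc gc z; apply: (@cvg_pair _ _ _ _ (nbhs (f z)) (nbhs (g z))); [exact: fc|exact: gc]. Qed.

Lemma addr_alternate (W : zmodType) (x y z : W) : x - y + z + (- x + (y - z)) = 0.
Proof. by have -> : - x + (y - z) = - (x - y + z); rewrite ?subrr// !opprD opprK addrA. Qed.

(** * Singular cocycles *)

Section Cocycles.
Context {R : realType} {V : normedModType R}.
Implicit Types (X : set V) (Th : (R -> V) -> R) (f g F : R -> V).

Definition singular_cocycle X Th :=
  (forall f g, {in `[0, 1], f =1 g} -> Th f = Th g) /\
  forall tau, singular2 X tau ->
    Th (fun t => tau (1 - t, t)) - Th (fun t => tau (0, t)) + Th (fun t => tau (t, 0)) = 0.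

Lemma mulrzfctE (T : Type) (K : zmodType) (f : T -> K) (z : int) (x : T) :
  (f *~ z) x = f x *~ z.
Proof. by case: z => k; rewrite ?NegzE ?mulrNz /= -?pmulrn; [rewrite natmulfctE|rewrite natmulfctE]. Qed.

Lemma chain_eval0 Th (I : finType) (a : I -> int) (f : I -> R -> V) :
  (forall f g, {in `[0, 1], f =1 g} -> Th f = Th g) ->
  \sum_i simplex1 (f i) *~ a i = 0 -> \sum_i (a i)%:~R * Th (f i) = 0.
Proof.
move=> Thext H.
pose E i j := `[< {in `[0, 1] : interval R, f i =1 f j} >].
have Esym i j : E i j = E j i.
  by apply/asboolP/asboolP => h x /h ->.
have Etr i j k : E i j -> E i k = E j k.
  move=> /asboolP ij; apply/asboolP/asboolP => h x x01; first by rewrite -ij// h.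
  by rewrite ij// h.
have Hj j : \sum_i (E i j)%:R * (a i)%:~R = 0 :> R.
  have := congr1 (fun z => z (f j)) H.
  have -> : (\sum_i simplex1 (f i) *~ a i) (f j) = \sum_i (E i j)%:Z * a i.
    rewrite fct_sumE; apply: eq_bigr => i _.
    by rewrite mulrzfctE /simplex1 -/(E i j) mulrzz.
  move=> /(congr1 (fun z : int => z%:~R : R)); rewrite rmorph_sum /= => h.
  rewrite -[RHS]h; apply: eq_bigr => i _; by rewrite rmorphM /=.
pose n i : R := \sum_j (E i j)%:R.
have n0 i : n i != 0.
  rewrite /n (bigD1 i)//= (_ : E i i)//; last by apply/asboolP.
  by rewrite gt_eqF// ltr_pwDl// sumr_ge0.
transitivity (\sum_i \sum_j (E i j)%:R / n i * ((a i)%:~R * Th (f i))).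
  apply: eq_bigr => i _; rewrite -mulr_suml -mulr_suml.
  by rewrite -/(n i) divff// mul1r.
rewrite exchange_big /= big1// => j _.
transitivity ((n j)^-1 * Th (f j) * \sum_i (E i j)%:R * (a i)%:~R); last by rewrite Hj mulr0.
rewrite mulr_sumr; apply: eq_bigr => i _.
have [Eij|_] := boolP (E i j); last by rewrite !mul0r mulr0.
have -> : n i = n j by apply: eq_bigr => k _; rewrite (Etr _ _ _ Eij).
have -> : Th (f i) = Th (f j) by apply: Thext; exact/asboolP.
ring.
Qed.

Lemma boundary_eval0 X Th (p m : nat) (a : 'I_p -> int) (f : 'I_p -> R -> V)
    (e : 'I_m -> int) (c : 'I_m -> R -> V) :
  singular_cocycle X Th ->
  is_boundary X (\sum_(i < p) simplex1 (f i) *~ a i - \sum_(j < m) simplex1 (c j) *~ e j) ->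
  \sum_(i < p) (a i)%:~R * Th (f i) = \sum_(j < m) (e j)%:~R * Th (c j).
Proof.
move=> [Thext Thtri] [q [b [tau [tauX E]]]].
pose I := ('I_p + ('I_m + ('I_q + ('I_q + 'I_q))))%type.
pose A (i : I) : int := match i with
  | inl i => a i | inr (inl j) => - e j | inr (inr (inl l)) => - b l
  | inr (inr (inr (inl l))) => b l | inr (inr (inr (inr l))) => - b l end.
pose P (i : I) : R -> V := match i with
  | inl i => f i | inr (inl j) => c j | inr (inr (inl l)) => fun t => tau l (1 - t, t)
  | inr (inr (inr (inl l))) => fun t => tau l (0, t)
  | inr (inr (inr (inr l))) => fun t => tau l (t, 0) end.
have H0 : \sum_i simplex1 (P i) *~ A i = 0.
  rewrite !big_sumType /= addrA.
  have -> : \sum_(i < m) simplex1 (c i) *~ - e i = - \sum_(j < m) simplex1 (c j) *~ e j.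
    by rewrite -sumrN; apply: eq_bigr => j _; rewrite mulrNz.
  rewrite E -!big_split /= big1// => l _.
  rewrite /boundary2 mulrzDl mulrzBl !mulrNz.
  set x := simplex1 _ *~ _; set y := simplex1 _ *~ _; set z := simplex1 _ *~ _.
  exact: addr_alternate.
have := chain_eval0 Thext H0; rewrite !big_sumType /= addrA.
have -> : \sum_(i < m) (- e i)%:~R * Th (c i) = - \sum_(j < m) (e j)%:~R * Th (c j).
  by rewrite -sumrN; apply: eq_bigr => j _; rewrite mulrNz mulNr.
rewrite -!big_split /= [X in _ + X]big1.
  by rewrite addr0 => /eqP; rewrite subr_eq0 => /eqP.
move=> l _; have := Thtri _ (tauX l); rewrite !mulrNz !mulNr => h.
transitivity (- (b l)%:~R * (Th (fun t => tau l (1 - t, t)) - Th (fun t => tau l (0, t)) + Th (fun t => tau l (t, 0)))).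
  ring.
by rewrite h mulr0.
Qed.

Definition seg F (u v : R) : R -> V := fun t => F (u + t * (v - u)).

Lemma path_inP X f : path_in X f <->
  {within `[0, 1], continuous f} /\ forall t, t \in `[0, 1] -> X (f t).
Proof.
split=> -[fc fX]; split=> //.
  by move=> t t01; apply: fX; exists t.
by move=> _ [t t01 <-]; exact: fX.
Qed.

Lemma conv01 (u v t : R) : u \in `[0, 1] -> v \in `[0, 1] -> t \in `[0, 1] -> u + t * (v - u) \in `[0, 1].
Proof. by rewrite !in_itv /= => /andP[? ?] /andP[? ?] /andP[? ?]; apply/andP; split; nra. Qed.

Lemma cocycle_affine X Th F (u v w : R) : singular_cocycle X Th -> path_in X F ->
  u \in `[0, 1] -> v \in `[0, 1] -> w \in `[0, 1] ->
  Th (seg F u v) + Th (seg F v w) = Th (seg F u w).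
Proof.
move=> [Thext Thtri] /path_inP[Fc FX] u01 v01 w01.
pose q (z : R * R) : R := u + z.1 * (v - u) + z.2 * (w - u).
have qc : continuous q.
  move=> z; apply: cvgD; [apply: cvgD; [exact: cvg_cst|]|]; apply: cvgM; try exact: cvg_cst.
    exact: cvg_fst.
  exact: cvg_snd.
have q01 z : triangle z -> q z \in `[0, 1].
  move: u01 v01 w01; rewrite /triangle /q !in_itv /= => /andP[? ?] /andP[? ?] /andP[? ?] [? ? ?].
  by apply/andP; split; nra.
have := Thtri (F \o q); rewrite /comp /q /=.
rewrite (Thext (fun t => F (u + (1 - t) * (v - u) + t * (w - u))) (seg F v w)); last first.
  by move=> t _; rewrite /seg; congr F; ring.
rewrite (Thext (fun t => F (u + 0 * (v - u) + t * (w - u))) (seg F u w)); last first.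
  by move=> t _; rewrite /seg; congr F; ring.
rewrite (Thext (fun t => F (u + t * (v - u) + 0 * (w - u))) (seg F u v)); last first.
  by move=> t _; rewrite /seg; congr F; ring.
have h : singular2 X (fun x : R * R => F (u + x.1 * (v - u) + x.2 * (w - u))).
  split.
    apply: within_continuous_comp Fc _ _; last exact: q01.
    by apply: continuous_subspaceT.
  by move=> _ [z zT <-]; apply: FX; exact: q01.
by move=> /(_ h); lra.
Qed.

Lemma cocycle_cst X Th (x : V) : singular_cocycle X Th -> X x -> Th (fun=> x) = 0.
Proof.
move=> [Thext Thtri] Xx; have := Thtri (fun=> x); rewrite subrr add0r; apply.
split; last by move=> _ [z _ <-].
by apply: continuous_subspaceT => z; exact: cvg_cst.
Qed.

Lemma cocycle_square X Th (H : R * R -> V) : singular_cocycle X Th ->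
  {within `[0, 1] `*` `[0, 1], continuous H} ->
  (forall s t, s \in `[0, 1] -> t \in `[0, 1] -> X (H (s, t))) ->
  Th (fun s => H (s, 0)) + Th (fun t => H (1, t)) = Th (fun t => H (0, t)) + Th (fun s => H (s, 1)).
Proof.
move=> [Thext Thtri] Hc HX.
have T1 : Th (fun t => H (1, t)) - Th (fun t => H (t, t)) + Th (fun s => H (s, 0)) = 0.
  pose q (z : R * R) : R * R := (z.1 + z.2, z.2).
  have qc : continuous q.
    by apply: continuous_pair => z; [apply: cvgD; [exact: cvg_fst|exact: cvg_snd]|exact: cvg_snd].
  have q01 z : triangle z -> (`[0, 1] `*` `[0, 1])%classic (q z).
    rewrite /triangle /q /= => -[? ? ?]; split; rewrite /= in_itv /=; apply/andP; split; lra.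
  have := Thtri (H \o q); rewrite /comp /q /=.
  rewrite (Thext (fun t => H (1 - t + t, t)) (fun t => H (1, t))); last by move=> t _; rewrite subrK.
  rewrite (Thext (fun t => H (0 + t, t)) (fun t => H (t, t))); last by move=> t _; rewrite add0r.
  rewrite (Thext (fun t => H (t + 0, 0)) (fun t => H (t, 0))); last by move=> t _; rewrite addr0.
  apply; split.
    by apply: (within_continuous_comp Hc); [apply: continuous_subspaceT|exact: q01].
  by move=> _ [z /q01[z1 z2] <-]; apply: HX.
have T2 : Th (fun s => H (s, 1)) - Th (fun t => H (t, t)) + Th (fun t => H (0, t)) = 0.
  pose q (z : R * R) : R * R := (z.2, z.1 + z.2).
  have qc : continuous q.
    by apply: continuous_pair => z; [exact: cvg_snd|apply: cvgD; [exact: cvg_fst|exact: cvg_snd]].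
  have q01 z : triangle z -> (`[0, 1] `*` `[0, 1])%classic (q z).
    rewrite /triangle /q /= => -[? ? ?]; split; rewrite /= in_itv /=; apply/andP; split; lra.
  have := Thtri (H \o q); rewrite /comp /q /=.
  rewrite (Thext (fun t => H (t, 1 - t + t)) (fun t => H (t, 1))); last by move=> t _; rewrite subrK.
  rewrite (Thext (fun t => H (t, 0 + t)) (fun t => H (t, t))); last by move=> t _; rewrite add0r.
  rewrite (Thext (fun t => H (0, t + 0)) (fun t => H (0, t))); last by move=> t _; rewrite addr0.
  apply; split.
    by apply: (within_continuous_comp Hc); [apply: continuous_subspaceT|exact: q01].
  by move=> _ [z /q01[z1 z2] <-]; apply: HX.
lra.
Qed.

Lemma cocycle_reparam X Th F (s : R -> R) : singular_cocycle X Th -> path_in X F ->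
  {within `[0, 1], continuous s} -> (forall t, t \in `[0, 1] -> s t \in `[0, 1]) ->
  Th (F \o s) = Th (seg F (s 0) (s 1)).
Proof.
move=> cTh /path_inP[Fc FX] sc s01.
have I0 := @I0 R; have I1 := @I1 R.
pose q (z : R * R) : R := s z.1 + z.2 * (s 0 + z.1 * (s 1 - s 0) - s z.1).
have q01 z : (`[0, 1] `*` `[0, 1])%classic z -> q z \in `[0, 1].
  move=> [z1 z2]; apply: conv01 => //; first exact: s01.
  by apply: conv01 => //; exact: s01.
have qc : {within `[0, 1] `*` `[0, 1], continuous q}.
  have sfc : {within `[0, 1] `*` `[0, 1], continuous (fun z : R * R => s z.1)}.
    apply: (within_continuous_comp sc); last by move=> z [].
    by apply: continuous_subspaceT => z; exact: cvg_fst.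
  have c1 : {within `[0, 1] `*` `[0, 1], continuous (fun z : R * R => z.1)}.
    by apply: continuous_subspaceT => z; exact: cvg_fst.
  have c2 : {within `[0, 1] `*` `[0, 1], continuous (fun z : R * R => z.2)}.
    by apply: continuous_subspaceT => z; exact: cvg_snd.
  move=> z; apply: cvgD; first exact: sfc.
  apply: cvgM; first exact: c2.
  apply: cvgB; last exact: sfc.
  apply: cvgD; first exact: cvg_cst.
  apply: cvgM; [exact: c1|exact: cvg_cst].
have := cocycle_square (H := F \o q) cTh (within_continuous_comp Fc qc q01).
have HX t u : t \in `[0, 1] -> u \in `[0, 1] -> X ((F \o q) (t, u)) by move=> t01 u01; apply: FX; exact: q01.
have [Thext _] := cTh.
move=> /(_ HX).
rewrite (Thext (fun t => (F \o q) (1, t)) (fun=> F (s 1))); last first.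
  by move=> t _; rewrite /q /=; congr F; ring.
rewrite (Thext (fun t => (F \o q) (0, t)) (fun=> F (s 0))); last first.
  by move=> t _; rewrite /q /=; congr F; ring.
rewrite (cocycle_cst cTh (FX _ (s01 _ I0))) (cocycle_cst cTh (FX _ (s01 _ I1))) addr0 add0r.
rewrite (Thext _ (F \o s)); last by move=> t _; rewrite /q /=; congr F; ring.
by move=> ->; apply: Thext => t _; rewrite /q /seg /=; congr F; ring.
Qed.

End Cocycles.

Lemma compact_unif_continuous (R : realType) (U V : normedModType R) (A : set U) (f : U -> V) :
  compact A -> {within A, continuous f} -> forall e, 0 < e ->
  exists2 d, 0 < d & forall x y, A x -> A y -> `|x - y| < d -> `|f x - f y| < e.
Proof.
move=> cA /within_continuousP fc e e0.
pose P (d : R) (x : U) := A x -> forall y, A y -> `|x - y| < d -> `|f x - f y| < e.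
have : \forall d \near (0:R)^'+, A `<=` P d.
  apply: ((compact_near_coveringP A).1 cA) => x Ax.
  have [d d0 fd] := fc x Ax (e / 2) (divr_gt0 e0 (ltr0n _ 2)).
  have d20 : 0 < d / 2 by rewrite divr_gt0.
  exists (ball x (d / 2), [set r | r < d / 2]).
    by split; [exact: nbhsx_ballx|exact: nbhs_right_lt].
  move=> [x' r] [/=]; rewrite -ball_normE /= => xx' rd; rewrite /P => Ax' y Ay x'y.
  rewrite (splitr e); apply: le_lt_trans (ler_distD (f x) _ _) _.
  apply: ltrD.
    rewrite distrC; apply: fd => //; apply: lt_trans xx' _; by rewrite ltr_pdivrMr// ltr_pMr// ltrDl.
  apply: fd => //; rewrite (splitr d); apply: le_lt_trans (ler_distD x' _ _) _.
  by apply: ltrD => //; exact: lt_trans x'y rd.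
move=> H; near (0:R)^'+ => d; exists d => //.
have H' : A `<=` P d by near: d.
by move=> x y Ax Ay; apply: (H' _ Ax Ax).
Unshelve. all: by end_near. Qed.

Lemma big_ord_mul2 (R : realType) (N : nat) (F : nat -> R) :
  \sum_(i < 2 * N) F i = \sum_(i < N) (F (2 * i)%N + F (2 * i).+1).
Proof.
elim: N => [|N IH]; first by rewrite !big_ord0.
rewrite mulnS addnC addn2 !big_ord_recr /= IH -addrA.
by [].
Qed.

Section AlexanderSpanier.
Context {R : realType} {V : normedModType R} (X : set V) (D : V -> V -> R) (delta : R).
Hypothesis delta0 : 0 < delta.
Hypothesis Dcocycle : forall x y z, X x -> X y -> X z ->
  `|x - y| < delta -> `|y - z| < delta -> `|x - z| < delta -> D x y + D y z = D x z.

Definition AS_sum (N : nat) (f : R -> V) : R :=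
  \sum_(i < N) D (f (i%:R / N%:R)) (f (i.+1%:R / N%:R)).

(* Junk value 0 if the sums over dyadic subdivisions are not eventually constant. *)
Definition AS_integral (f : R -> V) : R :=
  xget 0 [set v | exists k0, forall k, (k0 <= k)%N -> AS_sum (2 ^ k) f = v].

Lemma AS_integral_eq (f : R -> V) (v : R) (k0 : nat) :
  (forall k, (k0 <= k)%N -> AS_sum (2 ^ k) f = v) -> AS_integral f = v.
Proof.
move=> H; apply: xget_unique; first by exists k0.
move=> w [k1 H1]; rewrite -(H (maxn k0 k1)) ?leq_maxl// H1// leq_maxr//.
Qed.

Lemma D_refl x : X x -> D x x = 0.
Proof.
move=> Xx; have d0 : `|x - x| < delta by rewrite subrr normr0.
have := Dcocycle Xx Xx Xx d0 d0 d0; lra.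
Qed.

Lemma grid01 (i N : nat) : (0 < N)%N -> (i <= N)%N -> i%:R / N%:R \in (`[0, 1] : interval R).
Proof.
by move=> N0 iN; rewrite in_itv /= divr_ge0//= ler_pdivrMr ?ltr0n// mul1r ler_nat.
Qed.

Lemma pow2_small (e : R) : 0 < e -> exists k0, forall k, (k0 <= k)%N -> (2 ^ k)%:R^-1 < e.
Proof.
move=> e0; exists (Num.trunc e^-1) => k kk.
have k2 : (Num.trunc e^-1 < 2 ^ k)%N by apply: leq_ltn_trans kk _; exact: ltn_expl.
rewrite -[ltRHS]invrK ltf_pV2 ?posrE ?invr_gt0// ?ltr0n ?expn_gt0//.
by apply: lt_le_trans (truncnS_gt _) _; rewrite ler_nat.
Qed.

Lemma path_fine (f : R -> V) (e : R) : path_in X f -> 0 < e ->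
  exists k0, forall k, (k0 <= k)%N -> forall s t, s \in `[0, 1] -> t \in `[0, 1] ->
    `|s - t| <= (2 ^ k)%:R^-1 -> `|f s - f t| < e.
Proof.
move=> [fc _] e0.
have [d d0 fd] := compact_unif_continuous (@segment_compact _ 0 1) fc e0.
have [k0 Hk] := pow2_small d0.
by exists k0 => k kk s t s01 t01 st; apply: fd => //; apply: le_lt_trans st _; exact: Hk.
Qed.

Lemma AS_sum_stable (f : R -> V) : path_in X f ->
  exists k0, forall k, (k0 <= k)%N -> AS_sum (2 ^ k) f = AS_integral f.
Proof.
move=> fX; have [k0 Hk] := path_fine fX delta0.
have [_ Xf] := (path_inP _ _).1 fX.
have S k : (k0 <= k)%N -> AS_sum (2 ^ k.+1) f = AS_sum (2 ^ k) f.
  move=> kk; rewrite /AS_sum expnS.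
  rewrite (big_ord_mul2 _ (fun i => D (f (i%:R / (2 * 2 ^ k)%:R)) (f (i.+1%:R / (2 * 2 ^ k)%:R)))); apply: eq_bigr => i _.
  have N0 : (0 < 2 ^ k)%N by rewrite expn_gt0.
  have Nr : (2 ^ k)%:R != 0 :> R by rewrite pnatr_eq0 -lt0n.
  have E1 : (2 * i)%:R / (2 * 2 ^ k)%:R = i%:R / (2 ^ k)%:R :> R.
    by rewrite !natrM; field.
  have E2 : (2 * i).+2%:R / (2 * 2 ^ k)%:R = i.+1%:R / (2 ^ k)%:R :> R.
    by have -> : (2 * i).+2 = (2 * i.+1)%N by [lia]; rewrite !natrM; field.
  rewrite E1 E2.
  have i1 := grid01 N0 (ltnW (ltn_ord i)); have i2 := grid01 N0 (ltn_ord i).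
  have i3 : (2 * i).+1%:R / (2 * 2 ^ k)%:R \in (`[0, 1] : interval R).
    by apply: grid01; [rewrite muln_gt0|have := ltn_ord i; lia].
  have E3 : (2 * i).+1%:R / (2 * 2 ^ k)%:R = i%:R / (2 ^ k)%:R + (2 ^ k)%:R^-1 / 2 :> R.
    by rewrite -natr1 !natrM; field.
  have E4 : i.+1%:R / (2 ^ k)%:R = i%:R / (2 ^ k)%:R + (2 ^ k)%:R^-1 :> R.
    by rewrite -natr1; field.
  have P0 : 0 < (2 ^ k)%:R^-1 :> R by rewrite invr_gt0 ltr0n.
  apply: Dcocycle; first [exact: Xf|apply: (Hk k) => //; rewrite ?E3 ?E4 ler_norml; apply/andP; split; lra].
exists k0 => k kk; apply/esym/(@AS_integral_eq _ _ k) => j.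
elim: j => [|j IH]; first by rewrite leqn0 => /eqP ->.
rewrite leq_eqVlt => /orP[/eqP -> //|]; rewrite ltnS => kj.
by rewrite S ?IH// (leq_trans kk).
Qed.

Lemma AS_integral_cocycle : singular_cocycle X AS_integral.
Proof.
split.
  move=> f g fg; rewrite /AS_integral; congr (xget 0 _).
  apply/funext => v /=; apply/propext.
  have E k : AS_sum (2 ^ k) f = AS_sum (2 ^ k) g.
    have N0 : (0 < 2 ^ k)%N by rewrite expn_gt0.
    apply: eq_bigr => i _; rewrite (fg _ (grid01 N0 (ltn_ord i))).
    by rewrite (fg _ (grid01 N0 (ltnW (ltn_ord i)))).
  by split => -[k0 H]; exists k0 => k /H; rewrite E.
move=> tau [tc tX].
pose q (z : R * R) : R * R := (z.1 * (1 - z.2), z.1 * z.2).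
have qT z : (`[0, 1] `*` `[0, 1])%classic z -> triangle (q z).
  rewrite /triangle /q => -[/=]; rewrite !in_itv /= => /andP[? ?] /andP[? ?].
  by split=> /=; nra.
pose G (t u : R) := tau (q (t, u)).
have Gc : {within `[0, 1] `*` `[0, 1], continuous (tau \o q)}.
  apply: (within_continuous_comp tc); last exact: qT.
  apply: continuous_subspaceT; apply: continuous_pair => z; apply: cvgM; try exact: cvg_fst; try exact: cvg_snd.
  by apply: cvgB; [exact: cvg_cst|exact: cvg_snd].
have GX t u : t \in `[0, 1] -> u \in `[0, 1] -> X (G t u).
  by move=> t01 u01; apply: tX; exists (q (t, u)) => //; exact: qT.
have cK : compact (`[0, 1] `*` `[0, 1] : set (R * R)).
  by apply: compact_setX; exact: segment_compact.
have [d d0 Gd] := compact_unif_continuous cK Gc delta0.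
have [k0 Hk] := pow2_small d0.
have I0 := @I0 R; have I1 := @I1 R.
have pG u : u \in `[0, 1] -> path_in X (G ^~ u).
  move=> u01; apply/path_inP; split; last by move=> t t01; exact: GX.
  apply: (within_continuous_comp Gc); last by move=> t t01; split.
  by apply: continuous_subspaceT; apply: continuous_pair => z; [exact: cvg_id|exact: cvg_cst].
have pG1 : path_in X (G 1).
  apply/path_inP; split; last by move=> t t01; exact: GX.
  apply: (within_continuous_comp Gc); last by move=> t t01; split.
  by apply: continuous_subspaceT; apply: continuous_pair => z; [exact: cvg_cst|exact: cvg_id].
have [k1 H1] := AS_sum_stable (pG 0 I0).
have [k2 H2] := AS_sum_stable (pG 1 I1).
have [k3 H3] := AS_sum_stable pG1.
pose k := maxn k0 (maxn k1 (maxn k2 k3)).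
have kk0 : (k0 <= k)%N by rewrite /k leq_maxl.
have := H1 k; have := H2 k; have := H3 k.
rewrite !leq_max !leqnn !orbT => /(_ isT) ES3 /(_ isT) E2 /(_ isT) E1.
have N0 : (0 < 2 ^ k)%N by rewrite expn_gt0.
have Nr : (2 ^ k)%:R != 0 :> R by rewrite pnatr_eq0 -lt0n.
have Nk : (2 ^ k)%:R^-1 < d by exact: Hk.
have P0 : 0 < (2 ^ k)%:R^-1 :> R by rewrite invr_gt0 ltr0n.
have gS (i : nat) : i.+1%:R / (2 ^ k)%:R = i%:R / (2 ^ k)%:R + (2 ^ k)%:R^-1 :> R.
  by rewrite -natr1 mulrDl mul1r.
have close t u t' u' : t \in `[0, 1] -> u \in `[0, 1] -> t' \in `[0, 1] -> u' \in `[0, 1] ->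
    `|t - t'| <= (2 ^ k)%:R^-1 -> `|u - u'| <= (2 ^ k)%:R^-1 -> `|G t u - G t' u'| < delta.
  move=> t01 u01 t'01 u'01 tt' uu'; apply: (Gd (t, u) (t', u')) => //.
  by rewrite /Num.norm /= gt_max; apply/andP; split; apply: le_lt_trans Nk.
pose g (i : nat) : R := i%:R / (2 ^ k)%:R.
have g0 i : `|g i - g i| <= (2 ^ k)%:R^-1 by rewrite subrr normr0 ltW.
have g1 i : `|g i - g i.+1| <= (2 ^ k)%:R^-1.
  by rewrite distrC /g gS [X in X - _]addrC addrK ger0_norm// ltW.
have G0 u : G 0 u = tau (0, 0) by rewrite /G /q /= !mul0r.
have X00 : X (tau (0, 0)) by rewrite -(G0 0); exact: GX.
have fan j : (j < 2 ^ k)%N -> AS_sum (2 ^ k) (G ^~ (g j.+1)) - AS_sum (2 ^ k) (G ^~ (g j)) =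
   D (G 1 (g j)) (G 1 (g j.+1)).
  move=> jN; have j1 := grid01 N0 jN; have j0 := grid01 N0 (ltnW jN).
  rewrite /AS_sum -sumrB.
  transitivity (\sum_(0 <= i < 2 ^ k) (D (G (g i.+1) (g j)) (G (g i.+1) (g j.+1)) -
      D (G (g i) (g j)) (G (g i) (g j.+1)))).
    rewrite big_mkord; apply: eq_bigr => i _.
    have i1 := grid01 N0 (ltn_ord i); have i0 := grid01 N0 (ltnW (ltn_ord i)).
    have h1 := @Dcocycle (G (g i) (g j)) (G (g i) (g j.+1)) (G (g i.+1) (g j.+1)).
    have h2 := @Dcocycle (G (g i) (g j)) (G (g i.+1) (g j)) (G (g i.+1) (g j.+1)).
    have E : D (G (g i) (g j)) (G (g i) (g j.+1)) + D (G (g i) (g j.+1)) (G (g i.+1) (g j.+1)) =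
       D (G (g i) (g j)) (G (g i.+1) (g j)) + D (G (g i.+1) (g j)) (G (g i.+1) (g j.+1)).
      rewrite h1 ?h2//; first [exact: GX|apply: close => //; first [exact: g0|exact: g1]].
    rewrite -/(g i) -/(g i.+1); lra.
  rewrite (@telescope_sumr _ _ _ (fun i => D (G (g i) (g j)) (G (g i) (g j.+1))))//.
  have -> : g (2 ^ k)%N = 1 by rewrite /g divff.
  have -> : g 0%N = 0 by rewrite /g mul0r.
  by rewrite !G0 D_refl// subr0.
have : \sum_(0 <= j < 2 ^ k) (AS_sum (2 ^ k) (G ^~ (g j.+1)) - AS_sum (2 ^ k) (G ^~ (g j))) = AS_sum (2 ^ k) (G 1).
  by rewrite big_mkord; apply: eq_bigr => j _; rewrite fan.
rewrite (@telescope_sumr _ _ _ (fun j => AS_sum (2 ^ k) (G ^~ (g j))))//.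
have -> : g (2 ^ k)%N = 1 by rewrite /g divff.
have -> : g 0%N = 0 by rewrite /g mul0r.
rewrite E1 E2.
have GE1 : G^~ 1 = (fun t => tau (0, t)).
  by apply/funext => t; rewrite /G /q /= subrr mulr0 mulr1.
have GE0 : G^~ 0 = (fun t => tau (t, 0)).
  by apply/funext => t; rewrite /G /q /= subr0 mulr0 mulr1.
have GE2 : G 1 = (fun t => tau (1 - t, t)).
  by apply/funext => t; rewrite /G /q /= !mul1r.
rewrite ES3 GE1 GE0 GE2; lra.
Qed.

Lemma AS_integral_prim (g : R -> V) (I : R -> R) (eta : R) : path_in X g -> 0 < eta ->
  (forall x y, x \in `[0, 1] -> y \in `[0, 1] -> x <= y -> y - x < eta -> D (g x) (g y) = I y - I x) ->
  AS_integral g = I 1 - I 0.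
Proof.
move=> gX eta0 H; have [k0 Hk] := pow2_small eta0.
apply: (@AS_integral_eq _ _ k0) => k kk.
have N0 : (0 < 2 ^ k)%N by rewrite expn_gt0.
have Nr : (2 ^ k)%:R != 0 :> R by rewrite pnatr_eq0 -lt0n.
pose t (i : nat) : R := i%:R / (2 ^ k)%:R.
have gS (i : nat) : t i.+1 - t i = (2 ^ k)%:R^-1 :> R.
  by rewrite /t -natr1 mulrDl mul1r addrC addKr.
transitivity (\sum_(0 <= i < 2 ^ k) (I (t i.+1) - I (t i))).
  rewrite big_mkord; apply: eq_bigr => i _; apply: H; rewrite ?grid01// ?(ltnW (ltn_ord i))//.
    by rewrite -subr_ge0 gS.
  by rewrite gS Hk.
rewrite (@telescope_sumr _ _ _ (I \o t))//=.
by rewrite /t divff// mul0r.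
Qed.
End AlexanderSpanier.

Lemma fin_exists_pos (R : realType) (J : finType) (Q : J -> R -> Prop) :
  (forall j d d', d' <= d -> Q j d -> Q j d') ->
  (forall j, exists2 d, 0 < d & Q j d) -> exists2 d, 0 < d & forall j, Q j d.
Proof.
move=> Qmon /(_ _)/cid2 H.
pose d j := let: exist2 d _ _ := H j in d.
have d0 j : 0 < d j by rewrite /d; case: (H j).
have Qd j : Q j (d j) by rewrite /d; case: (H j).
exists (\big[Num.min/1]_j d j).
  by apply/lt_bigmin => //; split => // i _; exact: d0.
by move=> j; apply: Qmon (Qd j); exact: bigmin_le.
Qed.

Lemma compact_lebesgue (R : realType) (V : normedModType R) (X : set V) (rho : V -> R) :
  compact X -> (forall q, X q -> 0 < rho q) ->
  exists2 delta, 0 < delta & forall x, X x ->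
    exists2 q, X q & forall y, `|x - y| < delta -> `|q - y| < rho q.
Proof.
move=> cX rho0.
pose P (d : R) (x : V) := exists2 q, X q & forall y, `|x - y| < d -> `|q - y| < rho q.
have H : \forall d \near (0:R)^'+, X `<=` P d.
  apply: ((compact_near_coveringP X).1 cX) => q Xq.
  have d20 : 0 < rho q / 2 by rewrite divr_gt0// rho0.
  exists (ball q (rho q / 2), [set r | r < rho q / 2]).
    by split; [exact: nbhsx_ballx|exact: nbhs_right_lt].
  move=> [x' r] [/=]; rewrite -ball_normE /= => xx' rd; exists q => // y x'y.
  rewrite (splitr (rho q)); apply: le_lt_trans (ler_distD x' _ _) _.
  by apply: ltrD => //; exact: lt_trans x'y rd.
near (0:R)^'+ => d; exists d => //.
by near: d.
Unshelve. all: by end_near. Qed.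

Lemma closed_avoid (R : realType) (V : normedModType R) (A : set V) (x : V) :
  closed A -> ~ A x -> exists2 d, 0 < d & forall y, A y -> ~ `|x - y| < d.
Proof.
move=> cA nAx; have : open (~` A) by exact: closed_openC.
rewrite openE => /(_ x nAx); rewrite /interior /= => /nbhs_normP[d /= d0 H].
by exists d => // y Ay xy; apply: (H y).
Qed.

Lemma arc_inverse_continuous (R : realType) (V : normedModType R) (h : R -> V) (t : R) :
  {within `[0, 1], continuous h} -> {in `[0, 1] &, injective h} -> t \in `[0, 1] ->
  forall e, 0 < e -> exists2 d, 0 < d &
    forall u, u \in `[0, 1] -> `|h t - h u| < d -> `|t - u| < e.
Proof.
move=> hc hinj t01 e e0.
pose K := `[0, 1]%classic `&` [set u : R | e <= `|t - u|].
have cK : compact K.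
  apply: compact_closedI; first exact: segment_compact.
  apply: (@preimage_closed _ _ (fun u : R => `|t - u|) [set y | e <= y]); last exact: closed_ge.
  move=> u _; apply: cvg_norm; apply: cvgB; [exact: cvg_cst|exact: cvg_id].
have chK : closed (h @` K).
  apply: compact_closed; first exact: norm_hausdorff.
  apply: continuous_compact => //.
  by apply: continuous_subspaceW hc; exact: subIsetl.
have nhK : ~ (h @` K) (h t).
  move=> [u [u01 /= tu] huh]; have E : u = t by apply: hinj.
  by move: tu; rewrite E subrr normr0 leNgt e0.
have [d d0 Hd] := closed_avoid chK nhK.
exists d => // u u01 tu; rewrite ltNge; apply/negP => eu.
by apply: (Hd (h u)) => //; exists u.
Qed.

Lemma locally_lipschitz_pinv (R : realType) (n : nat) (h : R -> 'rV[R]_n) (x : 'rV[R]_n) :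
  lipschitz_arc h -> (h @` `[0, 1]) x -> x <> h 0 -> x <> h 1 ->
  exists rho L, [/\ 0 < rho, 0 < L & forall y z, (h @` `[0, 1]) y -> (h @` `[0, 1]) z ->
    `|x - y| < rho -> `|x - z| < rho ->
    `|pinv (`[0, 1] : set R) h y - pinv (`[0, 1] : set R) h z| <= L * `|y - z|].
Proof.
move=> [_ _ loc] Ex x0 x1.
pose A := (h @` `[0, 1]) `\` [set h 0; h 1].
have Ax : A x by split => // -[].
have : lipschitz_on (pinv (`[0, 1] : set R) h) (within (A `*` A) (nbhs (x, x))).
  by apply: (loc (x, x)); split.
rewrite /lipschitz_on => H.
near (pinfty_nbhs R) => L.
have : dominated_by (self_sub id) L (self_sub (pinv (`[0, 1] : set R) h)) (within (A `*` A) (nbhs (x, x))).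
  by near: L.
move=> H'.
have [[P Q] /= [/nbhs_normP[p /= p0 Pp] /nbhs_normP[q /= q0 Qq]] PQ] : nbhs (x, x)
    [set p | (A `*` A) p -> `|self_sub (pinv (`[0, 1] : set R) h) p| <= L * `|self_sub id p|] := H'.
have A0 : closed [set h 0; h 1] by apply: closedU; exact: (accessible_closed_set1 (hausdorff_accessible (@norm_hausdorff _ _))).
have [e e0 He] := closed_avoid A0 Ax.2.
exists (Num.min e (Num.min p q)), L; split.
- by rewrite !lt_min e0 p0 q0.
- by near: L; exact: nbhs_pinfty_gt.
- move=> y z Ey Ez; rewrite !lt_min => /and3P[ye yp yq] /and3P[ze zp zq].
  have := PQ (y, z); apply => //.
    by split; [exact: Pp|exact: Qq].
  by split; split => //= h1; [apply: He ye|apply: He ze].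
Unshelve. all: by end_near. Qed.

Lemma is_prim_lip (R : realType) (a b M : R) (w u W : R -> R) : 0 < M -> a <= b -> lip a b M u -> is_prim a b w u W ->
  (exists2 K, 0 < K & lip a b K w) ->
  exists2 K, 0 < K & lip a b K W.
Proof.
move=> M0 ab uM [C H] [Kw Kw0 wL].
pose B := `|w a| + Kw * (b - a).
have B0 : 0 <= B by rewrite addr_ge0// mulr_ge0 ?subr_ge0// ltW.
exists (`|C| * (b - a) + B * M + 1) => [|x y xab yab].
  by rewrite ltr_wpDl// addr_ge0// mulr_ge0// ?subr_ge0// ltW.
have -> : W y - W x = (W y - W x - w x * (u y - u x)) + w x * (u y - u x) by ring.
apply: le_trans (ler_normD _ _) _.
rewrite (_ : _ * `|y - x| = `|C| * (b - a) * `|y - x| + (B * M + 1) * `|y - x|); last by ring.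
apply: lerD.
  apply: le_trans (H _ _ xab yab) _; rewrite -real_normK ?num_real// expr2 mulrA.
  rewrite ler_wpM2r//; apply: (le_trans (ler_wpM2r (normr_ge0 _) (ler_norm C))).
  rewrite ler_wpM2l//; move: xab yab; rewrite !in_itv /= => /andP[? ?] /andP[? ?].
  by rewrite ler_norml; apply/andP; split; lra.
rewrite mulrDl mul1r ler_wpDr// normrM -mulrA; apply: ler_pM => //; last exact: uM.
have aab : a \in `[a, b] by rewrite in_itv /= lexx.
have -> : w x = w a + (w x - w a) by ring.
apply: le_trans (ler_normD _ _) _; rewrite lerD2l; apply: le_trans (wL _ _ aab xab) _.
rewrite ler_pM2l// ger0_norm; move: xab; rewrite in_itv /= => /andP[? ?]; lra.
Qed.

(** * The cocycle of a 1-form on a graph *)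

Definition lip_stable (R : realType) (V : normedModType R) (phi : V -> R) :=
  forall a b M (g : R -> V), 0 < M -> lip a b M g -> exists2 K, 0 < K & lip a b K (phi \o g).

Section GraphForms.
Context {R : realType} {n k : nat} (X : set 'rV[R]_n) (h : 'I_k -> R -> 'rV[R]_n).
Hypothesis cX : compact X.
Hypothesis htri : lipschitz_triangulation h X.
Variables (phi : 'rV[R]_n -> R) (s : 'I_n).
Hypothesis phiL : lip_stable phi.
Variable arc_prim : 'I_k -> R -> R.
Hypothesis arc_primP : forall i, is_prim 0 1 (phi \o h i) (fun t => h i t 0 s) (arc_prim i).
Local Notation E i := (h i @` `[0, 1]).
Local Notation sg i := (pinv (`[0, 1] : set R) (h i)).

Lemma arc_inj i : {in `[0, 1] &, injective (h i)}. Proof. by have [/(_ i)[]] := htri. Qed.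

Lemma sg_in i x : E i x -> sg i x \in (`[0, 1] : interval R).
Proof.
move=> Ex; have inj : {in (`[0, 1]%classic : set R) &, injective (h i)}.
  by move=> u v; rewrite !inE; exact: arc_inj.
have : (pinv (`[0, 1] : set R) (h i) @` (h i @` `[0, 1])) (sg i x) by exists x.
by rewrite (injpinv_image (fun=> point) inj).
Qed.

Lemma sgK i x : E i x -> h i (sg i x) = x.
Proof. by move=> Ex; apply: pinvK; rewrite inE. Qed.

Lemma sgKV i t : t \in `[0, 1] -> sg i (h i t) = t.
Proof.
move=> t01; have inj : {in (`[0, 1]%classic : set R) &, injective (h i)}.
  by move=> u v; rewrite !inE; exact: arc_inj.
by apply: (pinvKV (fun=> point) inj); rewrite inE.
Qed.

Lemma arc_lip i : exists2 M, 0 < M & lip 0 1 M (h i).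
Proof. by have [/(_ i)[/lipschitz_mapP]] := htri. Qed.

Lemma arc_continuous i : {within `[0, 1], continuous (h i)}.
Proof. by have [M M0 hM] := arc_lip i; exact: lip_within_continuous hM. Qed.

Lemma arc_closed i : closed (E i).
Proof.
apply: compact_closed; first exact: norm_hausdorff.
apply: continuous_compact; [exact: arc_continuous|exact: segment_compact].
Qed.

Lemma arc_sub i : E i `<=` X.
Proof. by have [_ -> _] := htri; move=> x Ex; exists i. Qed.

Lemma arc_ex x : X x -> exists i, E i x.
Proof. by have [_ -> _] := htri; case=> i _ Ex; exists i. Qed.

Lemma arc_meet i j x y : i != j -> E i x -> E j x -> E i y -> E j y -> x = y.
Proof.
have [_ _ H] := htri; move=> /H[H0|[p [Hp _ _]]] ix jx iy jy.
  by have : (E i `&` E j) x by []; rewrite H0.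
have : (E i `&` E j) x by []; have : (E i `&` E j) y by [].
by rewrite Hp => -> ->.
Qed.

Lemma arc_meet_end i j x : i != j -> E i x -> E j x -> x = h i 0 \/ x = h i 1.
Proof.
have [_ _ H] := htri; move=> /H[H0|[p [Hp pi _]]] ix jx.
  by have : (E i `&` E j) x by []; rewrite H0.
have : (E i `&` E j) x by []; rewrite Hp /= => ->.
by case: pi => ->; [left|right].
Qed.

Lemma sg_continuous i x e : E i x -> 0 < e ->
  exists2 d, 0 < d & forall y, E i y -> `|x - y| < d -> `|sg i x - sg i y| < e.
Proof.
move=> Ex e0.
have [d d0 Hd] := arc_inverse_continuous (@arc_continuous i) (@arc_inj i) (sg_in Ex) e0.
exists d => // y Ey xy; apply: Hd; [exact: sg_in|by rewrite !sgK].
Qed.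

Lemma star_ex q : exists2 d, 0 < d & forall x i, `|q - x| < d -> E i x -> E i q.
Proof.
have H0 i : exists2 d, 0 < d & forall x, `|q - x| < d -> E i x -> E i q.
  have [Eq|nEq] := pselect (E i q); first by exists 1.
  have [d d0 H] := closed_avoid (@arc_closed i) nEq.
  by exists d => // x qx Ex; have := H _ Ex.
have [d d0 H] := @fin_exists_pos R 'I_k (fun i d => forall x, `|q - x| < d -> E i x -> E i q)
  (fun i d d' dd H x qx => H x (lt_le_trans qx dd)) H0.
by exists d => // x i qx; apply: H.
Qed.

Definition rho q : R := sval (cid2 (star_ex q)).
Lemma rho0 q : 0 < rho q. Proof. by rewrite /rho; case: cid2. Qed.
Lemma starP q x i : `|q - x| < rho q -> E i x -> E i q.
Proof. by rewrite /rho; case: cid2 => /= d _ H; apply: H. Qed.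

Definition arc_pot i x := arc_prim i (sg i x).

Lemma arc_pot_continuous i x e : E i x -> 0 < e ->
  exists2 d, 0 < d & forall y, E i y -> `|x - y| < d -> `|arc_pot i x - arc_pot i y| < e.
Proof.
move=> Ex e0; have [M M0 hM] := arc_lip i.
have [K K0 AK] := is_prim_lip M0 ler01 (lip_coord s hM) (arc_primP i) (phiL M0 hM).
have [d d0 Hd] := sg_continuous Ex (divr_gt0 e0 K0).
exists d => // y Ey xy; rewrite distrC; apply: le_lt_trans (AK _ _ (sg_in Ex) (sg_in Ey)) _.
by rewrite distrC mulrC -ltr_pdivlMr// Hd.
Qed.

Definition arc_of x : option 'I_k := [pick i | `[< E i x >]].

Definition star_pot q x := if arc_of x is Some i then arc_pot i x - arc_pot i q else 0.

Lemma star_potE q x i : `|q - x| < rho q -> E i x -> star_pot q x = arc_pot i x - arc_pot i q.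
Proof.
move=> qx Ex; rewrite /star_pot /arc_of; case: pickP => [j /asboolP jx|/(_ i)/asboolP//].
have [-> //|ij] := eqVneq i j.
have -> : x = q by apply: (arc_meet ij) => //; apply: starP qx _.
by rewrite (subrr (arc_pot i q)) (subrr (arc_pot j q)).
Qed.

Lemma star_pot_indep q q' x y : X x -> X y ->
  `|q - x| < rho q -> `|q - y| < rho q -> `|q' - x| < rho q' -> `|q' - y| < rho q' ->
  star_pot q y - star_pot q x = star_pot q' y - star_pot q' x.
Proof.
move=> /arc_ex[i ix] /arc_ex[j jy] qx qy q'x q'y.
rewrite (star_potE qx ix) (star_potE qy jy) (star_potE q'x ix) (star_potE q'y jy).
have [<-|ij] := eqVneq i j; first by ring.
have -> // : q = q'.
by apply: (arc_meet ij); apply: starP ix || apply: starP jy.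
Qed.

(* The increment of a primitive of the form near a point [q], whose choice does
   not matter; junk value 0 if [x] and [y] are not close to a common [q]. *)
Definition arc_delta (x y : 'rV[R]_n) : R :=
  if pselect (exists q, `|q - x| < rho q /\ `|q - y| < rho q) is left H
  then star_pot (sval (cid H)) y - star_pot (sval (cid H)) x else 0.

Lemma arc_deltaE q x y : X x -> X y -> `|q - x| < rho q -> `|q - y| < rho q ->
  arc_delta x y = star_pot q y - star_pot q x.
Proof.
move=> Xx Xy qx qy; rewrite /arc_delta; case: pselect => [H|]; last by case; exists q.
by case: (cid H) => q' [q'x q'y] /=; apply: star_pot_indep.
Qed.

Section LipschitzCurve.
Variables (g : R -> 'rV[R]_n) (M a b : R).
Hypotheses (M0 : 0 < M) (gM : lip a b M g) (gX : forall t, t \in `[a, b] -> X (g t)).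
Variables (q : 'rV[R]_n) (W : R -> R).
Hypothesis gq : forall t, t \in `[a, b] -> `|q - g t| < rho q.
Hypothesis WP : is_prim a b (phi \o g) (fun t => g t 0 s) W.
Local Notation D := (fun t => star_pot q (g t) - W t).
Let bad (x : 'rV[R]_n) := exists i, x = h i 0 \/ x = h i 1.

Lemma pot_local t : t \in `[a, b] -> ~ bad (g t) ->
  exists2 d, 0 < d & forall u, u \in `[a, b] -> `|u - t| < d -> D u = D t.
Proof.
move=> tab nbad; have [i ix] := arc_ex (gX tab).
have n0 : g t <> h i 0 by move=> e; apply: nbad; exists i; left.
have n1 : g t <> h i 1 by move=> e; apply: nbad; exists i; right.
have larc : lipschitz_arc (h i) by have [] := htri.
have [r [L [r0 L0 rL]]] := locally_lipschitz_pinv larc ix n0 n1.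
pose d := Num.min (rho (g t)) r / M / 2.
have d0 : 0 < d by rewrite !divr_gt0// lt_min rho0.
have near u : u \in `[a, b] -> `|u - t| <= d -> `|g t - g u| < Num.min (rho (g t)) r.
  move=> uab ut; rewrite distrC; apply: le_lt_trans (gM tab uab) _.
  rewrite mulrC -ltr_pdivlMr//; apply: le_lt_trans ut _.
  by rewrite /d ltr_pdivrMr// ltr_pMr ?divr_gt0 ?lt_min ?rho0// ltr1n.
have Eu u : u \in `[a, b] -> `|u - t| <= d -> E i (g u).
  move=> uab ut; have [j ju] := arc_ex (gX uab).
  have := near _ uab ut; rewrite lt_min => /andP[h1 _].
  have jt := starP h1 ju.
  have [<- //|ji] := eqVneq j i.
  by rewrite eq_sym in ji; case: (arc_meet_end ji ix jt).
exists d => // u uab /ltW ut.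
pose c1 := Num.min t u; pose c2 := Num.max t u.
have subc v : v \in `[c1, c2] -> v \in `[a, b] /\ `|v - t| <= d.
  move: uab tab ut; rewrite /c1 /c2 !in_itv /= ler_norml => /andP[? ?] /andP[? ?] /andP[? ?].
  case: (leP t u) => ? /andP[? ?]; (split; [apply/andP; split; lra|rewrite ler_norml; apply/andP; split; lra]).
have tc : t \in `[c1, c2] by rewrite in_itv /= /c1 /c2 ge_min le_max !lexx.
have uc : u \in `[c1, c2] by rewrite in_itv /= /c1 /c2 ge_min le_max !lexx !orbT.
have sL : lip c1 c2 (L * M) (sg i \o g).
  move=> v w /subc[vab vd] /subc[wab wd] /=.
  apply: le_trans (rL _ _ (Eu _ wab wd) (Eu _ vab vd) _ _) _.
  - by have := near _ wab wd; rewrite lt_min => /andP[].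
  - by have := near _ vab vd; rewrite lt_min => /andP[].
  by rewrite -mulrA ler_pM2l//; apply: gM.
have [Mh Mh0 hMh] := arc_lip i; have [K K0 pK] := phiL Mh0 hMh.
have P1 := is_prim_comp (ltW K0) (ltW Mh0) pK (fun x y => @lip_coord _ _ _ _ _ _ s hMh x y)
  (fun v vc => sg_in (Eu _ (subc _ vc).1 (subc _ vc).2)) sL (arc_primP i).
have P2 : is_prim c1 c2 (phi \o g) (fun t => g t 0 s) (arc_prim i \o (sg i \o g)).
  case: P1 => C HC; exists C => v w vc wc.
  have := HC v w vc wc; rewrite /= !sgK//; first [exact: (Eu _ (subc _ vc).1 (subc _ vc).2)|exact: (Eu _ (subc _ wc).1 (subc _ wc).2)].
have P3 : is_prim c1 c2 (phi \o g) (fun t => g t 0 s) W.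
  case: WP => C HC; exists C => v w /subc[vab _] /subc[wab _]; exact: HC.
have c12 : c1 <= c2 by rewrite /c1 /c2 ge_min le_max lexx.
have := is_prim_unique c12 P2 P3; rewrite /= -!/(arc_pot _ _) => EE.
have Et := star_potE (gq tab) ix; have Euu := star_potE (gq uab) (Eu _ uab ut).
rewrite Et Euu; move: EE; rewrite /c1 /c2; case: (leP t u) => _; lra.
Qed.

Lemma pot_continuous t e : t \in `[a, b] -> 0 < e ->
  exists2 d, 0 < d & forall u, u \in `[a, b] -> `|u - t| < d -> `|D u - D t| < e.
Proof.
move=> tab e0.
have ab : a <= b by move: tab; rewrite in_itv /= => /andP[? ?]; lra.
have e20 : 0 < e / 2 by rewrite divr_gt0.
have [K K0 WK] := is_prim_lip M0 ab (lip_coord s gM) WP (phiL M0 gM).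
have Hi i : exists2 d, 0 < d & forall y, `|g t - y| < d -> E i y -> E i (g t) /\ `|arc_pot i (g t) - arc_pot i y| < e / 2.
  have [it|nit] := pselect (E i (g t)).
    have [d d0 Hd] := arc_pot_continuous it e20.
    by exists d => // y ty Ey; split => //; apply: Hd.
  by have [d d0 Hd] := closed_avoid (@arc_closed i) nit; exists d => // y ty Ey; case: (Hd _ Ey ty).
have [d d0 Hd] := @fin_exists_pos R 'I_k (fun i d => forall y, `|g t - y| < d -> E i y -> E i (g t) /\ `|arc_pot i (g t) - arc_pot i y| < e / 2)
  (fun i d d' dd H y ty => H y (lt_le_trans ty dd)) Hi.
exists (Num.min (d / M) (e / 2 / K)); first by rewrite lt_min !divr_gt0.
move=> u uab; rewrite lt_min => /andP[ud uK].
have [i iu] := arc_ex (gX uab).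
have tu : `|g t - g u| < d.
  by rewrite distrC; apply: le_lt_trans (gM tab uab) _; rewrite mulrC -ltr_pdivlMr.
have [it Hp] := Hd i _ tu iu.
rewrite (star_potE (gq tab) it) (star_potE (gq uab) iu).
have WW : `|W u - W t| < e / 2.
  by apply: le_lt_trans (WK _ _ tab uab) _; rewrite mulrC -ltr_pdivlMr.
move: WW Hp; generalize (arc_pot i (g t)) (arc_pot i (g u)) (arc_pot i q) (W u) (W t) => A1 A2 A3 A4 A5.
rewrite !ltr_norml => /andP[? ?] /andP[? ?]; apply/andP; split; lra.
Qed.

Lemma pot_const_closed u v : a <= u -> u <= v -> v <= b ->
  (forall t, t \in `[u, v] -> ~ bad (g t)) -> D v = D u.
Proof.
move=> au uv vb nbad.
have sub t : t \in `[u, v] -> t \in `[a, b].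
  by rewrite !in_itv /=; lra.
pose P (d t : R) := forall w, w \in `[u, v] -> `|w - t| < d -> t \in `[u, v] -> D w = D t.
have H : \forall d \near (0:R)^'+, `[u, v]%classic `<=` P d.
  apply: ((compact_near_coveringP _).1 (@segment_compact _ u v)) => t tuv.
  have [d d0 Hd] := pot_local (sub _ tuv) (nbad _ tuv).
  have d20 : 0 < d / 2 by rewrite divr_gt0.
  exists (ball t (d / 2), [set r | r < d / 2]).
    by split; [exact: nbhsx_ballx|exact: nbhs_right_lt].
  move=> [t' r] [/=]; rewrite -ball_normE /= => tt' rd w wuv wt' t'uv.
  rewrite (Hd t') ?sub//; last first.
    by rewrite distrC; apply: lt_trans tt' _; rewrite ltr_pdivrMr// ltr_pMr// ltr1n.
  apply: Hd; first exact: sub.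
  rewrite (splitr d); apply: le_lt_trans (ler_distD t' _ _) _.
  by apply: ltrD; [exact: lt_trans wt' rd|rewrite distrC].
near (0:R)^'+ => d.
have H' : `[u, v]%classic `<=` P d by near: d.
have d0 : 0 < d by near: d; exact: nbhs_right_gt.
apply: (@quad_const R u v 0 d (fun t => star_pot q (g t) - W t)) => // x y ux xy yv xyd.
have xuv : x \in `[u, v] by rewrite in_itv /= ux (le_trans xy).
have yuv : y \in `[u, v] by rewrite in_itv /= yv (le_trans ux).
rewrite mul0r (H' x xuv y yuv _ xuv); first by rewrite (subrr (D x)) normr0.
by rewrite ger0_norm ?subr_ge0.
Unshelve. all: by end_near. Qed.

Lemma pot_const_open u v : a <= u -> u <= v -> v <= b ->
  (forall t, t \in `]u, v[ -> ~ bad (g t)) -> D v = D u.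
Proof.
move=> au; rewrite le_eqVlt => /orP[/eqP -> //|uv] vb nbad.
have uab : u \in `[a, b] by rewrite in_itv /= au; lra.
have vab : v \in `[a, b] by rewrite in_itv /= vb andbT; lra.
apply/eqP; rewrite -subr_eq0 -normr_le0; apply/ler_addgt0Pr => e e0; rewrite add0r.
have e20 : 0 < e / 2 by rewrite divr_gt0.
have [d1 d10 H1] := pot_continuous uab e20.
have [d2 d20 H2] := pot_continuous vab e20.
pose d := Num.min ((v - u) / 3) (Num.min (d1 / 2) (d2 / 2)).
have d0 : 0 < d by rewrite !lt_min !divr_gt0// subr_gt0.
have dle : d <= (v - u) / 3 /\ d <= d1 / 2 /\ d <= d2 / 2.
  by rewrite /d !ge_min !lexx !orbT.
have [da [db dc]] := dle.
have E : D (v - d) = D (u + d).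
  apply: pot_const_closed; try lra.
  by move=> t; rewrite in_itv /= => /andP[? ?]; apply: nbad; rewrite in_itv /=; apply/andP; split; lra.
have h1 : `|D (u + d) - D u| < e / 2.
  apply: H1; first by rewrite in_itv /=; apply/andP; split; lra.
  by rewrite addrC addKr gtr0_norm//; lra.
have h2 : `|D (v - d) - D v| < e / 2.
  apply: H2; first by rewrite in_itv /=; apply/andP; split; lra.
  by rewrite addrC addKr normrN gtr0_norm//; lra.
move: h1 h2; rewrite -E; generalize (D (v - d)) (D u) (D v) => A1 A2 A3.
rewrite !ltr_norml => /andP[? ?] /andP[? ?]; rewrite ler_norml; apply/andP; split; lra.
Qed.

Lemma bad_sep : exists2 m, 0 < m & forall x y, bad x -> bad y -> `|x - y| < m -> x = y.
Proof.
pose pt (j : 'I_k * bool) := if j.2 then h j.1 1 else h j.1 0.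
have badpt x : bad x -> exists j, x = pt j.
  by move=> [i [->|->]]; [exists (i, false)|exists (i, true)].
have H0 (j : ('I_k * bool) * ('I_k * bool)) : exists2 m, 0 < m & `|pt j.1 - pt j.2| < m -> pt j.1 = pt j.2.
  have [E|E] := eqVneq (pt j.1) (pt j.2); first by exists 1.
  by exists `|pt j.1 - pt j.2|; rewrite ?normr_gt0 ?subr_eq0// ltxx.
have [m m0 Hm] := @fin_exists_pos R _ (fun j m => `|pt j.1 - pt j.2| < m -> pt j.1 = pt j.2)
   (fun j d d' dd H x => H (lt_le_trans x dd)) H0.
exists m => // x y /badpt[j ->] /badpt[j' ->]; exact: (Hm (j, j')).
Qed.

Lemma bad_extreme u v t : a <= u -> v <= b -> t \in `[u, v] -> bad (g t) ->
  exists t1 t2, [/\ t1 \in `[u, v] /\ t2 \in `[u, v], t1 <= t2, bad (g t1), bad (g t2) &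
    forall w, w \in `[u, v] -> bad (g w) -> t1 <= w <= t2].
Proof.
move=> au vb tuv badt.
pose B := \bigcup_(j in [set: 'I_k * bool]) [set (if j.2 then h j.1 1 else h j.1 0)].
have BE x : B x <-> bad x.
  split; first by move=> [[i [|]] _ /= ->]; exists i; [right|left].
  by move=> [i [->|->]]; [exists (i, false)|exists (i, true)].
have cB : closed B.
  by apply: closed_bigcup; [exact: finite_finset|move=> j _; exact: (accessible_closed_set1 (hausdorff_accessible (@norm_hausdorff _ _)))].
pose S := [set w : R | w \in `[u, v] /\ bad (g w)].
have St : S t by [].
have Sb w : S w -> u <= w <= v by move=> []; rewrite in_itv.
have hs : has_sup S by split; [exists t|exists v => w /Sb/andP[]].
have hi : has_inf S by split; [exists t|exists u => w /Sb/andP[]].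
have Sab z : u <= z <= v -> z \in `[a, b].
  by move=> /andP[? ?]; rewrite in_itv /=; apply/andP; split; lra.
have adh z : u <= z <= v -> (forall d, 0 < d -> exists2 w, S w & `|w - z| < d) -> bad (g z).
  move=> zuv H; apply: contrapT => nbad.
  have nB : ~ B (g z) by move=> /BE.
  have [d d0 Hd] := closed_avoid cB nB.
  have [w Sw wz] := H (d / M) (divr_gt0 d0 M0).
  apply: (Hd (g w)); first by apply/BE; case: Sw.
  rewrite distrC; apply: le_lt_trans (gM (Sab _ zuv) (Sab _ (Sb _ Sw))) _.
  by rewrite mulrC -ltr_pdivlMr.
have supuv : u <= sup S <= v.
  have tS : t <= sup S by apply: ub_le_sup => //; case: hs.
  have /andP[ut _] := Sb _ St.
  by rewrite (le_trans ut tS) /= ge_sup//; [exists t|move=> w /Sb/andP[]].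
have infuv : u <= inf S <= v.
  have tS : inf S <= t by apply: ge_inf => //; case: hi.
  have /andP[_ tv] := Sb _ St.
  by rewrite (le_trans tS tv) andbT lb_le_inf//; [exists t|move=> w /Sb/andP[]].
exists (inf S), (sup S); split.
- by rewrite !in_itv.
- apply: (@le_trans _ _ t); [apply: ge_inf => //; by case: hi|apply: ub_le_sup => //; by case: hs].
- apply: adh => // d d0; have [w Sw wd] := inf_adherent d0 hi.
  exists w => //; rewrite ger0_norm; first by rewrite ltrBlDl.
  by rewrite subr_ge0; apply: ge_inf => //; case: hi.
- apply: adh => // d d0; have [w Sw wd] := sup_adherent d0 hs.
  exists w => //; rewrite distrC ger0_norm; first by rewrite ltrBlDl -ltrBlDr.
  by rewrite subr_ge0; apply: ub_le_sup => //; case: hs.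
- move=> w wuv wb; have Sw : S w by [].
  by apply/andP; split; [apply: ge_inf => //; case: hi|apply: ub_le_sup => //; case: hs].
Qed.

Lemma star_integral : a <= b -> star_pot q (g b) - star_pot q (g a) = W b - W a.
Proof.
move=> ab; suff : D b = D a.
  by generalize (star_pot q (g b)) (star_pot q (g a)) (W a) (W b) => A1 A2 A3 A4; lra.
have [m m0 Hm] := bad_sep; have [C HC] := WP.
apply: (@quad_const R a b `|C| (m / M) (fun t => star_pot q (g t) - W t)) => // [|u v au uv vb vum].
  by rewrite divr_gt0.
have [[t [tuv badt]]|nb] := pselect (exists t, t \in `[u, v] /\ bad (g t)); last first.
  rewrite (@pot_const_open u v)//; last first.
    move=> t; rewrite in_itv /= => /andP[ut tv] bt; apply: nb; exists t; split => //.
    by rewrite in_itv /= !ltW.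
  by rewrite (subrr (D u)) normr0 mulr_ge0// sqr_ge0.
have [t1 [t2 [[t1uv t2uv] t12 b1 b2 Hw]]] := bad_extreme au vb tuv badt.
have := t1uv; have := t2uv; rewrite !in_itv /= => /andP[ut2 t2v] /andP[ut1 t1v].
have t1ab : t1 \in `[a, b] by rewrite in_itv /=; apply/andP; split; lra.
have t2ab : t2 \in `[a, b] by rewrite in_itv /=; apply/andP; split; lra.
have E1 : D t1 = D u.
  apply: pot_const_open => // [|t'].
    by lra.
  rewrite in_itv /= => /andP[? ?] /Hw; rewrite in_itv /= => H.
  have : t1 <= t' <= t2 by apply: H; apply/andP; split; lra.
  by move=> /andP[? ?]; lra.
have E2 : D v = D t2.
  apply: pot_const_open => // [|t'].
    by lra.
  rewrite in_itv /= => /andP[? ?] /Hw; rewrite in_itv /= => H.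
  have : t1 <= t' <= t2 by apply: H; apply/andP; split; lra.
  by move=> /andP[? ?]; lra.
have g12 : g t1 = g t2.
  apply: Hm => //; rewrite distrC; apply: le_lt_trans (gM t1ab t2ab) _.
  rewrite mulrC -ltr_pdivlMr//; apply: le_lt_trans vum; rewrite ger0_norm; lra.
rewrite -E1 E2 g12.
have := HC t1 t2 t1ab t2ab; rewrite g12 (subrr (g t2 0 s)) mulr0 subr0 => hW.
have -> : star_pot q (g t2) - W t2 - (star_pot q (g t2) - W t1) = - (W t2 - W t1).
  by generalize (star_pot q (g t2)) (W t1) (W t2) => A1 A2 A3; ring.
rewrite normrN; apply: le_trans hW _.
apply: le_trans (ler_wpM2r (sqr_ge0 _) (ler_norm C)) _; rewrite ler_wpM2l//.
by rewrite ler_sqr ?nnegrE; lra.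
Qed.
End LipschitzCurve.

Lemma graph_cocycle : exists Th : (R -> 'rV[R]_n) -> R, singular_cocycle X Th /\
  forall (g : R -> 'rV[R]_n) M W, 0 < M -> lip 0 1 M g -> (forall t, t \in `[0, 1] -> X (g t)) ->
    is_prim 0 1 (phi \o g) (fun t => g t 0 s) W -> Th g = W 1 - W 0.
Proof.
have [delta delta0 Hdelta] := compact_lebesgue cX (fun q _ => rho0 q).
have Dc x y z : X x -> X y -> X z -> `|x - y| < delta -> `|y - z| < delta -> `|x - z| < delta ->
    arc_delta x y + arc_delta y z = arc_delta x z.
  move=> Xx Xy Xz xy yz xz; have [q Xq Hq] := Hdelta x Xx.
  have qx : `|q - x| < rho q by apply: Hq; rewrite subrr normr0.
  have qy : `|q - y| < rho q by apply: Hq.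
  have qz : `|q - z| < rho q by apply: Hq.
  rewrite (arc_deltaE Xx Xy qx qy) (arc_deltaE Xy Xz qy qz) (arc_deltaE Xx Xz qx qz).
  by rewrite addrC subrKA.
exists (AS_integral arc_delta); split; first exact: AS_integral_cocycle delta0 Dc.
move=> g M W M0 gM gX WP.
have pg : path_in X g by apply/path_inP; split => //; exact: lip_within_continuous gM.
apply: (@AS_integral_prim R _ X arc_delta g W (delta / M)) => //; first by rewrite divr_gt0.
move=> x y x01 y01 xy yx.
have [q Xq Hq] := Hdelta _ (gX _ x01).
have sub t : t \in `[x, y] -> t \in `[0, 1].
  by move: x01 y01; rewrite !in_itv /=; lra.
have gq t : t \in `[x, y] -> `|q - g t| < rho q.
  move=> txy; apply: Hq; rewrite distrC; apply: le_lt_trans (gM _ _ x01 (sub _ txy)) _.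
  rewrite mulrC -ltr_pdivlMr//; apply: le_lt_trans yx.
  by move: txy; rewrite in_itv /= => /andP[? ?]; rewrite ger0_norm; lra.
have xxy : x \in `[x, y] by rewrite in_itv /= lexx.
have yxy : y \in `[x, y] by rewrite in_itv /= lexx andbT.
rewrite (arc_deltaE (gX _ x01) (gX _ y01) (gq _ xxy) (gq _ yxy)).
have gMxy : lip x y M g by move=> u v uxy vxy; apply: gM; exact: sub.
apply: (star_integral M0 gMxy) => //.
  by move=> t /sub; exact: gX.
by case: WP => C HC; exists C => u v uxy vxy; apply: HC; exact: sub.
Qed.
End GraphForms.

Theorem form_cocycle (R : realType) (n : nat) (X : set 'rV[R]_n) (phi : 'rV[R]_n -> R) (s : 'I_n) :
  lipschitz_triangulable X -> lip_stable phi ->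
  exists Th : (R -> 'rV[R]_n) -> R, singular_cocycle X Th /\
  forall (g : R -> 'rV[R]_n) M W, 0 < M -> lip 0 1 M g -> (forall t, t \in `[0, 1] -> X (g t)) ->
    is_prim 0 1 (phi \o g) (fun t => g t 0 s) W -> Th g = W 1 - W 0.
Proof.
move=> [cX [k [h htri]]] phiL.
apply: (graph_cocycle cX htri phiL (arc_prim := fun i t => cint phi s 0 t (h i))) => i.
have [hl _ _] := htri; have [/lipschitz_mapP[M M0 hM] _ _] := hl i.
have [K K0 pK] := phiL _ _ _ _ M0 hM.
by apply: (cint_prim _ _ M0 K0).
Qed.

Lemma within_continuous_eq (R : realType) (U V : normedModType R) (A : set U) (f g : U -> V) :
  (forall x, A x -> f x = g x) -> {within A, continuous f} -> {within A, continuous g}.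
Proof.
move=> fg /within_continuousP fc; apply/within_continuousP => x Ax e e0.
have [d d0 H] := fc x Ax e e0; exists d => // y Ay xy.
by rewrite -!fg//; exact: H.
Qed.

Lemma within_continuous_paste (R : realType) (U V : normedModType R) (A B C : set U) (f g k : U -> V) :
  closed A -> closed B -> C `<=` A `|` B ->
  {within A, continuous f} -> {within B, continuous g} ->
  (forall x, A x -> f x = k x) -> (forall x, B x -> g x = k x) -> {within C, continuous k}.
Proof.
move=> cA cB CAB fc gc fk gk; apply: (continuous_subspaceW CAB).
by apply: withinU_continuous => //; [exact: within_continuous_eq fk fc|exact: within_continuous_eq gk gc].
Qed.

(** * The exponent sums in a free fundamental group *)

Section PathHomotopy.
Context {R : realType} {V : normedModType R} (X : set V).
Implicit Types f g : R -> V.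
Local Notation I2 := (`[0, 1] `*` `[0, 1] : set (R * R)).

Definition phom f g := exists H : R * R -> V,
  [/\ {within I2, continuous H}, H @` I2 `<=` X,
    forall s, s \in `[0, 1] -> H (s, 0) = f s /\ H (s, 1) = g s
  & forall t, t \in `[0, 1] -> H (0, t) = f 0 /\ H (1, t) = f 1].

Lemma phom_loop x f g : f 0 = x -> f 1 = x -> loop_homotopic X x f g <-> phom f g.
Proof.
by move=> f0 f1; split=> -[H [h1 h2 h3 h4]]; exists H; split => //; move: h4; rewrite f0 f1.
Qed.

Lemma phom_ends f g : phom f g -> f 0 = g 0 /\ f 1 = g 1.
Proof.
move=> [H [_ _ h3 h4]].
have [_ <-] := h3 _ I0; have [_ <-] := h3 _ I1.
by have [-> ->] := h4 _ I1.
Qed.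

Lemma phom_convex (U : normedModType R) (A : set U) (F : U -> V) (p q : R -> U) :
  (forall x y t, A x -> A y -> t \in `[0, 1] -> A (x + t *: (y - x))) ->
  {within A, continuous F} -> F @` A `<=` X ->
  {within `[0, 1], continuous p} -> {within `[0, 1], continuous q} ->
  (forall t, t \in `[0, 1] -> A (p t)) -> (forall t, t \in `[0, 1] -> A (q t)) ->
  p 0 = q 0 -> p 1 = q 1 -> phom (F \o p) (F \o q).
Proof.
move=> cvA Fc FX pc qc pA qA e0 e1.
pose r (z : R * R) := p z.1 + z.2 *: (q z.1 - p z.1).
have rA z : I2 z -> A (r z) by move=> [z1 z2]; apply: cvA => //; [exact: pA|exact: qA].
exists (F \o r); split.
- apply: (within_continuous_comp Fc _ rA).
  have c1 : {within I2, continuous (fun z : R * R => z.1)}.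
    by apply: continuous_subspaceT => z; exact: cvg_fst.
  have c2 : {within I2, continuous (fun z : R * R => z.2)}.
    by apply: continuous_subspaceT => z; exact: cvg_snd.
  have pc' : {within I2, continuous (p \o fst)} by apply: (within_continuous_comp pc c1) => z [].
  have qc' : {within I2, continuous (q \o fst)} by apply: (within_continuous_comp qc c1) => z [].
  move=> z; apply: cvgD; first exact: pc'.
  apply: cvgZ; first exact: c2.
  by apply: cvgB; [exact: qc'|exact: pc'].
- by move=> _ [z z01 <-]; apply: FX; exists (r z) => //; exact: rA.
- by move=> s s01; rewrite /r /= scale0r addr0 scale1r addrC subrK.
- by move=> t t01; rewrite /r /= -e0 -e1 !subrr scaler0 !addr0.
Qed.

Lemma phom_reparam (F : R -> V) (p q : R -> R) : path_in X F ->
  {within `[0, 1], continuous p} -> {within `[0, 1], continuous q} ->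
  (forall t, t \in `[0, 1] -> p t \in `[0, 1]) -> (forall t, t \in `[0, 1] -> q t \in `[0, 1]) ->
  p 0 = q 0 -> p 1 = q 1 -> phom (F \o p) (F \o q).
Proof.
move=> [Fc FX] pc qc p01 q01; apply: (@phom_convex R `[0, 1]%classic F p q) => // x y t.
by rewrite /= !in_itv /= => /andP[? ?] /andP[? ?] /andP[? ?]; rewrite /GRing.scale /=; apply/andP; split; nra.
Qed.

Lemma phom_ext f g : path_in X f -> {in `[0, 1], f =1 g} -> phom f g.
Proof.
move=> /path_inP[fc fX] fg; exists (f \o fst); split.
- apply: (within_continuous_comp fc); last by move=> z [].
  by apply: continuous_subspaceT => z; exact: cvg_fst.
- by move=> _ [z [z1 _] <-]; exact: fX.
- by move=> s s01 /=; rewrite -fg.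
- by move=> t t01 /=.
Qed.

Lemma phom_refl f : path_in X f -> phom f f.
Proof. by move=> fX; apply: phom_ext. Qed.

Lemma phom_sym f g : phom f g -> phom g f.
Proof.
move=> fg; have [e0 e1] := phom_ends fg; case: fg => H [Hc HX H1 H2].
have q01 z : I2 z -> I2 (z.1, 1 - z.2).
  by move=> [z1 z2]; split => //=; move: z2; rewrite /= !in_itv /=; lra.
exists (fun z => H (z.1, 1 - z.2)); split.
- apply: (within_continuous_comp Hc _ q01); apply: continuous_subspaceT.
  apply: continuous_pair => z; first exact: cvg_fst.
  by apply: cvgB; [exact: cvg_cst|exact: cvg_snd].
- by move=> _ [z z01 <-]; apply: HX; exists (z.1, 1 - z.2) => //; exact: q01.
- by move=> s s01 /=; rewrite subr0 subrr; have [-> ->] := H1 _ s01.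
- move=> t t01 /=; rewrite -e0 -e1; apply: H2.
  by move: t01; rewrite !in_itv /=; lra.
Qed.

Lemma closed_le_fst (c : R) : closed [set z : R * R | z.1 <= c].
Proof. by apply: (@preimage_closed _ _ fst [set y | y <= c]); [move=> z _; exact: cvg_fst|exact: closed_le]. Qed.
Lemma closed_ge_fst (c : R) : closed [set z : R * R | c <= z.1].
Proof. by apply: (@preimage_closed _ _ fst [set y | c <= y]); [move=> z _; exact: cvg_fst|exact: closed_ge]. Qed.
Lemma closed_le_snd (c : R) : closed [set z : R * R | z.2 <= c].
Proof. by apply: (@preimage_closed _ _ snd [set y | y <= c]); [move=> z _; exact: cvg_snd|exact: closed_le]. Qed.
Lemma closed_ge_snd (c : R) : closed [set z : R * R | c <= z.2].
Proof. by apply: (@preimage_closed _ _ snd [set y | c <= y]); [move=> z _; exact: cvg_snd|exact: closed_ge]. Qed.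
Lemma closed_I2 : closed I2.
Proof.
apply: compact_closed; first exact: norm_hausdorff.
by apply: compact_setX; exact: segment_compact.
Qed.

Lemma half01 : (2^-1 : R) = 1 / 2. Proof. by rewrite div1r. Qed.

Lemma phom_trans g f k : phom f g -> phom g k -> phom f k.
Proof.
move=> fg gk; have [e0 e1] := phom_ends fg; have [e0' e1'] := phom_ends gk.
case: fg => H [Hc HX H1 H2]; case: gk => G [Gc GX G1 G2].
pose K (z : R * R) := if z.2 <= 2^-1 then H (z.1, 2 * z.2) else G (z.1, 2 * z.2 - 1).
have hA z : I2 z -> z.2 <= 2^-1 -> I2 (z.1, 2 * z.2).
  rewrite half01 => -[z1 z2] h; split => //=; move: z2; rewrite /= !in_itv /=; lra.
have hB z : I2 z -> 2^-1 <= z.2 -> I2 (z.1, 2 * z.2 - 1).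
  rewrite half01 => -[z1 z2] h; split => //=; move: z2; rewrite /= !in_itv /=; lra.
exists K; split.
- apply: (@within_continuous_paste _ _ _ (I2 `&` [set z | z.2 <= 2^-1]) (I2 `&` [set z | 2^-1 <= z.2])
    _ (fun z => H (z.1, 2 * z.2)) (fun z => G (z.1, 2 * z.2 - 1))).
  + by apply: closedI; [exact: closed_I2|exact: closed_le_snd].
  + by apply: closedI; [exact: closed_I2|exact: closed_ge_snd].
  + by move=> z z01; case: (leP z.2 2^-1) => h; [left|right; split => //; exact: ltW].
  + apply: (within_continuous_comp Hc); last by move=> z []; exact: hA.
    apply: continuous_subspaceT; apply: continuous_pair => z; first exact: cvg_fst.
    by apply: cvgM; [exact: cvg_cst|exact: cvg_snd].
  + apply: (within_continuous_comp Gc); last by move=> z []; exact: hB.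
    apply: continuous_subspaceT; apply: continuous_pair => z; first exact: cvg_fst.
    by apply: cvgB; [apply: cvgM; [exact: cvg_cst|exact: cvg_snd]|exact: cvg_cst].
  + by move=> z [_ /= h]; rewrite /K h.
  + move=> z [[z1 z2] /= h]; rewrite /K; case: ifPn => // h'.
    have -> : z.2 = 2^-1 by apply/eqP; rewrite eq_le h h'.
    rewrite divff ?pnatr_eq0// subrr.
    by have [-> _] := G1 _ z1; have [_ ->] := H1 _ z1.
- move=> _ [z z01 <-]; rewrite /K; case: (leP z.2 2^-1) => h.
    by apply: HX; exists (z.1, 2 * z.2) => //; exact: hA.
  by apply: GX; exists (z.1, 2 * z.2 - 1) => //; apply: hB => //; exact: ltW.
- move=> s s01; rewrite /K /= mulr0 mulr1 invr_ge0 ler0n.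
  have -> : (1 <= 2^-1 :> R) = false by apply/negbTE; rewrite -ltNge invf_lt1// ltr1n.
  have -> : 2 - 1 = 1 :> R by ring.
  by have [-> _] := H1 _ s01; have [_ ->] := G1 _ s01.
- move=> t t01; rewrite /K /=; case: (leP t 2^-1) => h.
    apply: H2; rewrite half01 in h; move: t01; rewrite !in_itv /=; lra.
  rewrite e0 e1; apply: G2; rewrite half01 in h; move: t01; rewrite !in_itv /=; lra.
Qed.

Lemma loop_mul0 f g : loop_mul f g 0 = f 0.
Proof. by rewrite /loop_mul invr_ge0 ler0n mulr0. Qed.
Lemma loop_mul1 f g : loop_mul f g 1 = g 1.
Proof.
rewrite /loop_mul; have -> : (1 <= 2^-1 :> R) = false by apply/negbTE; rewrite -ltNge invf_lt1// ltr1n.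
by have -> : 2 * 1 - 1 = 1 :> R by ring.
Qed.

Lemma phom_mul f f' g g' : f 1 = g 0 -> phom f f' -> phom g g' -> phom (loop_mul f g) (loop_mul f' g').
Proof.
move=> fg [H [Hc HX H1 H2]] [G [Gc GX G1 G2]].
pose K (z : R * R) := if z.1 <= 2^-1 then H (2 * z.1, z.2) else G (2 * z.1 - 1, z.2).
have hA z : I2 z -> z.1 <= 2^-1 -> I2 (2 * z.1, z.2).
  rewrite half01 => -[z1 z2] h; split => //=; move: z1; rewrite /= !in_itv /=; lra.
have hB z : I2 z -> 2^-1 <= z.1 -> I2 (2 * z.1 - 1, z.2).
  rewrite half01 => -[z1 z2] h; split => //=; move: z1; rewrite /= !in_itv /=; lra.
exists K; split.
- apply: (@within_continuous_paste _ _ _ (I2 `&` [set z | z.1 <= 2^-1]) (I2 `&` [set z | 2^-1 <= z.1])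
    _ (fun z => H (2 * z.1, z.2)) (fun z => G (2 * z.1 - 1, z.2))).
  + by apply: closedI; [exact: closed_I2|exact: closed_le_fst].
  + by apply: closedI; [exact: closed_I2|exact: closed_ge_fst].
  + by move=> z z01; case: (leP z.1 2^-1) => h; [left|right; split => //; exact: ltW].
  + apply: (within_continuous_comp Hc); last by move=> z []; exact: hA.
    apply: continuous_subspaceT; apply: continuous_pair => z; last exact: cvg_snd.
    by apply: cvgM; [exact: cvg_cst|exact: cvg_fst].
  + apply: (within_continuous_comp Gc); last by move=> z []; exact: hB.
    apply: continuous_subspaceT; apply: continuous_pair => z; last exact: cvg_snd.
    by apply: cvgB; [apply: cvgM; [exact: cvg_cst|exact: cvg_fst]|exact: cvg_cst].
  + by move=> z [_ /= h]; rewrite /K h.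
  + move=> z [[z1 z2] /= h]; rewrite /K; case: ifPn => // h'.
    have -> : z.1 = 2^-1 by apply/eqP; rewrite eq_le h h'.
    rewrite divff ?pnatr_eq0// subrr.
    by have [-> _] := G2 _ z2; have [_ ->] := H2 _ z2.
- move=> _ [z z01 <-]; rewrite /K; case: (leP z.1 2^-1) => h.
    by apply: HX; exists (2 * z.1, z.2) => //; exact: hA.
  by apply: GX; exists (2 * z.1 - 1, z.2) => //; apply: hB => //; exact: ltW.
- move=> s s01; rewrite /K /loop_mul /=; case: (leP s 2^-1) => h.
    apply: H1; rewrite half01 in h; move: s01; rewrite !in_itv /=; lra.
  apply: G1; rewrite half01 in h; move: s01; rewrite !in_itv /=; lra.
- move=> t t01; rewrite loop_mul0 loop_mul1 /K /= mulr0 mulr1 invr_ge0 ler0n.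
  have -> : (1 <= 2^-1 :> R) = false by apply/negbTE; rewrite -ltNge invf_lt1// ltr1n.
  have -> : 2 - 1 = 1 :> R by ring.
  by have [-> _] := H2 _ t01; have [_ ->] := G2 _ t01.
Qed.

Lemma phom_path f g : phom f g -> path_in X f /\ path_in X g.
Proof.
move=> [H [Hc HX H1 _]].
have P u : u \in `[0, 1] -> path_in X (fun s => H (s, u)).
  move=> u01; apply/path_inP; split.
    apply: (within_continuous_comp Hc); last by move=> s s01; split.
    by apply: continuous_subspaceT; apply: continuous_pair => z; [exact: cvg_id|exact: cvg_cst].
  by move=> t t01; apply: HX; exists (t, u).
split; apply/path_inP.
  have /path_inP[c x] := P _ I0; split; first by apply: within_continuous_eq c => s /H1[].
  by move=> t t01; have [<- _] := H1 _ t01; exact: x.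
have /path_inP[c x] := P _ I1; split; first by apply: within_continuous_eq c => s /H1[].
by move=> t t01; have [_ <-] := H1 _ t01; exact: x.
Qed.

Lemma path_mul f g : path_in X f -> path_in X g -> f 1 = g 0 -> path_in X (loop_mul f g).
Proof.
move=> /phom_refl ff /phom_refl gg e.
by have [] := phom_path (phom_mul e ff gg).
Qed.
End PathHomotopy.

Section PathAlgebra.
Context {R : realType} {V : normedModType R} (X : set V).
Implicit Types f g k : R -> V.
Local Notation "f ** g" := (loop_mul f g) (at level 40, left associativity).
Local Notation "f ~~ g" := (phom X f g) (at level 70).

Definition path_inv f : R -> V := fun t => f (1 - t).

Lemma lip_fun_continuous (p : R -> R) (L : R) : (forall x y, `|p x - p y| <= L * `|x - y|) ->
  {within `[0, 1], continuous p}.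
Proof.
move=> pL; apply/within_continuousP => x _ e e0.
exists (e / (`|L| + 1)); first by rewrite divr_gt0// ltr_wpDl.
move=> y _ xy; apply: le_lt_trans (pL _ _) _.
apply: (@le_lt_trans _ _ ((`|L| + 1) * `|x - y|)).
  by rewrite ler_wpM2r// ler_wpDr// ler_norm.
by rewrite mulrC -ltr_pdivlMr// ltr_wpDl.
Qed.

Lemma lip_max (p q : R -> R) (L x y : R) : `|p x - p y| <= L * `|x - y| -> `|q x - q y| <= L * `|x - y| ->
  `|Num.max (p x) (q x) - Num.max (p y) (q y)| <= L * `|x - y|.
Proof.
generalize (L * `|x - y|) => D; rewrite !ler_norml => /andP[? ?] /andP[? ?].
by case: (leP (p x) (q x)) => ?; case: (leP (p y) (q y)) => ?; lra.
Qed.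

Lemma lip_min (p q : R -> R) (L x y : R) : `|p x - p y| <= L * `|x - y| -> `|q x - q y| <= L * `|x - y| ->
  `|Num.min (p x) (q x) - Num.min (p y) (q y)| <= L * `|x - y|.
Proof.
generalize (L * `|x - y|) => D; rewrite !ler_norml => /andP[? ?] /andP[? ?].
by case: (leP (p x) (q x)) => ?; case: (leP (p y) (q y)) => ?; lra.
Qed.

Lemma lip_affine (c d L x y : R) : `|c| <= L -> `|(c * x + d) - (c * y + d)| <= L * `|x - y|.
Proof.
by move=> cL; have -> : (c * x + d) - (c * y + d) = c * (x - y) by [ring]; rewrite normrM ler_wpM2r.
Qed.

Lemma path_in_inv f : path_in X f -> path_in X (path_inv f).
Proof.
move=> /path_inP[fc fX].
have q01 t : t \in (`[0, 1] : interval R) -> 1 - t \in (`[0, 1] : interval R).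
  by rewrite !in_itv /=; lra.
apply/path_inP; split; last by move=> t t01; apply: fX; exact: q01.
apply: (within_continuous_comp fc); last exact: q01.
by apply: continuous_subspaceT => z; apply: cvgB; [exact: cvg_cst|exact: cvg_id].
Qed.

Lemma path_cst (x : V) : X x -> path_in X (fun _ : R => x).
Proof. by move=> Xx; apply/path_inP; split => //; apply: continuous_subspaceT => z; exact: cvg_cst. Qed.

Lemma phom_reparam_eq (F g : R -> V) (p q : R -> R) : path_in X F ->
  {within `[0, 1], continuous p} -> {within `[0, 1], continuous q} ->
  (forall t, t \in `[0, 1] -> p t \in `[0, 1]) -> (forall t, t \in `[0, 1] -> q t \in `[0, 1]) ->
  p 0 = q 0 -> p 1 = q 1 -> {in `[0, 1], F \o q =1 g} -> phom X (F \o p) g.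
Proof.
move=> FX pc qc p01 q01 e0 e1 qg; apply: (@phom_trans _ _ _ (F \o q)); first exact: phom_reparam.
have /path_inP[Fc FX'] := FX; apply: phom_ext qg; apply/path_inP; split.
  exact: (within_continuous_comp Fc qc q01).
by move=> t t01; apply: FX'; exact: q01.
Qed.

Lemma phom_assoc f g k : path_in X f -> path_in X g -> path_in X k -> f 1 = g 0 -> g 1 = k 0 ->
  f ** g ** k ~~ f ** (g ** k).
Proof.
move=> fX gX kX fg gk.
have FX : path_in X (f ** g ** k).
  by apply: path_mul => //; [exact: path_mul|rewrite loop_mul1].
pose p (t : R) := Num.max (t / 2) (Num.max (t - 4^-1) (2 * t - 1)).
have pc : {within `[0, 1], continuous p}.
  apply: (@lip_fun_continuous p 2) => x y.
  apply: (lip_max (p := fun t => t / 2) (q := fun t => Num.max (t - 4^-1) (2 * t - 1))).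
    by rewrite -mulrBl normrM mulrC ler_wpM2r// ger0_norm; lra.
  apply: (lip_max (p := fun t => t - 4^-1) (q := fun t => 2 * t - 1)); last by apply: lip_affine; rewrite ger0_norm; lra.
  have -> : x - 4^-1 - (y - 4^-1) = x - y by ring.
  by have := normr_ge0 (x - y); lra.
have p01 t : t \in (`[0, 1] : interval R) -> p t \in (`[0, 1] : interval R).
  by rewrite !in_itv /= /p !ge_max !le_max => /andP[? ?]; lra.
have p0 : p 0 = 0 by apply/eqP; rewrite /p eq_le !ge_max !le_max; lra.
have p1 : p 1 = 1 by apply/eqP; rewrite /p eq_le !ge_max !le_max; lra.
apply: (phom_reparam_eq FX _ pc (p := id)) => //.
  by apply: continuous_subspaceT => z; exact: cvg_id.
move=> t; rewrite in_itv /= => /andP[t0 t1]; rewrite /loop_mul half01 /=.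
have [h|h] := leP t (1 / 2).
  have -> : p t = t / 2 by apply/eqP; rewrite /p eq_le !ge_max !le_max; lra.
  have -> : t / 2 <= 1 / 2 by lra.
  have -> : 2 * (t / 2) = t by field.
  by rewrite h.
have [h'|h'] := leP (2 * t - 1) (1 / 2).
  have -> : p t = t - 4^-1 by apply/eqP; rewrite /p eq_le !ge_max !le_max; lra.
  have -> : t - 4^-1 <= 1 / 2 by lra.
  have -> : (2 * (t - 4^-1) <= 1 / 2) = false by apply/negbTE; rewrite -ltNge; lra.
  by congr g; field.
have -> : p t = 2 * t - 1 by apply/eqP; rewrite /p eq_le !ge_max !le_max; lra.
by have -> : (2 * t - 1 <= 1 / 2) = false by apply/negbTE; rewrite -ltNge; lra.
Qed.

Lemma phom_cstl f : path_in X f -> (fun=> f 0) ** f ~~ f.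
Proof.
move=> fX; pose p (t : R) := Num.max 0 (2 * t - 1).
have pc : {within `[0, 1], continuous p}.
  apply: (@lip_fun_continuous p 2) => x y; apply: (lip_max (p := fun=> 0) (q := fun t => 2 * t - 1)).
    by rewrite subrr normr0 mulr_ge0.
  by apply: lip_affine; rewrite ger0_norm; lra.
have p01 t : t \in (`[0, 1] : interval R) -> p t \in (`[0, 1] : interval R).
  by rewrite !in_itv /= /p !ge_max !le_max => /andP[? ?]; lra.
have p0 : p 0 = 0 by apply/eqP; rewrite /p eq_le !ge_max !le_max; lra.
have p1 : p 1 = 1 by apply/eqP; rewrite /p eq_le !ge_max !le_max; lra.
apply: phom_sym; apply: (phom_reparam_eq fX _ pc (p := id)) => //.
  by apply: continuous_subspaceT => z; exact: cvg_id.
move=> t; rewrite in_itv /= => /andP[t0 t1]; rewrite /loop_mul half01 /=.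
have [h|h] := leP t (1 / 2).
  by have -> : p t = 0 by apply/eqP; rewrite /p eq_le !ge_max !le_max; lra.
by have -> : p t = 2 * t - 1 by apply/eqP; rewrite /p eq_le !ge_max !le_max; lra.
Qed.

Lemma phom_cstr f : path_in X f -> f ** (fun=> f 1) ~~ f.
Proof.
move=> fX; pose p (t : R) := Num.min 1 (2 * t).
have pc : {within `[0, 1], continuous p}.
  apply: (@lip_fun_continuous p 2) => x y; apply: (lip_min (p := fun=> 1) (q := fun t => 2 * t)).
    by rewrite subrr normr0 mulr_ge0.
  by rewrite -mulrBr normrM ger0_norm.
have p01 t : t \in (`[0, 1] : interval R) -> p t \in (`[0, 1] : interval R).
  by rewrite !in_itv /= /p !ge_min !le_min => /andP[? ?]; lra.
have p0 : p 0 = 0 by apply/eqP; rewrite /p eq_le !ge_min !le_min; lra.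
have p1 : p 1 = 1 by apply/eqP; rewrite /p eq_le !ge_min !le_min; lra.
apply: phom_sym; apply: (phom_reparam_eq fX _ pc (p := id)) => //.
  by apply: continuous_subspaceT => z; exact: cvg_id.
move=> t; rewrite in_itv /= => /andP[t0 t1]; rewrite /loop_mul half01 /=.
have [h|h] := leP t (1 / 2).
  by have -> : p t = 2 * t by apply/eqP; rewrite /p eq_le !ge_min !le_min; lra.
by have -> : p t = 1 by apply/eqP; rewrite /p eq_le !ge_min !le_min; lra.
Qed.

Lemma phom_invl f : path_in X f -> path_inv f ** f ~~ (fun=> f 1).
Proof.
move=> fX; pose p (t : R) := Num.max (1 - 2 * t) (2 * t - 1).
have pc : {within `[0, 1], continuous p}.
  apply: (@lip_fun_continuous p 2) => x y; apply: (lip_max (p := fun t => 1 - 2 * t) (q := fun t => 2 * t - 1)).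
    have -> : 1 - 2 * x - (1 - 2 * y) = - (2 * (x - y)) by ring.
    by rewrite normrN normrM ger0_norm.
  by apply: lip_affine; rewrite ger0_norm; lra.
have p01 t : t \in (`[0, 1] : interval R) -> p t \in (`[0, 1] : interval R).
  rewrite !in_itv /= /p !ge_max !le_max => /andP[? ?]; apply/andP; split; last by lra.
  by case: (leP 0 (1 - 2 * t)) => //= ?; lra.
have p0 : p 0 = 1 by apply/eqP; rewrite /p eq_le !ge_max !le_max; lra.
have p1 : p 1 = 1 by apply/eqP; rewrite /p eq_le !ge_max !le_max; lra.
apply: phom_sym; apply: (phom_reparam_eq fX _ pc (p := fun=> 1)) => //.
  - by apply: continuous_subspaceT => z; exact: cvg_cst.
  - by move=> t _; exact: I1.
move=> t; rewrite in_itv /= => /andP[t0 t1]; rewrite /loop_mul /path_inv half01 /=.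
have [h|h] := leP t (1 / 2).
  by have -> : p t = 1 - 2 * t by apply/eqP; rewrite /p eq_le !ge_max !le_max; lra.
by have -> : p t = 2 * t - 1 by apply/eqP; rewrite /p eq_le !ge_max !le_max; lra.
Qed.

Lemma phom_triangle (tau : R * R -> V) : singular2 X tau ->
  (fun t => tau (t, 0)) ** (fun t => tau (1 - t, t)) ~~ (fun t => tau (0, t)).
Proof.
move=> [tc tX].
pose p (t : R) : R * R := (Num.min (2 * t) (2 - 2 * t), Num.max 0 (2 * t - 1)).
pose q (t : R) : R * R := (0, t).
have pc : {within `[0, 1], continuous p}.
  apply: within_continuous_pair.
    apply: (@lip_fun_continuous _ 2) => x y; apply: (lip_min (p := fun t => 2 * t) (q := fun t => 2 - 2 * t)).
      by rewrite -mulrBr normrM ger0_norm.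
    have -> : 2 - 2 * x - (2 - 2 * y) = - (2 * (x - y)) by ring.
    by rewrite normrN normrM ger0_norm.
  apply: (@lip_fun_continuous _ 2) => x y; apply: (lip_max (p := fun=> 0) (q := fun t => 2 * t - 1)).
    by rewrite subrr normr0 mulr_ge0.
  by apply: lip_affine; rewrite ger0_norm; lra.
have qc : {within `[0, 1], continuous q}.
  by apply: continuous_subspaceT; apply: continuous_pair => z; [exact: cvg_cst|exact: cvg_id].
have pT t : t \in (`[0, 1] : interval R) -> triangle (p t).
  rewrite in_itv /= /p /triangle => /andP[? ?] /=; case: (leP (2 * t) (2 - 2 * t)) => ?; case: (leP 0 (2 * t - 1)) => ?; split; lra.
have qT t : t \in (`[0, 1] : interval R) -> triangle (q t).
  rewrite in_itv /= /q /triangle => /andP[? ?] /=; split; lra.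
have H : tau \o p ~~ tau \o q.
  apply: (@phom_convex _ _ X _ triangle tau p q) => //.
  - move=> [x1 x2] [y1 y2] t; rewrite /triangle in_itv /= => -[? ? ?] [? ? ?] /andP[? ?].
    rewrite /GRing.scale /=; split; nra.
  - by rewrite /p /q; congr (_, _); [case: leP => ?|case: leP => ?]; lra.
  - by rewrite /p /q; congr (_, _); [case: leP => ?|case: leP => ?]; lra.
apply: phom_trans H; apply: phom_sym; apply: phom_ext.
  apply/path_inP; split; last by move=> t t01; apply: tX; exists (p t) => //; exact: pT.
  exact: (within_continuous_comp tc pc pT).
move=> t; rewrite in_itv /= => /andP[t0 t1]; rewrite /loop_mul half01 /= /p.
case: (leP t (1 / 2)) => h; congr tau; congr (_, _).
- by rewrite min_l; lra.
- by rewrite max_l; lra.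
- by rewrite min_r; lra.
- by rewrite max_r; lra.
Qed.
End PathAlgebra.

Section FreeWords.
Context {R : realType} {m : nat}.

Definition exps (k : 'I_m) (w : seq ('I_m * bool)) : R :=
  \sum_(x <- w) (if x.1 == k then (if x.2 then 1 else - 1) else 0).

Lemma exps_cat k u v : exps k (u ++ v) = exps k u + exps k v.
Proof. by rewrite /exps big_cat. Qed.

Lemma exps_equiv k u v : free_equiv u v -> exps k u = exps k v.
Proof.
elim=> [w //|w1 w2 _ -> //|w1 w2 w3 _ -> _ -> //|{}u {}v i b].
rewrite !exps_cat; congr (_ + _).
rewrite /exps !big_cons /= addrA; case: (i == k); rewrite ?addr0 ?add0r//.
by case: b => /=; rewrite ?subrr ?addNr add0r.
Qed.
End FreeWords.

Section Pi1Cocycles.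
Context {R : realType} {V : normedModType R} (X : set V) (x0 : V) (m : nat).
Variable Phi : seq ('I_m * bool) -> R -> V.
Hypothesis Phi_loop : forall w, loop_at X x0 (Phi w).
Hypothesis Phi_mul : forall u v, loop_homotopic X x0 (Phi (u ++ v)) (loop_mul (Phi u) (Phi v)).
Hypothesis Phi_inj : forall u v, loop_homotopic X x0 (Phi u) (Phi v) <-> free_equiv u v.
Hypothesis Phi_surj : forall f, loop_at X x0 f -> exists w, loop_homotopic X x0 f (Phi w).
Hypothesis X0 : X x0.
Implicit Types f g h : R -> V.
Hypothesis conn : forall x, X x -> exists f : R -> V, [/\ path_in X f, f 0 = x0 & f 1 = x].
Local Notation "f ** g" := (loop_mul f g) (at level 40, left associativity).
Local Notation "f ~~ g" := (phom X f g) (at level 70).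

Definition spoke (x : V) : R -> V :=
  if `[< x = x0 >] then (fun=> x0)
  else if pselect (X x) is left H then sval (cid (conn H)) else (fun=> x0).

Lemma spokeP x : X x -> [/\ path_in X (spoke x), spoke x 0 = x0 & spoke x 1 = x].
Proof.
move=> Xx; rewrite /spoke; case: asboolP => [->|_]; first by split => //; exact: path_cst.
by case: pselect => // H; case: (cid (conn H)).
Qed.

Lemma spoke0 : spoke x0 = (fun _ : R => x0).
Proof. by rewrite /spoke asboolT. Qed.

Definition loopify (f : R -> V) : R -> V := (spoke (f 0) ** f) ** path_inv (spoke (f 1)).

Lemma path_end f t : path_in X f -> t \in `[0, 1] -> X (f t).
Proof. by move=> /path_inP[_]; apply. Qed.

Lemma inv_ends (f : R -> V) : path_inv f 0 = f 1 /\ path_inv f 1 = f 0.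
Proof. by rewrite /path_inv subr0 subrr. Qed.

Lemma loopifyP f : path_in X f -> loop_at X x0 (loopify f).
Proof.
move=> fX; have [e1 e2 e3] := spokeP (path_end fX I0); have [e1' e2' e3'] := spokeP (path_end fX I1).
have [i0 i1] := inv_ends (spoke (f 1)).
split.
- apply: path_mul; first by apply: path_mul.
    exact: path_in_inv.
  by rewrite loop_mul1 i0.
- by rewrite /loopify !loop_mul0.
- by rewrite /loopify loop_mul1 i1.
Qed.

Definition word (f : R -> V) : seq ('I_m * bool) :=
  if pselect (path_in X f) is left H then sval (cid (Phi_surj (loopifyP H))) else [::].

(* A path is closed up by fixed paths from the base point to its endpoints. *)
Definition Psi (k : 'I_m) (f : R -> V) : R :=
  if `[< path_in X f >] then exps k (word f) else 0.

Lemma PsiE k f : path_in X f -> Psi k f = exps k (word f).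
Proof. by move=> fX; rewrite /Psi asboolT. Qed.

Lemma loopify_word f : path_in X f -> loopify f ~~ Phi (word f).
Proof.
move=> fX; have [_ l0 l1] := loopifyP fX.
rewrite /word; case: pselect => // H; case: cid => w /= Hw.
exact/(phom_loop _ _ l0 l1).
Qed.

Lemma Phi_equiv u v : Phi u ~~ Phi v -> free_equiv u v.
Proof. by have [_ l0 l1] := Phi_loop u; move=> H; apply/Phi_inj/(phom_loop _ _ l0 l1). Qed.

Lemma Psi_word k f w : path_in X f -> loopify f ~~ Phi w -> Psi k f = exps k w.
Proof.
move=> fX H; rewrite PsiE//.
apply: exps_equiv; apply: Phi_equiv; apply: phom_trans H.
by apply: phom_sym; exact: loopify_word.
Qed.

Lemma loopify_hom f g : f ~~ g -> loopify f ~~ loopify g.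
Proof.
move=> fg; have [e0 e1] := phom_ends fg; have [fX gX] := phom_path fg.
have [a1 a2 a3] := spokeP (path_end fX I0); have [b1 b2 b3] := spokeP (path_end fX I1).
rewrite /loopify -e0 -e1; have [i0 i1] := inv_ends (spoke (f 1)).
apply: phom_mul; [by rewrite loop_mul1 i0| |by apply/phom_refl/path_in_inv].
by apply: phom_mul => //; exact: phom_refl.
Qed.

Lemma Psi_hom k f g : f ~~ g -> Psi k f = Psi k g.
Proof.
move=> fg; have [fX gX] := phom_path fg.
rewrite (Psi_word k fX (w := word g)); last by apply: phom_trans (loopify_hom fg) (loopify_word gX).
by rewrite PsiE.
Qed.

Lemma loopify_mul f g h : path_in X f -> path_in X g -> f 1 = g 0 -> f ** g ~~ h ->
  loopify f ** loopify g ~~ loopify h.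
Proof.
move=> fX gX fg fgh; have [h0 h1] := phom_ends fgh.
rewrite loop_mul0 in h0; rewrite loop_mul1 in h1.
have [a1 a2 a3] := spokeP (path_end fX I0).
have [b1 b2 b3] := spokeP (path_end gX I0).
have [c1 c2 c3] := spokeP (path_end gX I1).
have [_ hX] := phom_path fgh.
rewrite /loopify -h0 -h1 fg.
set a := spoke (f 0) in a1 a2 a3 *; set b := spoke (g 0) in b1 b2 b3 *; set c := spoke (g 1) in c1 c2 c3 *.
have [ib0 ib1] := inv_ends b; have [ic0 ic1] := inv_ends c.
rewrite b3 in ib0; rewrite c3 in ic0.
have bX := path_in_inv b1; have cX := path_in_inv c1.
have afX : path_in X (a ** f) by exact: path_mul.
have bgX : path_in X (b ** g) by exact: path_mul.
have bgcX : path_in X (b ** g ** path_inv c) by apply: path_mul => //; rewrite loop_mul1 ic0.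
have gcX : path_in X (g ** path_inv c) by apply: path_mul.
have ibbX : path_in X (path_inv b ** b) by apply: path_mul.
have af1 : (a ** f) 1 = g 0 by rewrite loop_mul1 fg.
have S1 : path_inv b ** (b ** g ** path_inv c) ~~ g ** path_inv c.
  apply: (@phom_trans _ _ _ (path_inv b ** (b ** g) ** path_inv c)).
    apply: phom_sym; apply: phom_assoc => //; first by rewrite loop_mul0 ib1.
    by rewrite loop_mul1 ic0.
  apply: phom_mul; [by rewrite !loop_mul1 ic0| |exact: phom_refl].
  apply: (@phom_trans _ _ _ (path_inv b ** b ** g)).
    by apply: phom_sym; apply: phom_assoc.
  apply: (@phom_trans _ _ _ ((fun=> g 0) ** g)); last exact: phom_cstl.
  apply: phom_mul; [by rewrite loop_mul1| |exact: phom_refl].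
  by rewrite -b3; exact: phom_invl.
apply: (@phom_trans _ _ _ (a ** f ** (path_inv b ** (b ** g ** path_inv c)))).
  apply: phom_assoc => //; first by rewrite af1 ib0.
  by rewrite ib1 !loop_mul0.
apply: (@phom_trans _ _ _ (a ** f ** (g ** path_inv c))).
  by apply: phom_mul => //; [rewrite loop_mul0 af1 ib0|exact: phom_refl].
apply: (@phom_trans _ _ _ (a ** f ** g ** path_inv c)).
  apply: phom_sym; apply: phom_assoc => //; by rewrite ?ic0.
apply: phom_mul; [by rewrite loop_mul1 ic0| |exact: phom_refl].
apply: (@phom_trans _ _ _ (a ** (f ** g))); first exact: phom_assoc.
by apply: phom_mul => //; [rewrite loop_mul0|exact: phom_refl].
Qed.

Lemma Psi_mul k f g h : path_in X f -> path_in X g -> f 1 = g 0 -> f ** g ~~ h ->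
  Psi k h = Psi k f + Psi k g.
Proof.
move=> fX gX fg H; have [_ hX] := phom_path H.
have [_ lf0 lf1] := loopifyP fX; have [_ lg0 lg1] := loopifyP gX.
have [_ p0 p1] := Phi_loop (word f ++ word g).
rewrite (Psi_word k hX (w := word f ++ word g)).
  by rewrite exps_cat !PsiE.
apply: phom_sym; apply: (phom_trans ((phom_loop _ _ p0 p1).1 (Phi_mul _ _))).
apply: phom_trans (loopify_mul fX gX fg H).
apply: phom_mul; last 2 first.
- by apply: phom_sym; exact: loopify_word.
- by apply: phom_sym; exact: loopify_word.
have [_ _ ->] := Phi_loop (word f); by have [_ -> _] := Phi_loop (word g).
Qed.

Lemma Psi_cocycle k : singular_cocycle X (Psi k).
Proof.
split=> [f g fg|tau tauX].
  have [fX|nfX] := pselect (path_in X f); first by apply: Psi_hom; exact: phom_ext.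
  have ngX : ~ path_in X g.
    move=> /path_inP[gc gX]; apply: nfX; apply/path_inP; split.
      by apply: within_continuous_eq gc => x x01; rewrite fg.
    by move=> t t01; rewrite fg//; exact: gX.
  by rewrite /Psi !asboolF.
have := phom_triangle tauX => H.
have [tc tX] := tauX.
have P (q : R -> R * R) : continuous q -> (forall t, t \in `[0, 1] -> triangle (q t)) -> path_in X (tau \o q).
  move=> qc qT; apply/path_inP; split; last by move=> t t01; apply: tX; exists (q t) => //; exact: qT.
  by apply: (within_continuous_comp tc _ qT); exact: continuous_subspaceT.
have P1 : path_in X (fun t => tau (t, 0)).
  apply: (P (fun t => (t, 0))); first by apply: continuous_pair => z; [exact: cvg_id|exact: cvg_cst].
  by move=> t; rewrite in_itv /triangle /= => /andP[? ?]; split; lra.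
have P2 : path_in X (fun t => tau (1 - t, t)).
  apply: (P (fun t => (1 - t, t))).
    by apply: continuous_pair => z; [apply: cvgB; [exact: cvg_cst|exact: cvg_id]|exact: cvg_id].
  by move=> t; rewrite in_itv /triangle /= => /andP[? ?]; split; lra.
by rewrite (Psi_mul k P1 P2 _ H) /= ?subr0//; ring.
Qed.

Lemma Psi_loop k f w : loop_at X x0 f -> f ~~ Phi w -> Psi k f = exps k w.
Proof.
move=> [fX f0 f1] H; apply: Psi_word => //; apply: phom_trans H.
rewrite /loopify f0 f1 spoke0.
have -> : path_inv (fun=> x0) = (fun=> x0) :> (R -> V) by apply/funext.
have cX := path_cst (R := R) X0.
have fcX : path_in X ((fun _ : R => x0) ** f) by apply: path_mul.
apply: (@phom_trans _ _ _ ((fun _ : R => x0) ** f)).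
  by have := phom_cstr fcX; rewrite loop_mul1 f1.
by have := phom_cstl fX; rewrite f0.
Qed.
End Pi1Cocycles.

Lemma pi1_cocycles (R : realType) (V : normedModType R) (X : set V) (x0 : V) (m : nat) :
  pi1_isom_free (R := R) X x0 m -> X x0 ->
  (forall x, X x -> exists f : R -> V, [/\ path_in X f, f 0 = x0 & f 1 = x]) ->
  exists (Psi : 'I_m -> (R -> V) -> R) (f : 'I_m -> R -> V),
    [/\ forall k, singular_cocycle X (Psi k), forall l, path_in X (f l) /\ f l 0 = f l 1 &
        forall k l, Psi k (f l) = (k == l)%:R].
Proof.
move=> [Phi [P1 P2 P3 P4]] Xx0 conn.
exists (Psi P4 Xx0 conn), (fun l => Phi [:: (l, true)]); split.
- by move=> k; apply: Psi_cocycle.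
- by move=> l; have [? -> ->] := P1 [:: (l, true)].
- move=> k l; have [p e0 e1] := P1 [:: (l, true)].
  rewrite (@Psi_loop _ _ _ _ _ _ P1 P3 _ _ _ _ _ [:: (l, true)])//; last exact: phom_refl.
  by rewrite /exps big_cons big_nil /= addr0 eq_sym; case: eqP.
Qed.

(** * Polynomial approximation of Lipschitz functions *)

Section Korovkin.
Context {R : realType}.

Lemma sin_le_id (x : R) : 0 <= x -> sin x <= x.
Proof.
rewrite le_eqVlt => /orP[/eqP <-|x0]; first by rewrite sin0.
have [c _ /eqP] := @MVT_segment R sin cos 0 x (ltW x0) (fun z _ => is_derive_sin z)
   (continuous_subspaceT (@continuous_sin R)).
rewrite sin0 !subr0 => /eqP ->.
by rewrite ler_piMl ?cos_le1// ltW.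
Qed.

Lemma cos_quad (b : R) : 0 <= b -> 2 - 2 * cos b <= b ^+ 2.
Proof.
move=> b0; have h2 : b = b / 2 + b / 2 by field.
have E : cos b = 1 - 2 * sin (b / 2) ^+ 2.
  have -> : cos b = cos (b / 2 + b / 2) by rewrite -h2.
  by have := cos2Dsin2 (b / 2); rewrite cosD; nra.
have s1 : sin (b / 2) <= b / 2 by apply: sin_le_id; lra.
have s2 : - (b / 2) <= sin (b / 2).
  have [bp|bp] := leP (b / 2) pi.
    have : 0 <= sin (b / 2) by apply: sin_ge0_pi; apply/andP; split; lra.
    lra.
  have := sin_geN1 (b / 2); have := @pi_ge2 R; lra.
rewrite E; nra.
Qed.

Lemma sin_period (x : R) (j : nat) : sin (x - j%:R * (2 * pi)) = sin x.
Proof.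
elim: j => [|j IH]; first by rewrite mul0r subr0.
have -> : x - j.+1%:R * (2 * pi) = x - j%:R * (2 * pi) - pi - pi by rewrite -natr1; ring.
rewrite sinB sinpi cospi mulr0 subr0 sinB sinpi cospi mulr0 subr0 IH; ring.
Qed.

Lemma sum_cos_grid (Q j : nat) (theta : R) : (0 < j)%N -> (j < Q)%N ->
  \sum_(q < Q) cos (j%:R * (theta - 2 * pi * q%:R / Q%:R)) = 0.
Proof.
move=> j0 jQ; have Q0 : 0 < Q%:R :> R by rewrite ltr0n (leq_trans _ jQ).
have Qn : Q%:R != 0 :> R by rewrite gt_eqF.
pose h := j%:R * pi / Q%:R : R.
have h0 : 0 < sin h.
  apply: sin_gt0_pi; rewrite divr_gt0 ?mulr_gt0 ?ltr0n ?pi_gt0 ?(leq_ltn_trans _ jQ)//=.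
  by rewrite ltr_pdivrMr// mulrC ltr_pM2l ?pi_gt0// ltr_nat.
pose g (q : nat) := sin (j%:R * theta + h - 2 * h * q%:R).
have E (q : nat) : 2 * sin h * cos (j%:R * (theta - 2 * pi * q%:R / Q%:R)) = - (g q.+1 - g q).
  have -> : j%:R * (theta - 2 * pi * q%:R / Q%:R) = j%:R * theta - 2 * h * q%:R.
    by rewrite /h; field.
  set y := j%:R * theta - 2 * h * q%:R.
  have -> : g q = sin (y + h) by rewrite /g /y; congr sin; ring.
  have -> : g q.+1 = sin (y - h) by rewrite /g /y -natr1; congr sin; ring.
  by rewrite (sinB y h) (sinD y h); move: (sin y) (cos y) (sin h) (cos h) => *; ring.
have S : \sum_(q < Q) 2 * sin h * cos (j%:R * (theta - 2 * pi * q%:R / Q%:R)) = 0.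
  under eq_bigr do rewrite E.
  rewrite sumrN -(big_mkord xpredT (fun q => g q.+1 - g q)) telescope_sumr//.
  have -> : g Q = g 0%N.
    rewrite /g mulr0 subr0.
    have -> : j%:R * theta + h - 2 * h * Q%:R = (j%:R * theta + h) - j%:R * (2 * pi).
      by rewrite /h; field.
    by rewrite sin_period.
  by rewrite subrr oppr0.
move: S; rewrite -mulr_sumr => /eqP; rewrite !mulf_eq0 pnatr_eq0 (gt_eqF h0) /=.
by move=> /eqP.
Qed.

Lemma chebyshev_ex (k : nat) : exists2 T : {poly R}, (size T <= k.+1)%N &
  forall t, T.[cos t] = cos (k%:R * t).
Proof.
suff [T [T' [h1 h2 h3 h4]]] : exists T T' : {poly R}, [/\ (size T <= k.+1)%N, (size T' <= k.+2)%N,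
   forall t, T.[cos t] = cos (k%:R * t) & forall t, T'.[cos t] = cos (k.+1%:R * t)].
  by exists T.
elim: k => [|k [T [T' [h1 h2 h3 h4]]]].
  exists 1, 'X; split; rewrite ?size_poly1 ?size_polyX// => t.
    by rewrite hornerC mul0r cos0.
  by rewrite hornerX mul1r.
exists T', ('X * T' *+ 2 - T); split => //.
  apply: leq_trans (size_polyD _ _) _; rewrite geq_max size_polyN; apply/andP; split.
    rewrite -scaler_nat; apply: leq_trans (size_scale_leq _ _) _.
    by apply: leq_trans (size_polyMleq _ _) _; rewrite size_polyX.
  by apply: leq_trans h1 _; lia.
move=> t; rewrite hornerD hornerN hornerMn hornerM hornerX h3 h4.
have -> : k.+2%:R * t = k.+1%:R * t + t by rewrite -[in LHS]natr1; ring.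
have -> : k%:R * t = k.+1%:R * t - t by rewrite -natr1; ring.
by rewrite (cosB (_ * t)) (cosD (_ * t)); ring.
Qed.

Definition cheb k := sval (cid2 (chebyshev_ex k)).
Lemma size_cheb k : (size (cheb k) <= k.+1)%N. Proof. by rewrite /cheb; case: cid2. Qed.
Lemma chebE k t : (cheb k).[cos t] = cos (k%:R * t). Proof. by rewrite /cheb; case: cid2. Qed.

Section Kernel.
Variable N : nat.
Let Q := N.+2.
Let beta : R := pi / Q%:R.
(* An eigenvector of the adjacency matrix of a path of length N + 1, for the
   largest eigenvalue [2 cos beta]: this choice minimizes the mean of
   [2 - 2 cos t] with respect to the kernel [K]. *)
Let a (k : nat) : R := sin (k.+1%:R * beta).
Let S : R := \sum_(k < N.+1) a k ^+ 2.
Let dist (k l : nat) : nat := (k - l) + (l - k).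
Let K (t : R) : R := \sum_(k < N.+1) \sum_(l < N.+1) a k * a l * cos ((dist k l)%:R * t).
Let node (q : nat) : R := 2 * pi * q%:R / Q%:R.

Let cos_dist k l (t : R) : cos ((dist k l)%:R * t) = cos (k%:R * t) * cos (l%:R * t) + sin (k%:R * t) * sin (l%:R * t).
Proof.
have [kl|lk] := leqP k l.
  have -> : dist k l = (l - k)%N by rewrite /dist; lia.
  rewrite natrB// mulrBl cosB; ring.
have -> : dist k l = (k - l)%N by rewrite /dist; lia.
by rewrite natrB ?(ltnW lk)// mulrBl cosB.
Qed.

Let K_ge0 (t : R) : 0 <= K t.
Proof.
have -> : K t = (\sum_(k < N.+1) a k * cos (k%:R * t)) ^+ 2 + (\sum_(k < N.+1) a k * sin (k%:R * t)) ^+ 2.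
  rewrite !expr2 !mulr_suml -big_split /=; apply: eq_bigr => k _.
  rewrite !mulr_sumr -big_split /=; apply: eq_bigr => l _.
  by rewrite cos_dist; ring.
by rewrite addr_ge0// sqr_ge0.
Qed.

Let Q0 : 0 < Q%:R :> R. Proof. by rewrite ltr0n. Qed.
Let beta0 : 0 < beta. Proof. by rewrite divr_gt0// pi_gt0. Qed.

Let S_gt0 : 0 < S.
Proof.
rewrite /S big_ord_recl /= ltr_pwDl ?sumr_ge0//; last by move=> i _; exact: sqr_ge0.
rewrite exprn_gt0// /a mul1r sin_gt0_pi// beta0 /= /beta ltr_pdivrMr// ltr_pMr ?pi_gt0//.
by rewrite ltr1n.
Qed.

Let dist_lt k l : (k < N.+1)%N -> (l < N.+1)%N -> (dist k l < Q.-1)%N.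
Proof. by rewrite /dist /Q; lia. Qed.

Let sum_grid j (theta : R) : (j < Q)%N ->
  \sum_(q < Q) cos (j%:R * (theta - node q)) = (j == 0%N)%:R * Q%:R.
Proof.
case: j => [|j] jQ; last by rewrite mul0r /node sum_cos_grid.
rewrite mul1r -[Q in RHS]card_ord -[RHS]mulr1 mulr_natl -sumr_const.
by apply: eq_bigr => q _; rewrite mul0r cos0.
Qed.

Let mean_K (theta : R) : \sum_(q < Q) K (theta - node q) = Q%:R * S.
Proof.
rewrite /K exchange_big /= /S mulr_sumr; apply: eq_bigr => k _.
rewrite exchange_big /= (bigD1 k)//= [X in _ + X]big1 ?addr0.
  rewrite -mulr_sumr sum_grid; last by apply: (leq_trans (dist_lt _ _)).
  have -> : dist k k = 0%N by rewrite /dist; lia.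
  by rewrite eqxx mul1r mulrC.
move=> l lk; rewrite -mulr_sumr sum_grid; last by apply: (leq_trans (dist_lt _ _)).
have -> : (dist k l == 0%N) = false.
  by apply/negbTE; move: lk; rewrite -(inj_eq val_inj) /dist /=; lia.
by rewrite mul0r mulr0.
Qed.

Let sum_grid_cos j (theta : R) : (j < Q.-1)%N ->
  \sum_(q < Q) cos (j%:R * (theta - node q)) * cos (theta - node q) = (j == 1%N)%:R * Q%:R / 2.
Proof.
case: j => [|j] jQ.
  under eq_bigr do rewrite mul0r cos0 mul1r -[theta - _]mul1r.
  by rewrite (sum_grid (j := 1))// !mul0r.
have -> : \sum_(q < Q) cos (j.+1%:R * (theta - node q)) * cos (theta - node q) =
   \sum_(q < Q) (cos (j.+2%:R * (theta - node q)) / 2 + cos (j%:R * (theta - node q)) / 2).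
  apply: eq_bigr => q _.
  have -> : j.+2%:R * (theta - node q) = j.+1%:R * (theta - node q) + (theta - node q).
    by rewrite -[in LHS]natr1; ring.
  have -> : j%:R * (theta - node q) = j.+1%:R * (theta - node q) - (theta - node q).
    by rewrite -[in RHS]natr1; ring.
  by rewrite (cosB (_ * _)) (cosD (_ * _)); lra.
rewrite big_split /= -!mulr_suml !sum_grid//; last by rewrite /Q in jQ *; lia.
  by rewrite /= mul0r mul0r add0r eqSS.
Qed.

Let sum_delta n (F : nat -> R) (i : nat) : \sum_(l < n) ((l : nat) == i)%:R * F l = (i < n)%:R * F i.
Proof.
have [ni|ni] := ltnP i n.
  rewrite (bigD1 (Ordinal ni))//= eqxx big1 ?addr0// => l.
  by rewrite -(inj_eq val_inj) /= => /negbTE ->; rewrite mul0r.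
rewrite mul0r big1// => l _; have -> : ((l : nat) == i) = false; last by rewrite mul0r.
by apply/negbTE; rewrite neq_ltn (leq_trans (ltn_ord l) ni).
Qed.

Let neighbours k : (k < N.+1)%N -> \sum_(l < N.+1) (dist k l == 1%N)%:R * a l = 2 * cos beta * a k.
Proof.
move=> kN.
have -> : \sum_(l < N.+1) (dist k l == 1%N)%:R * a l =
   \sum_(l < N.+1) (((l : nat) == k.+1)%:R * a l + ((l : nat) == k.-1)%:R * ((0 < k)%N%:R * a l)).
  apply: eq_bigr => l _; rewrite mulrA -mulrDl -natrM -natrD; congr (_%:R * _).
  by rewrite /dist; case: k {kN} => [|k] /=; case: eqP; case: eqP; case: eqP => //=; lia.
rewrite big_split /= (sum_delta _ a) (sum_delta _ (fun l => (0 < k)%N%:R * a l)).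
have k1 : (k.-1 < N.+1)%N by lia.
have -> : (k.+1 < N.+1)%N%:R * a k.+1 = sin (k.+2%:R * beta).
  have [kk|kk] := ltnP k.+1 N.+1; first by rewrite mul1r.
  have -> : k.+2 = Q by rewrite /Q; lia.
  by rewrite mul0r /beta mulrC divfK ?gt_eqF// sinpi.
have -> : (k.-1 < N.+1)%N%:R * ((0 < k)%N%:R * a k.-1) = sin (k%:R * beta).
  rewrite k1 mul1r; case: k {kN k1} => [|k] /=; first by rewrite !mul0r sin0.
  by rewrite mul1r.
have -> : k.+2%:R * beta = k.+1%:R * beta + beta by rewrite -[in LHS]natr1; ring.
have -> : k%:R * beta = k.+1%:R * beta - beta by rewrite -natr1; ring.
by rewrite /a sinD sinB; ring.
Qed.

Let mean_Kcos (theta : R) : \sum_(q < Q) K (theta - node q) * (2 - 2 * cos (theta - node q)) =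
  Q%:R * S * (2 - 2 * cos beta).
Proof.
under eq_bigr do rewrite mulrBr mulrC.
rewrite sumrB -mulr_sumr mean_K.
have -> : \sum_(q < Q) K (theta - node q) * (2 * cos (theta - node q)) = Q%:R * S * (2 * cos beta); last by ring.
under eq_bigr do rewrite /K mulr_suml.
rewrite exchange_big /= /S mulr_sumr mulr_suml; apply: eq_bigr => k _.
under eq_bigr do rewrite mulr_suml.
rewrite exchange_big /=.
transitivity (\sum_(l < N.+1) Q%:R * a k * ((dist k l == 1%N)%:R * a l)).
  apply: eq_bigr => l _.
  transitivity (a k * a l * 2 * \sum_(q < Q) cos ((dist k l)%:R * (theta - node q)) * cos (theta - node q)).
    by rewrite mulr_sumr; apply: eq_bigr => q _; ring.
  by rewrite sum_grid_cos ?dist_lt//; field.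
rewrite -mulr_sumr neighbours//; ring.
Qed.

Definition kernel_poly (q : nat) : {poly R} :=
  \sum_(k < N.+1) \sum_(l < N.+1) ((Q%:R * S)^-1 * a k * a l * cos ((dist k l)%:R * node q)) *: cheb (dist k l).

Lemma size_kernel q : (size (kernel_poly q) <= N.+1)%N.
Proof.
apply: (leq_trans (size_sum _ _ _)); apply/bigmax_leqP => k _.
apply: (leq_trans (size_sum _ _ _)); apply/bigmax_leqP => l _.
apply: (leq_trans (size_scale_leq _ _)); apply: (leq_trans (size_cheb _)).
by have := dist_lt (ltn_ord k) (ltn_ord l); rewrite /Q; lia.
Qed.

Let kernelE q (t : R) : (kernel_poly q).[cos t] = (2 * Q%:R * S)^-1 * (K (t - node q) + K (- t - node q)).
Proof.
have S0 : S != 0 by rewrite gt_eqF ?S_gt0.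
have Qn : Q%:R != 0 :> R by rewrite gt_eqF.
rewrite /kernel_poly /K; move: (S) S0 => S' S0.
rewrite horner_sum mulrDr !mulr_sumr -big_split; apply: eq_bigr => k _.
rewrite horner_sum !mulr_sumr -big_split; apply: eq_bigr => l _ /=.
rewrite hornerZ chebE.
have -> : (dist k l)%:R * (t - node q) = (dist k l)%:R * t - (dist k l)%:R * node q by ring.
have -> : (dist k l)%:R * (- t - node q) = - ((dist k l)%:R * t + (dist k l)%:R * node q) by ring.
rewrite cosN (cosB (_ * _)) (cosD (_ * _)); field.
by rewrite S0 Qn.
Qed.

Let dist_cos (t : R) q : (cos t - cos (node q)) ^+ 2 <= 2 - 2 * cos (t - node q).
Proof.
have := cos2Dsin2 t; have := cos2Dsin2 (node q); rewrite cosB => h1 h2.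
by have := sqr_ge0 (sin t - sin (node q)); nra.
Qed.

Lemma kernel_1d : exists y : 'I_Q -> R, (forall q, -1 <= y q <= 1) /\
  forall x, -1 <= x <= 1 -> [/\ forall q, 0 <= (kernel_poly q).[x],
    \sum_(q < Q) (kernel_poly q).[x] = 1 &
    \sum_(q < Q) (kernel_poly q).[x] * `|y q - x| <= pi / Q%:R].
Proof.
exists (fun q => cos (node q)); split; first by move=> q; rewrite cos_geN1 cos_le1.
move=> x /acos_def[_ xE]; rewrite -xE; set t := acos x.
have QS : 0 < 2 * Q%:R * S by rewrite !mulr_gt0 ?S_gt0.
have k0 q : 0 <= (kernel_poly q).[cos t].
  by rewrite kernelE mulr_ge0 ?invr_ge0 ?(ltW QS)// addr_ge0.
have k1 : \sum_(q < Q) (kernel_poly q).[cos t] = 1.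
  under eq_bigr do rewrite kernelE.
  rewrite -mulr_sumr big_split /= !mean_K; field.
  by rewrite gt_eqF ?S_gt0// gt_eqF.
split => //.
have b2 : 0 < 2 * beta by rewrite mulr_gt0 ?beta0.
have k2 : \sum_(q < Q) (kernel_poly q).[cos t] * (cos (node q) - cos t) ^+ 2 <= beta ^+ 2.
  apply: le_trans (cos_quad (ltW beta0)).
  have -> : 2 - 2 * cos beta = (2 * Q%:R * S)^-1 * (Q%:R * S * (2 - 2 * cos beta) + Q%:R * S * (2 - 2 * cos beta)).
    by field; rewrite gt_eqF ?S_gt0// gt_eqF.
  rewrite -{1}(mean_Kcos t) -(mean_Kcos (- t)) -big_split /= mulr_sumr; apply: ler_sum => q _.
  rewrite kernelE -[X in X <= _]mulrA; apply: ler_wpM2l; first by rewrite invr_ge0 (ltW QS).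
  rewrite mulrDl; apply: lerD; apply: ler_wpM2l => //.
    by rewrite -sqrrN opprB dist_cos.
  by rewrite -sqrrN opprB -[cos t]cosN dist_cos.
apply: (@le_trans _ _ (\sum_(q < Q) (kernel_poly q).[cos t] * (((cos (node q) - cos t) ^+ 2 + beta ^+ 2) / (2 * beta)))).
  apply: ler_sum => q _; rewrite ler_wpM2l// ler_pdivlMr//.
  rewrite -(real_normK (num_real (cos (node q) - cos t))).
  by have := sqr_ge0 (`|cos (node q) - cos t| - beta); nra.
have -> : \sum_(q < Q) (kernel_poly q).[cos t] * (((cos (node q) - cos t) ^+ 2 + beta ^+ 2) / (2 * beta)) =
  (\sum_(q < Q) (kernel_poly q).[cos t] * (cos (node q) - cos t) ^+ 2 + beta ^+ 2 * \sum_(q < Q) (kernel_poly q).[cos t]) / (2 * beta).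
  rewrite mulr_sumr -big_split /= mulr_suml; apply: eq_bigr => q _; field; rewrite gt_eqF//.
rewrite k1 mulr1 ler_pdivrMr// -/beta; nra.
Qed.
End Kernel.

Theorem jackson n N (M d : R) (c : 'rV[R]_n) (f : 'rV[R]_n -> R) : 0 <= M -> 0 < d ->
  (forall x y, closed_cube c d x -> closed_cube c d y ->
     `|f x - f y| <= M * \sum_j `|x 0 j - y 0 j|) ->
  exists a : {ffun 'I_n -> 'I_N.+1} -> R, forall x, closed_cube c d x ->
    `|\sum_e a e * (\prod_j x 0 j ^+ e j) - f x| <= M * n%:R * d * pi / N.+2%:R.
Proof.
move=> M0 d0 fL; have dn : d != 0 by rewrite gt_eqF.
have [y [y1 yk]] := kernel_1d N.
pose P (q : 'I_N.+2) j : {poly R} := kernel_poly N q \Po (d^-1 *: ('X - (c 0 j)%:P)).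
have PE q j (t : R) : (P q j).[t] = (kernel_poly N q).[(t - c 0 j) / d].
  by rewrite /P horner_comp hornerZ hornerXsubC mulrC.
have sP q j : (size (P q j) <= N.+1)%N.
  apply: leq_trans (size_comp_poly_leq _ _) _.
  have s2 : leq (size (d^-1 *: ('X - (c 0 j)%:P) : {poly R})) 2.
    by rewrite (leq_trans (size_scale_leq _ _))// size_XsubC.
  have := size_kernel N q; nia.
pose z (w : {ffun 'I_n -> 'I_N.+2}) : 'rV[R]_n := \row_j (c 0 j + d * y (w j)).
have zin w : closed_cube c d (z w).
  move=> j; rewrite mxE addrAC subrr add0r normrM gtr0_norm// ger_pMr// ler_norml.
  exact: y1.
exists (fun e : {ffun 'I_n -> 'I_N.+1} => \sum_w f (z w) * \prod_j (P (w j) j)`_(e j)) => x xin.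
have xk j : -1 <= (x 0 j - c 0 j) / d <= 1.
  by rewrite -ler_norml normrM (gtr0_norm (_ : 0 < d^-1)) ?invr_gt0// ler_pdivrMr// mul1r.
pose k j (q : 'I_N.+2) := (P q j).[x 0 j].
have k0 j q : 0 <= k j q by rewrite /k PE; have [+ _ _] := yk _ (xk j).
have k1 j : \sum_q k j q = 1.
  by have [_ <- _] := yk _ (xk j); apply: eq_bigr => q _; rewrite /k PE.
have k2 j : \sum_q k j q * `|c 0 j + d * y q - x 0 j| <= d * (pi / N.+2%:R).
  have [_ _ H] := yk _ (xk j); apply: le_trans (ler_wpM2l (ltW d0) H).
  rewrite mulr_sumr; apply: ler_sum => q _; rewrite /k PE mulrCA ler_wpM2l//.
    by rewrite -PE; exact: k0.
  rewrite -{2}(gtr0_norm d0) -normrM le_eqVlt; apply/orP; left; apply/eqP; congr `|_|.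
  by field.
pose W (w : {ffun 'I_n -> 'I_N.+2}) := \prod_j k j (w j).
have W0 w : 0 <= W w by apply: prodr_ge0.
have W1 : \sum_w W w = 1.
  by rewrite /W -(bigA_distr_bigA (fun j q => k j q)) big1.
have -> : \sum_(e : {ffun 'I_n -> 'I_N.+1}) (\sum_w f (z w) * \prod_j (P (w j) j)`_(e j)) * (\prod_j x 0 j ^+ e j)
   = \sum_w f (z w) * W w.
  under eq_bigr do rewrite mulr_suml.
  rewrite exchange_big; apply: eq_bigr => w _ /=.
  under eq_bigr do rewrite -mulrA -big_split /=.
  rewrite -mulr_sumr; congr (_ * _).
  rewrite -(bigA_distr_bigA (fun j (i : 'I_N.+1) => (P (w j) j)`_i * x 0 j ^+ i)).
  by apply: eq_bigr => j _; rewrite /k (horner_coef_wide _ (sP _ _)).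
have -> : \sum_w f (z w) * W w - f x = \sum_w W w * (f (z w) - f x).
  rewrite -[f x in LHS]mul1r -W1 mulr_suml -sumrB; apply: eq_bigr => w _; ring.
apply: le_trans (ler_norm_sum _ _ _) _.
apply: (@le_trans _ _ (\sum_w \sum_j M * (W w * `|z w 0 j - x 0 j|))).
  apply: ler_sum => w _; rewrite normrM (ger0_norm (W0 w)).
  rewrite -mulr_sumr -mulr_sumr mulrCA ler_wpM2l//; exact: fL.
rewrite exchange_big /=.
have -> : M * n%:R * d * pi / N.+2%:R = \sum_(j < n) M * (d * (pi / N.+2%:R)).
  by rewrite sumr_const card_ord -mulr_natl; field.
apply: ler_sum => j _; rewrite -mulr_sumr ler_wpM2l//; apply: le_trans (k2 j).
pose g i q := k i q * (if i == j then `|c 0 j + d * y q - x 0 j| else 1).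
have -> : \sum_w W w * `|z w 0 j - x 0 j| = \sum_(w : {ffun 'I_n -> 'I_N.+2}) \prod_i g i (w i).
  apply: eq_bigr => w _; rewrite /g big_split /= -big_mkcond /= big_pred1_eq mxE //.
rewrite -(bigA_distr_bigA g) (bigD1 j)//= [X in _ * X]big1 ?mulr1.
  by apply: ler_sum => q _; rewrite /g eqxx.
move=> i ij; rewrite -(k1 i); apply: eq_bigr => q _.
by rewrite /g (negbTE ij) mulr1.
Qed.
End Korovkin.

(** * Decomposition of simple loops into arcs *)

Section LoopDecomposition.
Context {R : realType} {n k : nat} (C X : set 'rV[R]_n) (h : 'I_k -> R -> 'rV[R]_n).
Hypothesis htri : lipschitz_triangulation h C.
Hypothesis CX : C `<=` X.
Variable c : R -> 'rV[R]_n.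
Hypothesis c_continuous : {within `[0, 1], continuous c}.
Hypothesis cC : forall t, t \in `[0, 1] -> C (c t).
Hypothesis c01 : c 0 = c 1.
Hypothesis cinj : {in `[0, 1[ &, injective c}.
Local Notation E i := (h i @` `[0, 1]).
Local Notation sg i := (pinv (`[0, 1] : set R) (h i)).

Definition is_vertex (x : 'rV[R]_n) := exists i, x = h i 0 \/ x = h i 1.

Lemma vertex_isolated t : t \in `[0, 1] -> exists2 d, 0 < d &
  forall u, u \in `[0, 1] -> u != t -> `|t - u| < d -> ~ is_vertex (c u).
Proof.
move=> t01.
have H0 (p : 'rV[R]_n) : exists2 d, 0 < d & forall u, u \in `[0, 1] -> u != t -> `|t - u| < d -> c u <> p.
  have [[u1 u1I cu1]|nu] := pselect (exists2 u1, u1 \in `[0, 1[ & c u1 = p); last first.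
    exists 1 => // u u01 _ _ cu; apply: nu.
    have [u1|u1] := ltP u 1.
      by exists u => //; move: u01; rewrite !in_itv /= u1 => /andP[-> _].
    exists 0; first by rewrite in_itv /= lexx ltr01.
    by rewrite c01 -cu; congr c; move: u01; rewrite in_itv /=; lra.
  pose e (v : R) := if v == t then 1 else `|t - v|.
  have e0 v : 0 < e v by rewrite /e; case: eqVneq => // vt; rewrite normr_gt0 subr_eq0 eq_sym.
  have eP v u : u != t -> `|t - u| < e v -> u <> v.
    by move=> /negbTE ut + uv; rewrite -uv /e ut ltxx.
  exists (Num.min (e u1) (e 1)); first by rewrite lt_min !e0.
  move=> u u01 ut; rewrite lt_min => /andP[/(eP _ _ ut) h1 /(eP _ _ ut) h2] cu.
  apply: h1; apply: cinj => //; last by rewrite cu.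
  move: u01; rewrite !in_itv /= => /andP[-> u_1] /=.
  by have /eqP := h2; rewrite lt_neqAle u_1 andbT.
have [d d0 H] := @fin_exists_pos R ('I_k * bool)%type
  (fun j d => forall u, u \in `[0, 1] -> u != t -> `|t - u| < d -> c u <> h j.1 j.2%:R)
  (fun j d d' dd' H u u01 ut tu => H u u01 ut (lt_le_trans tu dd')) (fun j => H0 _).
exists d => // u u01 ut tu [i [e|e]].
  exact: (H (i, false) u u01 ut tu e).
exact: (H (i, true) u u01 ut tu e).
Qed.

(* The loop may start inside an arc.  Moving each point other than the end of its
   arc to the origin of the arc changes the value of [Th] on a piece of the loop by
   the increment of a function of the endpoints, which telescopes along the loop. *)
Definition arc_defect (Th : (R -> 'rV[R]_n) -> R) i u := Th (seg (h i) 0 u) - (u == 1)%:R * Th (h i).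

Definition defect Th x := \sum_i if `[< E i x >] then arc_defect Th i (sg i x) else 0.

Lemma path_arc i : path_in X (h i).
Proof.
apply/path_inP; split; first exact: arc_continuous htri i.
by move=> t t01; apply: CX; apply: (arc_sub htri (i := i)); exists t.
Qed.

Lemma seg01 Th F : singular_cocycle X Th -> Th (seg F 0 1) = Th F.
Proof. by move=> [ext _]; apply: ext => t _; rewrite /seg subr0 mulr1 add0r. Qed.

Lemma arc_defect_end Th i : singular_cocycle X Th -> arc_defect Th i 0 = 0 /\ arc_defect Th i 1 = 0.
Proof.
move=> cTh; rewrite /arc_defect eqxx mul1r seg01// subrr; split => //.
rewrite eq_sym oner_eq0 mul0r subr0.
have -> : Th (seg (h i) 0 0) = Th (fun=> h i 0).
  by case: cTh => ext _; apply: ext => t _; rewrite /seg subrr mulr0 addr0.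
apply: cocycle_cst cTh _; apply: CX; apply: (arc_sub htri (i := i)); exists 0 => //.
exact: I0.
Qed.

Lemma defectE Th i x : singular_cocycle X Th -> E i x -> defect Th x = arc_defect Th i (sg i x).
Proof.
move=> cTh ix; rewrite /defect (bigD1 i)//= asboolT// big1 ?addr0// => j ji.
case: asboolP => // jx; have [d0 d1] := arc_defect_end j cTh.
by have [->|->] := arc_meet_end htri ji jx ix; rewrite (sgKV htri) ?I0 ?I1.
Qed.

Definition decomposes (u v : R) := exists alpha : 'I_k -> R, forall Th, singular_cocycle X Th ->
  Th (seg c u v) = \sum_i alpha i * Th (h i) + defect Th (c v) - defect Th (c u).

Lemma path_c : path_in X c.
Proof. by apply/path_inP; split => // t t01; apply: CX; exact: cC. Qed.

Lemma seg_continuous u v : u \in `[0, 1] -> v \in `[0, 1] -> {within `[0, 1], continuous (seg c u v)}.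
Proof.
move=> u01 v01; apply: (@within_continuous_comp R R R _ _ `[0, 1] c (fun t => u + t * (v - u))) => //.
  apply: (@lip_fun_continuous _ _ `|v - u|) => x y.
  have -> : u + x * (v - u) - (u + y * (v - u)) = (v - u) * (x - y) by ring.
  by rewrite normrM.
by move=> t t01; apply: conv01.
Qed.

Lemma decomposes_arc i u v : u \in `[0, 1] -> v \in `[0, 1] ->
  (forall t, t \in `[0, 1] -> E i (seg c u v t)) -> decomposes u v.
Proof.
move=> u01 v01 H; pose s t := sg i (seg c u v t).
have s01 t : t \in (`[0, 1] : interval R) -> s t \in (`[0, 1] : interval R).
  by move=> /H; exact: sg_in htri _ _.
have sc : {within `[0, 1], continuous s}.
  apply/within_continuousP => t t01 e e0.
  have [d d0 hd] := sg_continuous htri (H t t01) e0.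
  have /within_continuousP/(_ t t01 d d0)[d' d'0 hd'] := seg_continuous u01 v01.
  by exists d' => // y y01 ty; apply: hd; [exact: H|exact: hd'].
exists (fun j => (j == i)%:R * ((s 1 == 1)%:R - (s 0 == 1)%:R)) => Th cTh.
have s0E : s 0 = sg i (c u) by rewrite /s /seg mul0r addr0.
have s1E : s 1 = sg i (c v) by rewrite /s /seg mul1r addrC subrK.
have cu : E i (c u) by have := H 0 (I0); rewrite /seg mul0r addr0.
have cv : E i (c v) by have := H 1 (I1); rewrite /seg mul1r addrC subrK.
rewrite (defectE cTh cu) (defectE cTh cv) -s0E -s1E.
have -> : Th (seg c u v) = Th (h i \o s).
  by case: cTh => ext _; apply: ext => t t01 /=; rewrite /s sgK//; exact: H.
rewrite (cocycle_reparam cTh (path_arc i) sc s01).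
have := cocycle_affine cTh (path_arc i) I0 (s01 _ I0) (s01 _ I1).
rewrite (bigD1 i)//= eqxx mul1r big1 => [|j /negbTE ->]; last by rewrite !mul0r.
rewrite /arc_defect; move: (Th (seg _ 0 (s 0))) (Th (seg _ (s 0) (s 1))) (Th (seg _ 0 (s 1))) => x y z <-.
ring.
Qed.

Lemma decomposes_near t : t \in `[0, 1] -> exists2 d, 0 < d &
  forall u, u \in `[0, 1] -> `|t - u| < d -> decomposes t u.
Proof.
move=> t01; have [d d0 Hd] := vertex_isolated t01; exists d => // u u01 tu.
have fc := seg_continuous t01 u01; pose f := seg c t u.
have f0 : f 0 = c t by rewrite /f /seg mul0r addr0.
have f1 : f 1 = c u by rewrite /f /seg mul1r addrC subrK.
have [ut|ut] := eqVneq u t.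
  have [i ix] := arc_ex htri (cC t01).
  by apply: (@decomposes_arc i) => // w _; rewrite /seg ut subrr mulr0 addr0.
have nv w : w \in `]0, 1] -> ~ is_vertex (f w).
  rewrite in_itv /= => /andP[w0 w1]; rewrite /f /seg; apply: Hd.
  - by apply: conv01 => //; rewrite in_itv /= w1 (ltW w0).
  - by rewrite -[X in _ != X]addr0 (inj_eq (addrI _)) mulf_neq0 ?subr_eq0// gt_eqF.
  - rewrite opprD addNKr normrN normrM gtr0_norm// distrC.
    by apply: le_lt_trans tu; rewrite ler_piMl.
have fC w : w \in `[0, 1] -> C (f w) by move=> w01; apply: cC; apply: conv01.
have sub01 (w : R) : w \in `]0, 1] -> w \in `[0, 1].
  by rewrite !in_itv /= => /andP[/ltW -> ->].
have [i ix] := arc_ex htri (fC 1 I1).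
pose A := f @` `]0, 1]; pose B := A `&` E i.
have cA : connected A.
  apply: connected_continuous_connected; first by apply/connected_intervalP; exact: interval_is_interval.
  apply: continuous_subspaceW fc; exact: sub01.
have BA : B = A.
  apply: cA.
  - exists (f 1); split => //; exists 1 => //=; by rewrite in_itv /= ltr01 lexx.
  - exists (~` \bigcup_(j in [set j | j != i]) E j).
      apply: closed_openC; apply: closed_bigcup; first exact: finite_finset.
      by move=> j _; exact: arc_closed htri j.
    apply/seteqP; split => x [Ax]; [move=> Ei|move=> nE]; split => //.
      move=> [j /= ji Ej]; case: Ax => w w01 wx; apply: (nv w w01); exists i; rewrite wx.
      by apply: (arc_meet_end htri (j := j)) => //; rewrite eq_sym.
    case: Ax => w w01 wx.
    have [j jx] := arc_ex htri (fC w (sub01 _ w01)).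
    have [ji|ji] := eqVneq j i; first by rewrite -wx -ji.
    by case: nE; exists j => //; rewrite -wx.
  - by exists (E i); first exact: arc_closed htri i.
have Ei w : w \in `]0, 1] -> E i (f w).
  move=> w01; have : A (f w) by exists w.
  by rewrite -BA => -[].
apply: (@decomposes_arc i) => // w; have [w0 _|w0 w01] := eqVneq w 0; last first.
  by apply: Ei; move: w01; rewrite !in_itv /= lt_neqAle eq_sym w0 => /andP[-> ->].
apply: contrapT => nE; rewrite w0 in nE.
have [e e0 He] := closed_avoid (arc_closed htri (i := i)) nE.
have /within_continuousP/(_ 0 I0 e e0)[d' d'0 hd'] := fc.
pose w' := Num.min 1 (d' / 2).
have w'0 : 0 < w' by rewrite lt_min ltr01 divr_gt0.
have w'1 : w' <= 1 by rewrite ge_min lexx.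
apply: (He (f w')); first by apply: Ei; rewrite in_itv /= w'0.
apply: hd'; first by rewrite /= in_itv /= (ltW w'0).
rewrite sub0r normrN gtr0_norm// /w'; have : Num.min 1 (d' / 2) <= d' / 2 by rewrite ge_min lexx orbT.
lra.
Qed.

Lemma decomposes_trans u v w : u \in `[0, 1] -> v \in `[0, 1] -> w \in `[0, 1] ->
  decomposes u v -> decomposes u w -> decomposes v w.
Proof.
move=> u01 v01 w01 [al Hal] [be Hbe]; exists (fun i => be i - al i) => Th cTh.
have := cocycle_affine cTh path_c u01 v01 w01; rewrite Hal// Hbe//.
have -> : \sum_i (be i - al i) * Th (h i) = \sum_i be i * Th (h i) - \sum_i al i * Th (h i).
  by rewrite -sumrB; apply: eq_bigr => i _; rewrite mulrBl.
lra.
Qed.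

Lemma loop_decomposition : exists alpha : 'I_k -> R, forall Th, singular_cocycle X Th ->
  Th c = \sum_i alpha i * Th (h i).
Proof.
pose rho t : R := if pselect (t \in `[0, 1]) is left H then sval (cid2 (decomposes_near H)) else 1.
have rho0 t : `[0, 1]%classic t -> 0 < rho t.
  by rewrite /rho => _; case: pselect => // H; case: cid2.
have rhoP t u : t \in `[0, 1] -> u \in `[0, 1] -> `|t - u| < rho t -> decomposes t u.
  by rewrite /rho => t01 u01; case: pselect => // H; case: cid2 => /= d d0 Hd; exact: Hd.
have [d d0 Hd] := compact_lebesgue (@segment_compact R 0 1) rho0.
have step u v : u \in `[0, 1] -> v \in `[0, 1] -> `|u - v| < d -> decomposes u v.
  move=> u01 v01 uv; have [q q01 Hq] := Hd u u01.
  by apply: (@decomposes_trans q) => //; apply: rhoP => //; apply: Hq => //; rewrite subrr normr0.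
have refl0 : decomposes 0 0 by apply: step; rewrite ?I0// subrr normr0.
pose N := (Num.trunc d^-1).+1.
have N0 : 0 < N%:R :> R by rewrite ltr0n.
have Nd : N%:R^-1 < d.
  by rewrite -[ltRHS]invrK ltf_pV2 ?posrE ?invr_gt0//; exact: truncnS_gt.
have H (i : nat) : (i <= N)%N -> decomposes 0 (i%:R / N%:R).
  elim: i => [|i IH] iN; first by rewrite mul0r.
  have g01 : i%:R / N%:R \in (`[0, 1] : interval R) by apply: grid01 => //; exact: ltnW.
  have g'01 : i.+1%:R / N%:R \in (`[0, 1] : interval R) by exact: grid01.
  apply: (@decomposes_trans (i%:R / N%:R)) => //; first exact: I0.
    by apply: (@decomposes_trans 0) => //; [exact: I0|exact: I0|exact: IH (ltnW iN)].
  apply: step => //; rewrite distrC -mulrBl -natrB// subSnn mul1r gtr0_norm ?invr_gt0//.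
have [al Hal] := H N (leqnn _); exists al => Th cTh.
have := Hal _ cTh; rewrite divff ?gt_eqF// seg01// c01.
lra.
Qed.

End LoopDecomposition.

(** * Bumps *)

Section Bump.
Context {R : realType} {n : nat}.
Implicit Types (c x y : 'rV[R]_n) (r : R).
Local Notation mu := (@lebesgue_measure R).

Definition bump c r x : R := Num.max 0 (Num.min 1 (2 - 2 * `|x - c| / r)).

Lemma cube_norm c r x : `|x - c| < r -> cube c r x.
Proof.
by move=> xr j; apply: le_lt_trans xr; have := norm_coord_le (x - c) j; rewrite !mxE.
Qed.

Lemma norm_cube c r x : 0 <= r -> closed_cube c r x -> `|x - c| <= r.
Proof. by move=> r0 H; apply: norm_le_coord => // j; rewrite !mxE. Qed.

Lemma cube_closed_cube c r x : cube c r x -> closed_cube c r x.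
Proof. by move=> H j; apply: ltW. Qed.

Lemma bump01 c r x : 0 <= bump c r x <= 1.
Proof. by rewrite le_max lexx /= ge_max ler01 ge_min lexx. Qed.

Lemma bump_eq1 c r x : 0 < r -> cube c (r / 2) x -> bump c r x = 1.
Proof.
move=> r0 /cube_closed_cube/norm_cube; rewrite divr_ge0 ?(ltW r0)// => /(_ isT) H.
have H1 : 2 * `|x - c| / r <= 1 by rewrite ler_pdivrMr//; lra.
rewrite /bump; have -> : Num.min 1 (2 - 2 * `|x - c| / r) = 1 by apply: min_idPl; lra.
by apply: max_idPr; exact: ler01.
Qed.

Lemma bump_le c r x : 0 < r -> bump c r x <= Num.max 0 (2 / r * (r - `|x - c|)).
Proof.
move=> r0; rewrite ge_max le_max lexx /= le_max; apply/orP; right.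
by rewrite ge_min; apply/orP; right; rewrite le_eqVlt; apply/orP; left; apply/eqP; field; rewrite gt_eqF.
Qed.

Lemma bump_gt0 c r x : 0 < r -> 0 < bump c r x -> `|x - c| < r.
Proof.
move=> r0 b0; have := lt_le_trans b0 (bump_le c x r0).
by rewrite lt_max ltxx /= pmulr_rgt0 ?divr_gt0// subr_gt0.
Qed.

Lemma bump_lip c r x y : 0 < r -> `|bump c r x - bump c r y| <= 2 / r * `|x - y|.
Proof.
move=> r0.
have H x' y' : bump c r x' <= bump c r y' + 2 / r * `|x' - y'|.
  have t : `|y' - c| <= `|x' - c| + `|x' - y'|.
    by have := ler_distD x' y' c; rewrite (distrC y' x') [leRHS]addrC.
  have k0 : 0 < 2 / r by rewrite divr_gt0.
  have := ler_wpM2l (ltW k0) t; rewrite mulrDr => t'.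
  have [b0 b1] := andP (bump01 c r y').
  have p0 : 0 <= 2 / r * `|x' - y'| by rewrite mulr_ge0// ltW.
  have E (z : 'rV[R]_n) : 2 - 2 * `|z - c| / r = 2 - 2 / r * `|z - c| by ring.
  rewrite {1}/bump ge_max; apply/andP; split; first by lra.
  have [y1|y1] := leP 1 (2 - 2 * `|y' - c| / r).
    have -> : bump c r y' = 1.
      by rewrite /bump (min_idPl y1); apply: max_idPr; exact: ler01.
    by rewrite ge_min; apply/orP; left; lra.
  have : 2 - 2 * `|y' - c| / r <= bump c r y' by rewrite le_max (min_idPr (ltW y1)) lexx orbT.
  by rewrite ge_min !E => h; apply/orP; right; lra.
rewrite ler_norml; have := H x y; have := H y x; rewrite (distrC y x) => h1 h2.
by apply/andP; split; lra.
Qed.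

Lemma half_cube c r x : 0 < r -> cube c (r / 2) x -> cube c r x.
Proof. by move=> r0 H j; apply: lt_trans (H j) _; lra. Qed.

Lemma is_prim_reflect (B u W : R -> R) : is_prim 0 1 B u W ->
  is_prim 0 1 (fun t => B (1 - t)) (fun t => u (1 - t)) (fun t => W (1 - t)).
Proof.
move=> [C H]; exists C => x y x01 y01.
have E : (y - x) ^+ 2 = (1 - y - (1 - x)) ^+ 2 by ring.
by rewrite E; apply: H; [move: x01|move: y01]; rewrite !in_itv /=; lra.
Qed.

Lemma lip_reflect (L : R) (V : normedModType R) (u : R -> V) : lip 0 1 L u -> lip 0 1 L (fun t => u (1 - t)).
Proof.
move=> H x y x01 y01; have -> : `|y - x| = `|1 - y - (1 - x)|.
  by rewrite -normrN; congr `|_|; ring.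
by apply: H; [move: x01|move: y01]; rewrite !in_itv /=; lra.
Qed.

Lemma bump_integral_abs (L M : R) (u B W : R -> R) (S : set R) :
  0 < L -> 0 < M -> lip 0 1 L B -> lip 0 1 M u -> is_prim 0 1 B u W ->
  (forall t, t \in `[0, 1] -> 0 <= B t <= 1) ->
  S `<=` `[0, 1] -> (forall t, S t -> B t = 1) ->
  (forall x y : R, x \in `[0, 1] -> y \in `[0, 1] -> x <= y -> 0 < B x -> 0 < B y -> u x <= u y) \/
  (forall x y : R, x \in `[0, 1] -> y \in `[0, 1] -> x <= y -> 0 < B x -> 0 < B y -> u y <= u x) ->
  (mu [set u t | t in S] <= `|W 1 - W 0|%:E)%E.
Proof.
move=> L0 M0 BL uM WP B01 S01 SB [umono|umono].
  apply: le_trans (bump_integral_ge L0 M0 BL uM WP B01 S01 SB umono) _.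
  by rewrite lee_fin ler_norm.
have r01 (t : R) : t \in `[0, 1] -> 1 - t \in `[0, 1] by rewrite !in_itv /=; lra.
have -> : [set u t | t in S] = [set u (1 - t) | t in [set t | S (1 - t)]].
  apply/seteqP; split => z [t /= St <-]; last by exists (1 - t).
  by exists (1 - t) => /=; rewrite subKr.
apply: le_trans (bump_integral_ge L0 M0 (lip_reflect BL) (lip_reflect uM) (is_prim_reflect WP) _ _ _ _) _.
- by move=> t t01; apply: B01; exact: r01.
- by move=> t /= /S01 /= /r01; rewrite subKr.
- by move=> t /= /SB.
- by move=> x y x01 y01 xy Bx By; apply: umono => //; [exact: r01|exact: r01|lra].
by rewrite lee_fin subrr subr0 distrC ler_norm.
Qed.

End Bump.

Section ArcBump.
Context {R : realType} {n k : nat} (C : set 'rV[R]_n) (h : 'I_k -> R -> 'rV[R]_n).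
Hypothesis htri : lipschitz_triangulation h C.
Variables (i : 'I_k) (c : 'rV[R]_n) (r : R) (s : 'I_n).
Hypothesis r0 : 0 < r.
Local Notation E := (h i @` `[0, 1]).
Local Notation mu := (@lebesgue_measure R).
Hypothesis cE : E c.
Hypothesis Kconn : connected (cube c r `&` E).
Hypothesis Kinj : set_inj (cube c r `&` E) (axis_proj s).
Let u (t : R) : R := h i t 0 s.
Let J : set R := [set t | t \in `[0, 1] /\ cube c r (h i t)].

Lemma arc_trace_interval : is_interval J.
Proof.
apply/connected_intervalP.
have -> : J = pinv (`[0, 1] : set R) (h i) @` (cube c r `&` E).
  apply/seteqP; split => [t [t01 ct]|_ [x [cx Ex] <-]].
    by exists (h i t); rewrite ?(sgKV htri)//; split => //; exists t.
  by split; [exact: sg_in htri _ _ Ex|rewrite sgK].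
apply: connected_continuous_connected => //; apply/within_continuousP => x [cx Ex] e e0.
have [d d0 H] := sg_continuous htri Ex e0.
by exists d => // y [_ Ey]; apply: H.
Qed.

Lemma arc_coord_inj : {in J &, injective u}.
Proof.
move=> x y; rewrite !inE => -[x01 cx] [y01 cy] uxy.
apply: (arc_inj htri (i := i)) => //; apply: Kinj; rewrite ?inE.
- by split => //; exists x.
- by split => //; exists y.
by apply/rowP => j; rewrite !mxE; case: eqP => // ->.
Qed.

Lemma arc_coord_continuous : {within `[0, 1], continuous u}.
Proof.
have [M M0 hM] := arc_lip htri i.
exact: lip_within_continuous M0 (lip_coord s hM).
Qed.

Lemma arc_coord_mono :
  (forall x y, J x -> J y -> x <= y -> u x <= u y) \/ (forall x y, J x -> J y -> x <= y -> u y <= u x).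
Proof.
have /is_intervalP JE := arc_trace_interval.
have inJ x : J x <-> x \in Rhull J by rewrite [in X in X <-> _]JE.
have uc : {within [set` Rhull J], continuous u}.
  by apply: continuous_subspaceW arc_coord_continuous; rewrite -JE => t [].
have [|H|H] := itv_continuous_inj_mono uc.
- by move=> x y /inJ Jx /inJ Jy; apply: arc_coord_inj; rewrite inE.
- by left => x y /inJ Jx /inJ Jy; rewrite le_eqVlt => /orP[/eqP -> //|xy]; apply: ltW; exact: H.
- by right => x y /inJ Jx /inJ Jy; rewrite le_eqVlt => /orP[/eqP -> //|xy]; apply: ltW; exact: H.
Qed.

Let S : set R := [set t | t \in `[0, 1] /\ cube c (r / 2) (h i t)].

Lemma axis_measureE :
  axis_measure s (axis_proj s @` (cube c (r / 2) `&` E)) = fine (mu [set u t | t in S]).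
Proof.
rewrite /axis_measure; congr (fine (mu _)); apply/seteqP; split.
  by move=> _ [_ [x [cx [t t01 tx]] <-] <-]; exists t; [split => //; rewrite tx|rewrite mxE eqxx /u tx].
move=> _ [t [t01 ct] <-]; exists (axis_proj s (h i t)); last by rewrite mxE eqxx.
by exists (h i t) => //; split => //; exists t.
Qed.

Lemma arc_trace_measure_gt0 : (0 < mu [set u t | t in S])%E.
Proof.
have [t0 t001 ht0] := cE.
have r20 : 0 < r / 2 by rewrite divr_gt0.
have /within_continuousP/(_ t0 t001 _ r20)[d d0 Hd] := arc_continuous htri (i := i).
have St t : t \in `[0, 1] -> `|t0 - t| < d -> S t.
  move=> t01 tt; split => //; apply: cube_norm.
  by have := Hd _ t01 tt; rewrite ht0 distrC.
pose p := Num.max 0 (t0 - d / 2); pose q := Num.min 1 (t0 + d / 2).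
have /andP[h1 h2] : 0 <= t0 <= 1 by [].
have [pp qq] : (0 <= p /\ t0 - d / 2 <= p) /\ (q <= 1 /\ q <= t0 + d / 2).
  by rewrite /p /q !le_max !ge_min !lexx !orbT.
have pq : p < q by rewrite /p /q gt_max !lt_min; apply/andP; split; apply/andP; split; lra.
have pqS t : t \in `[p, q] -> S t.
  rewrite in_itv /= => /andP[? ?]; apply: St; first by rewrite in_itv /=; lra.
  by rewrite ltr_norml; lra.
have SJ t : S t -> J t by move=> [t01 ct]; split => //; exact: half_cube.
have pS : S p by apply: pqS; rewrite in_itv /= lexx (ltW pq).
have qS : S q by apply: pqS; rewrite in_itv /= lexx (ltW pq).
have uc : {within `[p, q], continuous u}.
  by apply: continuous_subspaceW arc_coord_continuous => t /= /pqS[].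
have sub : `[Num.min (u p) (u q), Num.max (u p) (u q)] `<=` [set u t | t in S].
  move=> v /=; rewrite in_itv /= => hv.
  by have [t tpq <-] := IVT (ltW pq) uc hv; exists t => //; exact: pqS.
have lm (al be : R) : al < be -> (0 < mu `[al, be])%E.
  by move=> ab; rewrite lebesgue_measure_itv /= lte_fin ab -EFinD lte_fin subr_gt0.
have : u p != u q.
  apply/eqP => upq; have pqE : p = q by apply: arc_coord_inj => //; rewrite inE; exact: SJ.
  by move: pq; rewrite pqE ltxx.
move=> upq; have mM : Num.min (u p) (u q) < Num.max (u p) (u q).
  by move: upq; rewrite neq_lt => /orP[] h3; [rewrite (min_idPl (ltW h3)) (max_idPr (ltW h3))|rewrite (min_idPr (ltW h3)) (max_idPl (ltW h3))].
exact: lt_le_trans (lm _ _ mM) (@le_mu_ext _ (ocitv_type R) R (wlength idfun) _ _ sub).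
Qed.

Lemma arc_bump_integral W : is_prim 0 1 (bump c r \o h i) u W ->
  0 < axis_measure s (axis_proj s @` (cube c (r / 2) `&` E)) <= `|W 1 - W 0|.
Proof.
move=> WP; have [M M0 hM] := arc_lip htri i.
have r20 : 0 < 2 / r by rewrite divr_gt0.
have BL : lip 0 1 (2 / r * M) (bump c r \o h i).
  move=> x y x01 y01; apply: le_trans (bump_lip _ _ _ r0) _.
  by rewrite -[leRHS]mulrA ler_wpM2l ?(ltW r20)//; exact: hM.
have JB x : x \in `[0, 1] -> 0 < (bump c r \o h i) x -> J x.
  by move=> x01 /(bump_gt0 r0)/cube_norm.
have H : (mu [set u t | t in S] <= `|W 1 - W 0|%:E)%E.
  apply: (@bump_integral_abs R (2 / r * M) M u _ W S (mulr_gt0 r20 M0) M0 BL _ WP).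
  - exact: lip_coord hM.
  - by move=> t _; exact: bump01.
  - by move=> t [].
  - by move=> t [_ ct]; exact: bump_eq1.
  - by case: arc_coord_mono => H; [left|right] => x y x01 y01 xy /(JB _ x01) Jx /(JB _ y01) Jy; exact: H.
have P := arc_trace_measure_gt0.
have fm : mu [set u t | t in S] \is a fin_num.
  by rewrite ge0_fin_numE ?(ltW P)//; apply: le_lt_trans H _; exact: ltry.
by rewrite axis_measureE; move: P H; rewrite -(fineK fm) lee_fin lte_fin fineK// => -> ->.
Qed.

End ArcBump.

Section BumpSum.
Context {R : realType} {n k : nat} (c : 'I_k -> 'rV[R]_n) (r : 'I_k -> R) (rT : R).
Hypothesis r_gt0 : forall i, 0 < r i.
Hypothesis rT0 : 0 < rT.
Hypothesis rTr : forall i, rT <= r i.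
Hypothesis K_disj : forall i j, i != j -> cube (c i) (r i) `&` cube (c j) (r j) = set0.
Variable th : 'I_k -> R.
Hypothesis th1 : forall i, `|th i| <= 1.

Definition bump_sum x := \sum_i th i * bump (c i) (r i) x.

Lemma center_dist i j : i != j -> r i + r j <= `|c i - c j|.
Proof.
move=> ij; rewrite leNgt; apply/negP => lt; have S0 : 0 < r i + r j by rewrite addr_gt0.
have := K_disj ij; rewrite -subset0 => /(_ (c i + (r i / (r i + r j)) *: (c j - c i))); apply; split.
  apply: cube_norm; rewrite addrAC subrr add0r normrZ gtr0_norm ?divr_gt0//.
  by rewrite distrC mulrAC ltr_pdivrMr// ltr_pM2l.
apply: cube_norm.
have -> : c i + (r i / (r i + r j)) *: (c j - c i) - c j = (r j / (r i + r j)) *: (c i - c j).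
  have -> : r j / (r i + r j) = 1 - r i / (r i + r j) by field; rewrite gt_eqF.
  by apply/rowP => l; rewrite !mxE; ring.
by rewrite normrZ gtr0_norm ?divr_gt0// mulrAC ltr_pdivrMr// ltr_pM2l.
Qed.

Lemma bump_off i j x : i != j -> 0 < bump (c i) (r i) x -> bump (c j) (r j) x = 0.
Proof.
move=> ij /(bump_gt0 (r_gt0 i))/cube_norm ix; have /andP[b0 _] := bump01 (c j) (r j) x.
apply/eqP; rewrite eq_le b0 andbT leNgt; apply/negP => /(bump_gt0 (r_gt0 j))/cube_norm jx.
by have := K_disj ij; rewrite -subset0 => /(_ x); apply.
Qed.

Lemma bump_sumP x : (exists i, 0 < bump (c i) (r i) x /\ bump_sum x = th i * bump (c i) (r i) x) \/
  (bump_sum x = 0 /\ forall i, bump (c i) (r i) x = 0).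
Proof.
have [[i ix]|nex] := pselect (exists i, 0 < bump (c i) (r i) x).
  left; exists i; split => //; rewrite /bump_sum (bigD1 i)//= big1 ?addr0// => j ji.
  by rewrite (bump_off _ ix) ?mulr0// eq_sym.
have b0 i : bump (c i) (r i) x = 0.
  have /andP[b0 _] := bump01 (c i) (r i) x.
  by apply/eqP; rewrite eq_le b0 andbT leNgt; apply/negP => ix; apply: nex; exists i.
by right; split => //; rewrite /bump_sum big1// => i _; rewrite b0 mulr0.
Qed.

Lemma bump_lip_unif i x y : `|bump (c i) (r i) x - bump (c i) (r i) y| <= 2 / rT * `|x - y|.
Proof.
apply: le_trans (bump_lip _ _ _ (r_gt0 i)) _; rewrite ler_wpM2r// ler_wpM2l// lef_pV2 ?posrE//.
Qed.

Lemma bump_sum_lip x y : `|bump_sum x - bump_sum y| <= 2 / rT * `|x - y|.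
Proof.
have one i z z' : `|th i * bump (c i) (r i) z - th i * bump (c i) (r i) z'| <= 2 / rT * `|z - z'|.
  rewrite -mulrBr normrM; apply: le_trans (bump_lip_unif i z z').
  by rewrite ler_piMl.
have [[i [ix ->]]|[-> x0]] := bump_sumP x; have [[j [jy ->]]|[-> y0]] := bump_sumP y.
(* In distinct cubes, [center_dist] leaves room for both bumps to vanish. *)
- have [->|ij] := eqVneq j i; first exact: one.
  have b i' z : 0 < bump (c i') (r i') z -> `|th i' * bump (c i') (r i') z| <= 2 / rT * (r i' - `|z - c i'|).
    move=> b0; rewrite normrM (gtr0_norm b0); apply: (@le_trans _ _ (bump (c i') (r i') z)).
      by rewrite ler_piMl// ltW.
    have d0 := bump_gt0 (r_gt0 i') b0.
    have e0 : 0 <= 2 / r i' * (r i' - `|z - c i'|) by rewrite mulr_ge0 ?divr_ge0 ?subr_ge0// ltW.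
    apply: le_trans (bump_le _ _ (r_gt0 i')) _; rewrite (max_idPr e0).
    by rewrite ler_wpM2r ?subr_ge0 ?(ltW d0)// ler_wpM2l// lef_pV2 ?posrE.
  apply: le_trans (ler_normB _ _) _; apply: le_trans (lerD (b _ _ ix) (b _ _ jy)) _.
  rewrite -mulrDr ler_wpM2l ?divr_ge0 ?(ltW rT0)//.
  have := center_dist ij; have := ler_distD x (c i) (c j); have := ler_distD y x (c j).
  by rewrite (distrC (c i) x) (distrC (c j) (c i)); lra.
- by have := one i x y; rewrite y0 mulr0.
- by have := one j x y; rewrite x0 mulr0.
- by rewrite subrr normr0 mulr_ge0 ?divr_ge0 ?(ltW rT0).
Qed.

End BumpSum.

(** * Independence of the arcs *)

Section LipschitzFunctions.
Context {R : realType} (a b : R).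
Hypothesis ab : a <= b.
Implicit Types (f g : R -> R).

Definition is_lip f := exists2 K, 0 < K & lip a b K f.

Lemma is_lip_cst (v : R) : is_lip (fun=> v).
Proof. by exists 1 => // x y _ _; rewrite subrr normr0 mulr_ge0. Qed.

Lemma is_lip_le M f : lip a b M f -> is_lip f.
Proof.
move=> fM; exists (`|M| + 1); first by rewrite ltr_wpDl.
move=> x y xab yab; apply: le_trans (fM _ _ xab yab) _; rewrite ler_wpM2r//.
by have := ler_norm M; lra.
Qed.

Lemma is_lip_add f g : is_lip f -> is_lip g -> is_lip (fun t => f t + g t).
Proof.
move=> [K K0 fK] [L L0 gL]; apply: (@is_lip_le (K + L)) => x y xab yab.
have -> : f y + g y - (f x + g x) = (f y - f x) + (g y - g x) by ring.
by apply: le_trans (ler_normD _ _) _; rewrite mulrDl lerD ?fK ?gL.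
Qed.

Lemma is_lip_mul f g : is_lip f -> is_lip g -> is_lip (fun t => f t * g t).
Proof.
move=> [K K0 fK] [L L0 gL].
have bd (p : R -> R) P : 0 < P -> lip a b P p -> forall t, t \in `[a, b] -> `|p t| <= `|p a| + P * (b - a).
  move=> P0 pP t tab; have aab : a \in `[a, b] by rewrite in_itv /= lexx.
  have := pP _ _ aab tab; have := ler_normD (p t - p a) (p a); rewrite subrK => h1 h2.
  have : P * `|t - a| <= P * (b - a).
    rewrite ler_wpM2l ?(ltW P0)//; move: tab; rewrite in_itv /= => /andP[ta tb].
    by rewrite ger0_norm; lra.
  lra.
apply: (@is_lip_le ((`|g a| + L * (b - a)) * K + (`|f a| + K * (b - a)) * L)) => x y xab yab.
have -> : f y * g y - f x * g x = g y * (f y - f x) + f x * (g y - g x) by ring.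
apply: le_trans (ler_normD _ _) _; rewrite !normrM mulrDl -!mulrA.
by apply: lerD; apply: ler_pM => //; [exact: bd|exact: fK|exact: bd|exact: gL].
Qed.

Lemma is_lip_sum (I : Type) (s : seq I) (F : I -> R -> R) :
  (forall i, is_lip (F i)) -> is_lip (fun t => \sum_(i <- s) F i t).
Proof.
move=> FL; elim: s => [|i s IH].
  by rewrite (_ : (fun _ => _) = fun=> 0); [exact: is_lip_cst|apply/funext => t; rewrite big_nil].
rewrite (_ : (fun _ => _) = fun t => F i t + \sum_(i <- s) F i t); first exact: is_lip_add.
by apply/funext => t; rewrite big_cons.
Qed.

Lemma is_lip_prod (I : Type) (s : seq I) (F : I -> R -> R) :
  (forall i, is_lip (F i)) -> is_lip (fun t => \prod_(i <- s) F i t).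
Proof.
move=> FL; elim: s => [|i s IH].
  by rewrite (_ : (fun _ => _) = fun=> 1); [exact: is_lip_cst|apply/funext => t; rewrite big_nil].
rewrite (_ : (fun _ => _) = fun t => F i t * \prod_(i <- s) F i t); first exact: is_lip_mul.
by apply/funext => t; rewrite big_cons.
Qed.

Lemma is_lip_exp f k : is_lip f -> is_lip (fun t => f t ^+ k).
Proof.
move=> fL; rewrite (_ : (fun _ => _) = fun t => \prod_(i <- iota 0 k) f t); first exact: is_lip_prod.
by apply/funext => t; rewrite -{1}(subn0 k) -prodr_const_nat /index_iota subn0.
Qed.

End LipschitzFunctions.

Section CurveIntegrals.
Context {R : realType} {n : nat}.
Implicit Types (phi psi : 'rV[R]_n -> R) (g : R -> 'rV[R]_n).

Definition mono (d : 'I_n -> nat) (x : 'rV[R]_n) : R := \prod_j x 0 j ^+ d j.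

Lemma mono_lip (a b M : R) g d : a <= b -> lip a b M g -> is_lip a b (mono d \o g).
Proof.
move=> ab gM; apply: is_lip_prod => // j; apply: is_lip_exp => //.
exact: (is_lip_le (@lip_coord _ _ _ _ _ _ j gM)).
Qed.

Lemma mono_lip_stable d : lip_stable (mono d).
Proof.
move=> a b M g M0 gM; have [ab|ba] := leP a b; first exact: mono_lip ab gM.
by exists 1 => // x y; rewrite in_itv /= => /andP[h1 h2]; lra.
Qed.

Lemma cint_eq_prim (a b M : R) phi s g W : a < b -> 0 < M -> lip a b M g -> is_lip a b (phi \o g) ->
  is_prim a b (phi \o g) (fun t => g t 0 s) W -> cint phi s a b g = W b - W a.
Proof.
move=> ab M0 gM [K K0 pK] WP.
rewrite -(is_prim_unique (ltW ab) (cint_prim s ab M0 K0 gM pK) WP).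
by rewrite {3}/cint Rintegral_pt subr0.
Qed.

Lemma is_prim_cint (M : R) phi s g : 0 < M -> lip 0 1 M g -> is_lip 0 1 (phi \o g) ->
  is_prim 0 1 (phi \o g) (fun t => g t 0 s) (fun z => cint phi s 0 z g).
Proof. by move=> M0 gM [K K0 pK]; exact: cint_prim ltr01 M0 K0 gM pK. Qed.

Lemma is_prim_ext (a b : R) (w w' u W : R -> R) : {in `[a, b], w =1 w'} ->
  is_prim a b w u W -> is_prim a b w' u W.
Proof. by move=> ww [C H]; exists C => x y xab yab; rewrite -ww//; exact: H. Qed.

Lemma cint_comb (I : finType) (M : R) (l : I -> R) (phi : I -> 'rV[R]_n -> R) psi s g :
  0 < M -> lip 0 1 M g -> (forall i, is_lip 0 1 (phi i \o g)) ->
  {in `[0, 1], (fun t => \sum_i l i * phi i (g t)) =1 psi \o g} ->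
  cint psi s 0 1 g = \sum_i l i * cint (phi i) s 0 1 g.
Proof.
move=> M0 gM pL E.
have P := is_prim_comb l (fun i => is_prim_cint s M0 gM (pL i)).
have [K K0 SL] : is_lip 0 1 (fun t => \sum_i l i * phi i (g t)).
  by apply: is_lip_sum => i; apply: is_lip_mul; [exact: ler01|exact: is_lip_cst|exact: pL].
have pg : is_lip 0 1 (psi \o g).
  by exists K => // x y x01 y01; rewrite -!E//; exact: SL.
rewrite (cint_eq_prim ltr01 M0 gM pg (is_prim_ext E P)).
rewrite [X in _ - X]big1 ?subr0// => i _.
by rewrite /cint Rintegral_pt mulr0.
Qed.

Lemma cint_sub (M : R) phi psi s g : 0 < M -> lip 0 1 M g -> is_lip 0 1 (phi \o g) -> is_lip 0 1 (psi \o g) ->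
  cint (fun x => phi x - psi x) s 0 1 g = cint phi s 0 1 g - cint psi s 0 1 g.
Proof.
move=> M0 gM pL qL.
rewrite (@cint_comb bool M (fun i => if i then 1 else -1) (fun i => if i then phi else psi) _ s g M0 gM).
- by rewrite big_bool /= mul1r mulN1r.
- by case.
by move=> t _ /=; rewrite big_bool /= mul1r mulN1r.
Qed.

End CurveIntegrals.

Lemma inf_range_fin (R : realType) (k : nat) (f : 'I_k -> R) (i0 : 'I_k) :
  exists2 i, inf (range f) = f i & forall j, f i <= f j.
Proof.
have [i _ H] := @arg_minP _ R _ i0 xpredT f isT; exists i => [|j]; last exact: H.
apply/eqP; rewrite eq_le; apply/andP; split.
  by apply: ge_inf; [exists (f i) => _ [j _ <-]; exact: H|exists i].
by apply: lb_le_inf; [exists (f i); exists i|move=> _ [j _ <-]; exact: H].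
Qed.

Lemma le_sup_range (R : realType) (k : nat) (f : 'I_k -> R) i : f i <= sup (range f).
Proof.
apply: ub_le_sup; last by exists i.
exists (\sum_j `|f j|) => _ [j _ <-]; rewrite (bigD1 j)//=.
by apply: ler_wpDr; [rewrite sumr_ge0|exact: ler_norm].
Qed.

Lemma l1_length_ge0 (R : realType) (n : nat) (h : R -> 'rV[R]_n) : 0 <= l1_length h.
Proof.
apply: (@Rintegral_ge0 _ (measurableTypeR R) R lebesgue_measure) => t _.
by apply: sumr_ge0 => j _.
Qed.

Notation monoN e := (mono (fun j => nat_of_ord (e j))).

Section ArcsIndependent.
Context {R : realType} {n k : nat} (C : set 'rV[R]_n) (h : 'I_k -> R -> 'rV[R]_n).
Hypothesis htri : lipschitz_triangulation h C.
Variables (c : 'I_k -> 'rV[R]_n) (r : 'I_k -> R) (s : 'I_k -> 'I_n).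
Hypothesis r_gt0 : forall i, 0 < r i.
Hypothesis K_disj : forall i j, i != j -> cube (c i) (r i) `&` cube (c j) (r j) = set0.
Hypothesis c_arc : forall i, (h i @` `[0, 1]) (c i).
Hypothesis K_conn : forall i, connected (cube (c i) (r i) `&` (h i @` `[0, 1])).
Hypothesis K_other : forall i j, j != i -> cube (c i) (r i) `&` (h j @` `[0, 1]) = set0.
Hypothesis K_inj : forall i, set_inj (cube (c i) (r i) `&` (h i @` `[0, 1])) (axis_proj (s i)).

Let l i : R := axis_measure (s i) (axis_proj (s i) @` (cube (c i) (r i / 2) `&` (h i @` `[0, 1]))).
Let V i : R := cint (bump (c i) (r i)) (s i) 0 1 (h i).

Lemma bump_arc_lip i j : is_lip 0 1 (bump (c i) (r i) \o h j).
Proof.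
have [M M0 hM] := arc_lip htri j.
apply: (@is_lip_le _ _ _ (2 / r i * M)) => x y x01 y01.
apply: le_trans (bump_lip _ _ _ (r_gt0 i)) _.
by rewrite -[leRHS]mulrA ler_wpM2l ?divr_ge0 ?(ltW (r_gt0 i))//; exact: hM.
Qed.

Lemma bump_arc_bounds i : 0 < l i <= `|V i|.
Proof.
have [M M0 hM] := arc_lip htri i.
have := arc_bump_integral htri (r_gt0 i) (c_arc i) (@K_conn i) (@K_inj i)
  (is_prim_cint (s i) M0 hM (bump_arc_lip i i)).
by rewrite {2}/cint Rintegral_pt subr0.
Qed.

Lemma min_cube_radius_approx (eta : R) : 'I_k -> 0 < eta ->
  exists c0 d, [/\ 0 < d, d < min_cube_radius C + eta & C `<=` closed_cube c0 d].
Proof.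
move=> i0 eta0; have e2 : 0 < eta / 2 by rewrite divr_gt0.
pose S := [set rho : R | 0 <= rho /\ exists c, C `<=` closed_cube c rho].
have hS : has_inf S.
  split; last by exists 0 => rho [].
  have /choice[M HM] : forall i, exists M : R, 0 < M /\ lip 0 1 M (h i).
    by move=> i; have [M M0 hM] := arc_lip htri i; exists M.
  exists (\sum_i (`|h i 0| + M i)); split.
    by apply: sumr_ge0 => i _; rewrite addr_ge0// ltW//; have [] := HM i.
  exists 0 => x Cx j; rewrite mxE subr0; apply: le_trans (norm_coord_le _ _) _.
  have [i [t t01 <-]] := arc_ex htri Cx; have [M0 hM] := HM i.
  rewrite (bigD1 i)//=; apply: ler_wpDr.
    by apply: sumr_ge0 => i' _; rewrite addr_ge0// ltW//; have [] := HM i'.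
  have := hM 0 t I0 t01; have := ler_normD (h i t - h i 0) (h i 0); rewrite subrK subr0.
  have : M i * `|t| <= M i.
    move: t01; rewrite /= in_itv /= => /andP[t0 t1].
    by rewrite ler_piMr ?(ltW M0)// ger0_norm.
  lra.
have [rho [rho0 [c0 Hc0]] rlt] := inf_adherent e2 hS.
exists c0, (rho + eta / 2); split.
- by rewrite ltr_wpDl.
- by move: rlt; rewrite -/(min_cube_radius C); lra.
by move=> x /Hc0 H j; apply: le_trans (H j) _; lra.
Qed.

Lemma arcs_independent (N : nat) (alpha : 'I_k -> R) : N%:Z = Nbar C h c r s ->
  (forall (e : {ffun 'I_n -> 'I_N.+1}) s', \sum_i alpha i * cint (monoN e) s' 0 1 (h i) = 0) ->
  forall i, alpha i = 0.
Proof.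
move=> NE H0 i0.
pose rT := inf (range r); pose lT := inf (range l); pose LT := sup (range (fun i => l1_length (h i))).
have [ri rTE rTle] := inf_range_fin r i0; have [li lTE lTle] := inf_range_fin l i0.
have rT0 : 0 < rT by rewrite /rT rTE.
have lT0 : 0 < lT by rewrite /lT lTE; have /andP[] := bump_arc_bounds li.
have LTle i : l1_length (h i) <= LT by exact: (le_sup_range (fun i => l1_length (h i))).
have LT0 : 0 <= LT by apply: le_trans (LTle i0); exact: l1_length_ge0.
pose A := 2 * pi * n%:R * LT / (rT * lT).
have A0 : 0 <= A by rewrite divr_ge0 ?mulr_ge0 ?pi_ge0 ?(ltW rT0) ?(ltW lT0).
have AN : A * min_cube_radius C < N%:R.
  have -> : A * min_cube_radius C = 2 * pi * n%:R * LT * min_cube_radius C / (rT * lT) by rewrite /A mulrAC.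
  have -> : N%:R = (N%:Z)%:~R :> R by [].
  rewrite NE /Nbar; exact: floorD1_gt.
have A1 : 0 < A + 1 by rewrite ltr_wpDl.
have Ai : 0 < (A + 1)^-1 by rewrite invr_gt0.
have [c0 [d [d0 dlt Cd]]] := min_cube_radius_approx i0 Ai.
have AdN : A * d < N.+2%:R.
  have h1 : A * d <= A * (min_cube_radius C + (A + 1)^-1) by rewrite ler_wpM2l// ltW.
  have h2 : A / (A + 1) <= 1 by rewrite ler_pdivrMr//; lra.
  by rewrite -addn2 natrD; move: h1; rewrite mulrDr; lra.
pose eps := 2 / rT * n%:R * d * pi / N.+2%:R.
have eLT : eps * LT < lT.
  have -> : eps * LT = A * d / N.+2%:R * lT by rewrite /eps /A; field; rewrite !gt_eqF.
  by rewrite gtr_pMl// ltr_pdivrMr// mul1r.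
(* With these signs all arcs contribute positively to the integral. *)
pose th s' i := (s i == s')%:R * Num.sg (alpha i * V i).
have th1 s' i : `|th s' i| <= 1.
  by rewrite /th normrM normr_sg; case: eqP; case: eqP; rewrite ?normr0 ?normr1 ?mul0r ?mul1r ?mulr0.
have rTr i : rT <= r i by rewrite /rT rTE.
pose f s' := bump_sum c r (th s').
have fL s' x y : `|f s' x - f s' y| <= 2 / rT * \sum_j `|x 0 j - y 0 j|.
  apply: le_trans (bump_sum_lip r_gt0 rT0 rTr K_disj (th1 s') x y) _.
  rewrite ler_wpM2l ?divr_ge0 ?(ltW rT0)//; apply: norm_le_coord; first by apply: sumr_ge0.
  by move=> j; rewrite !mxE (bigD1 j)//=; apply: ler_wpDr => //; apply: sumr_ge0.
have /choice[a Ha] : forall s', exists a : {ffun 'I_n -> 'I_N.+1} -> R, forall x, closed_cube c0 d x ->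
    `|\sum_e a e * monoN e x - f s' x| <= eps.
  move=> s'; apply: (jackson N (divr_ge0 _ (ltW rT0)) d0) => // x y _ _; exact: fL.
pose p s' (x : 'rV[R]_n) := \sum_e a s' e * monoN e x.
have /choice[M HM] : forall i, exists M : R, 0 < M /\ lip 0 1 M (h i).
  by move=> i; have [M M0 hM] := arc_lip htri i; exists M.
have pL s' i : is_lip 0 1 (p s' \o h i).
  apply: is_lip_sum => e; apply: is_lip_mul; [exact: ler01|exact: is_lip_cst|].
  by have [_ hM] := HM i; exact: mono_lip ler01 hM.
have fE s' i : {in `[0, 1], (fun t => th s' i * bump (c i) (r i) (h i t)) =1 f s' \o h i}.
  move=> t t01 /=; rewrite /f /bump_sum (bigD1 i)//= big1 ?addr0// => j ji.
  have /andP[b0 _] := bump01 (c j) (r j) (h i t).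
  suff -> : bump (c j) (r j) (h i t) = 0 by rewrite mulr0.
  apply/eqP; rewrite eq_le b0 andbT leNgt; apply/negP => /(bump_gt0 (r_gt0 j))/cube_norm jx.
  have : (cube (c j) (r j) `&` (h i @` `[0, 1])) (h i t) by split => //; exists t.
  by rewrite K_other// eq_sym.
have fLip s' i : is_lip 0 1 (f s' \o h i).
  have [K K0 SL] : is_lip 0 1 (fun t => th s' i * bump (c i) (r i) (h i t)).
    apply: is_lip_mul; [exact: ler01|exact: is_lip_cst|exact: bump_arc_lip].
  by exists K => // x y x01 y01; rewrite -!fE//; exact: SL.
have fV s' i : cint (f s') s' 0 1 (h i) = th s' i * cint (bump (c i) (r i)) s' 0 1 (h i).
  have [M0 hM] := HM i.
  rewrite (@cint_comb R n unit (M i) (fun=> th s' i) (fun=> bump (c i) (r i)) (f s') s' (h i) M0 hM).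
  - by rewrite big_const card_unit /= addr0.
  - by move=> _; exact: bump_arc_lip.
  by move=> t t01; rewrite -fE// big_const card_unit /= addr0.
have pV s' i : cint (p s') s' 0 1 (h i) = \sum_e a s' e * cint (monoN e) s' 0 1 (h i).
  have [M0 hM] := HM i; apply: (@cint_comb R n _ (M i) (a s') (fun e x => monoN e x)) => //.
  by move=> e; exact: mono_lip ler01 hM.
pose D i := \sum_s' cint (fun x => f s' x - p s' x) s' 0 1 (h i).
have DE i : D i = Num.sg (alpha i * V i) * V i - \sum_s' \sum_e a s' e * cint (monoN e) s' 0 1 (h i).
  have [M0 hM] := HM i; rewrite /D.
  under eq_bigr do rewrite (cint_sub _ M0 hM (fLip _ i) (pL _ i)) fV pV.
  rewrite sumrB; congr (_ - _); rewrite (bigD1 (s i))//= big1 ?addr0.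
    by rewrite /th eqxx mul1r.
  by move=> s' /negbTE; rewrite eq_sym /th => ->; rewrite !mul0r.
have Dbound i : `|D i| <= eps * LT.
  have [M0 hM] := HM i.
  have /choice[K HK] : forall s', exists K : R, 0 < K /\ lip 0 1 K ((fun x => f s' x - p s' x) \o h i).
    move=> s'; have [|K K0 HK] := @is_lip_add R 0 1 (f s' \o h i) (fun t => -1 * p s' (h i t)) (fLip s' i).
      by apply: is_lip_mul; [exact: ler01|exact: is_lip_cst|exact: pL].
    exists K; split => // x y x01 y01; have := HK x y x01 y01; rewrite /= !mulN1r; exact.
  pose KK := \sum_s' K s'.
  have Kle s' : K s' <= KK.
    by rewrite /KK (bigD1 s')//=; apply: ler_wpDr => //; apply: sumr_ge0 => s'' _; have [/ltW] := HK s''.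
  have KK0 : 0 < KK by apply: lt_le_trans (Kle (s i)); have [] := HK (s i).
  apply: (@le_trans _ _ (eps * l1_length (h i))).
    apply: (cint_l1_bound M0 KK0 hM).
      move=> s' x y x01 y01; have [_ hK] := HK s'; apply: le_trans (hK x y x01 y01) _.
      by rewrite ler_wpM2r.
    move=> s' t t01; rewrite distrC; apply: Ha; apply: Cd.
    by apply: (arc_sub htri (i := i)); exists t.
  rewrite ler_wpM2l// /eps !mulr_ge0 ?invr_ge0 ?pi_ge0 ?(ltW rT0) ?(ltW d0)//.
have sumE : \sum_i alpha i * D i = \sum_i `|alpha i| * `|V i|.
  under eq_bigr do rewrite DE mulrBr.
  rewrite sumrB [X in _ - X](_ : _ = 0) ?subr0.
    by apply: eq_bigr => i _; rewrite -normrM normrEsg mulrCA.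
  under eq_bigr do rewrite mulr_sumr.
  rewrite exchange_big big1// => s' _ /=.
  under eq_bigr do rewrite mulr_sumr.
  rewrite exchange_big big1// => e _ /=.
  under eq_bigr do rewrite mulrCA.
  by rewrite -mulr_sumr H0 mulr0.
have key : \sum_i `|alpha i| * (lT - eps * LT) <= 0.
  rewrite -mulr_suml mulrBr subr_le0 !mulr_suml.
  apply: (@le_trans _ _ (\sum_i `|alpha i| * `|V i|)).
    apply: ler_sum => i _; rewrite ler_wpM2l//.
    have /andP[_] := bump_arc_bounds i; apply: le_trans; rewrite /lT lTE; exact: lTle.
  rewrite -sumE; apply: le_trans (ler_norm _) _; apply: le_trans (ler_norm_sum _ _ _) _.
  by apply: ler_sum => i _; rewrite normrM ler_wpM2l.
have g0 : 0 < lT - eps * LT by rewrite subr_gt0.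
apply/eqP; rewrite -normr_le0 -(pmulr_lle0 _ g0); apply: le_trans key.
rewrite (bigD1 i0)//= lerDl; apply: sumr_ge0 => i _.
by rewrite mulr_ge0// ltW.
Qed.

Lemma Nbar_ge1 : 'I_k -> 1 <= Nbar C h c r s.
Proof.
move=> i0; rewrite /Nbar lerDr floor_ge0.
have [ri -> _] := inf_range_fin r i0; have [li -> _] := inf_range_fin l i0.
have /andP[l0 _] := bump_arc_bounds li.
have L0 : 0 <= sup (range (fun i => l1_length (h i))).
  by apply: le_trans (le_sup_range (fun i => l1_length (h i)) i0); exact: l1_length_ge0.
have d0 : 0 <= min_cube_radius C.
  rewrite leNgt; apply/negP => dlt; have e0 : 0 < - min_cube_radius C by rewrite oppr_gt0.
  by have [c0 [d [d0 + _]]] := min_cube_radius_approx i0 e0; rewrite subrr ltNge ltW.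
by rewrite divr_ge0 ?mulr_ge0 ?pi_ge0 ?(ltW l0) ?(ltW (r_gt0 _)).
Qed.

End ArcsIndependent.

(** * Selection of the moments *)

Lemma select_columns (F : fieldType) (m : nat) (I : finType) (A : 'I_m -> I -> F) :
  (forall lam : 'I_m -> F, (forall x, \sum_j lam j * A j x = 0) -> forall j, lam j = 0) ->
  (m <= #|I|)%N /\ exists2 e : 'I_m -> I, injective e &
    forall v : 'I_m -> F, exists lam : 'I_m -> F, forall j, v j = \sum_l lam l * A j (e l).
Proof.
move=> Hfree; pose B : 'M[F]_(#|I|, m) := \matrix_(x, j) A j (enum_val x).
have fB : row_full B.
  rewrite /row_full -mxrank_tr; apply: inj_row_free => v vB; apply/rowP => j; rewrite mxE.
  apply: (Hfree (fun j => v 0 j)) => x.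
  have := congr1 (fun w : 'rV_#|I| => w 0 (enum_rank x)) vB; rewrite !mxE => E.
  by rewrite -[RHS]E; apply: eq_bigr => l _; rewrite !mxE enum_rankK.
split; first by rewrite -(eqP fB) rank_leq_row.
exists (fun l => enum_val (fullrankfun fB l)).
  by move=> x y /enum_val_inj/fullrankfun_inj.
move=> v; pose w := (\row_j v j) *m invmx (rowsub (fullrankfun fB) B).
exists (fun l => w 0 l) => j.
have := congr1 (fun z : 'rV_m => z 0 j) (mulmxKV (fullrowsub_unit fB) (\row_j v j)).
by rewrite !mxE => <-; apply: eq_bigr => l _; rewrite !mxE.
Qed.

Lemma floor_root_le (R : realType) (m n N : nat) : (0 < n)%N -> (m <= N.+1 ^ n * n)%N ->
  Num.floor ((m%:R / n%:R) `^ n%:R^-1 - 1 : R) <= N%:Z.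
Proof.
move=> n0 mN; have nR : 0 < n%:R :> R by rewrite ltr0n.
rewrite -(@ler_int R); apply: le_trans (floor_le_tmp _) _.
rewrite lerBlDr -[leRHS]/(N%:R + 1) natr1.
have -> : N.+1%:R = (N.+1%:R ^+ n) `^ n%:R^-1 :> R.
  by rewrite -powR_mulrn// -powRrM divff ?powRr1// gt_eqF.
apply: ge0_ler_powR; rewrite ?nnegrE ?invr_ge0 ?divr_ge0 ?exprn_ge0//.
by rewrite ler_pdivrMr// -natrX -natrM ler_nat.
Qed.

Section Reparametrization.
Context {R : realType} {n : nat} (a b M : R) (G : R -> 'rV[R]_n).
Hypothesis ab : a < b.
Hypothesis M0 : 0 < M.
Hypothesis GM : lip a b M G.

Lemma seg_in u v t : u \in `[a, b] -> v \in `[a, b] -> t \in `[0, 1] -> u + t * (v - u) \in `[a, b].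
Proof. by rewrite !in_itv /= => /andP[? ?] /andP[? ?] /andP[? ?]; apply/andP; split; nra. Qed.

Lemma seg_lip u v : u \in `[a, b] -> v \in `[a, b] ->
  lip 0 1 (M * (b - a)) (seg G u v).
Proof.
move=> uab vab x y x01 y01; apply: le_trans (GM (seg_in uab vab x01) (seg_in uab vab y01)) _.
rewrite -mulrA ler_wpM2l ?(ltW M0)//.
have -> : u + y * (v - u) - (u + x * (v - u)) = (v - u) * (y - x) by ring.
rewrite normrM ler_wpM2r//; move: uab vab; rewrite !in_itv /= ler_norml.
by move=> /andP[? ?] /andP[? ?]; apply/andP; split; lra.
Qed.

Lemma cint_seg d s : cint (mono d) s a b G = cint (mono d) s 0 1 (seg G a b).
Proof.
have [K K0 pK] := mono_lip_stable d M0 GM.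
have ba : 0 < b - a by rewrite subr_gt0.
have aab : a \in `[a, b] by rewrite in_itv /= lexx ltW.
have bab : b \in `[a, b] by rewrite in_itv /= lexx ltW.
have sL := seg_lip aab bab; have MM := mulr_gt0 M0 ba.
have P := cint_prim s ab M0 K0 GM pK.
have P' : is_prim 0 1 (mono d \o seg G a b) (fun t => seg G a b t 0 s)
    (fun t => cint (mono d) s a (a + t * (b - a)) G).
  apply: (@is_prim_comp R a b 0 1 K M (b - a) _ _ _ (fun t => a + t * (b - a)) (ltW K0) (ltW M0) pK _ _ _ P).
  - exact: lip_coord GM.
  - by move=> t t01; exact: seg_in.
  move=> x y _ _; have -> : a + y * (b - a) - (a + x * (b - a)) = (b - a) * (y - x) by ring.
  by rewrite normrM gtr0_norm.
rewrite (cint_eq_prim ltr01 MM sL (mono_lip d ler01 sL) P') mul0r addr0 mul1r [a + _]addrC subrK.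
by rewrite [X in _ = _ - X]/cint Rintegral_pt subr0.
Qed.

End Reparametrization.

Lemma mono_cocycle (R : realType) (n : nat) (X : set 'rV[R]_n) d s : lipschitz_triangulable X ->
  exists2 Th, singular_cocycle X Th & forall (g : R -> 'rV[R]_n) M, 0 < M -> lip 0 1 M g ->
    (forall t, t \in `[0, 1] -> X (g t)) -> Th g = cint (mono d) s 0 1 g.
Proof.
move=> Xtri; have [Th [cTh H]] := form_cocycle s Xtri (mono_lip_stable d).
exists Th => // g M M0 gM gX; have gL := mono_lip d ler01 gM.
rewrite (H g M _ M0 gM gX (is_prim_cint s M0 gM gL)).
by rewrite [X in _ - X]/cint Rintegral_pt subr0.
Qed.

Lemma loop_class (R : realType) (V : normedModType R) (X : set V) (m : nat) (c : 'I_m -> R -> V) f :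
  generate_H1 X c -> path_in X f -> f 0 = f 1 ->
  exists z : 'I_m -> int, forall Th, singular_cocycle X Th -> Th f = \sum_j (z j)%:~R * Th (c j).
Proof.
move=> gen fX f01.
have [|z Hz] := gen 1%N (fun=> 1) (fun=> f) (fun=> fX).
  by rewrite big_ord1 /boundary1 f01 subrr mul0rz.
by exists z => Th cTh; have := boundary_eval0 cTh Hz; rewrite big_ord1 mul1r.
Qed.

Theorem theorem3p4 (R : realType) (n : nat) (hn : (3 <= n)%N)
  (a b : R) (hab : a <= b)
  (F : R -> 'rV[R]_n) (F_lip : lipschitz_map a b F)
  (F_nonconst : exists t u, [/\ t \in `[a, b], u \in `[a, b] & F t <> F u])
  (Gamma_tri : lipschitz_triangulable (F @` `[a, b]))
  (m : nat) (hm : (1 <= m)%N)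
  (Gamma_pi1 : pi1_isom_free (R := R) (F @` `[a, b]) (F a) m)
  (c : 'I_m -> R -> 'rV[R]_n)
  (c_simple : forall j, simple_closed_lipschitz (c j))
  (c_Gamma : forall j, c j @` `[0, 1] `<=` F @` `[a, b])
  (c_H1 : generate_H1 (F @` `[a, b]) c)
  (C : set 'rV[R]_n)
  (C_def : C = \bigcup_(j in [set: 'I_m]) (c j @` `[0, 1]))
  (k : nat) (h : 'I_k -> R -> 'rV[R]_n)
  (h_tri : lipschitz_triangulation h C)
  (center : 'I_k -> 'rV[R]_n) (r : 'I_k -> R) (s : 'I_k -> 'I_n)
  (r_gt0 : forall i, 0 < r i)
  (K_disj : forall i j, i != j ->
    cube (center i) (r i) `&` cube (center j) (r j) = set0)
  (center_gamma : forall i, (h i @` `[0, 1]) (center i))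
  (K_conn : forall i, connected (cube (center i) (r i) `&` (h i @` `[0, 1])))
  (K_other : forall i j, j != i ->
    cube (center i) (r i) `&` (h j @` `[0, 1]) = set0)
  (K_inj : forall i, set_inj (cube (center i) (r i) `&` (h i @` `[0, 1]))
                             (axis_proj (s i))) :
  exists N : nat,
    Num.max (Num.floor ((m%:R / n%:R) `^ n%:R^-1 - 1 : R)) 1 <= N%:Z
      <= Nbar C h center r s /\
    forall (d : {ffun 'I_n -> nat}) (i : 'I_n),
      exists (e : 'I_m -> {ffun 'I_n -> nat} * 'I_n) (lambda : 'I_m -> R),
        [/\ injective e,
            forall l, (\max_(j < n) (e l).1 j <= N)%N
          & forall G : R -> 'rV[R]_n,
              lipschitz_map a b G -> G a = G b ->
              G @` `[a, b] `<=` F @` `[a, b] ->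
              moment a b G d i =
                \sum_(l < m) lambda l * moment a b G (e l).1 (e l).2].

Proof.
have ab : a < b.
  rewrite lt_neqAle hab andbT; apply/eqP => E; case: F_nonconst => t [u [tab uab]]; apply.
  by move: tab uab; rewrite -E !in_itv /= => h1 h2; congr F; lra.
pose X := F @` `[a, b]; have [MF MF0 FM] := (lipschitz_mapP _ _ _).1 F_lip.
have ba : 0 < b - a by rewrite subr_gt0.
have aab : a \in `[a, b] by rewrite in_itv /= lexx.
have bab : b \in `[a, b] by rewrite in_itv /= lexx andbT.
have /choice[Mc HMc] : forall j, exists M : R, 0 < M /\ lip 0 1 M (c j).
  by move=> j; have [/lipschitz_mapP[M M0 cM] _ _] := c_simple j; exists M.
have cX j t : t \in `[0, 1] -> X (c j t) by move=> t01; apply: c_Gamma; exists t.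
have CX : C `<=` X by rewrite C_def => x [j _]; exact: c_Gamma.
have cC j t : t \in `[0, 1] -> C (c j t) by move=> t01; rewrite C_def; exists j => //; exists t.
have [i0 _] := arc_ex h_tri (cC (Ordinal hm) 0 I0).
have N1 := Nbar_ge1 h_tri r_gt0 center_gamma K_conn K_inj i0.
pose N := `|Nbar C h center r s|%N.
have NE : N%:Z = Nbar C h center r s by rewrite /N gez0_abs// (le_trans ler01).
pose A j (x : {ffun 'I_n -> 'I_N.+1} * 'I_n) := cint (monoN x.1) x.2 0 1 (c j).
have conn x : X x -> exists g : R -> 'rV[R]_n, [/\ path_in X g, g 0 = F a & g 1 = x].
  move=> [t tab <-]; exists (seg F a t); split.
  - apply/path_inP; split.
      exact: lip_within_continuous (mulr_gt0 MF0 ba) (seg_lip MF0 FM aab tab).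
    by move=> w w01; exists (a + w * (t - a)) => //; exact: seg_in.
  - by rewrite /seg mul0r addr0.
  - by rewrite /seg mul1r addrC subrK.
have Xa : X (F a) by exists a.
have [Psi [f [Psic fX Psif]]] := pi1_cocycles Gamma_pi1 Xa conn.
have /choice[al Hal] : forall j, exists al : 'I_k -> R, forall Th, singular_cocycle X Th ->
    Th (c j) = \sum_i al i * Th (h i).
  move=> j; have [M0 cM] := HMc j; have [_ c01 cinj] := c_simple j.
  exact: (loop_decomposition h_tri CX (lip_within_continuous M0 cM) (cC j) c01 cinj).
have /choice[z Hz] : forall l, exists z : 'I_m -> int, forall Th, singular_cocycle X Th ->
    Th (f l) = \sum_j (z j)%:~R * Th (c j).
  by move=> l; have [fl f01] := fX l; exact: loop_class c_H1 fl f01.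
have Afree (lam : 'I_m -> R) : (forall x, \sum_j lam j * A j x = 0) -> forall j, lam j = 0.
  move=> lam0; pose be i := \sum_j lam j * al j i.
  have comb Th : singular_cocycle X Th -> \sum_i be i * Th (h i) = \sum_j lam j * Th (c j).
    move=> cTh; under eq_bigr do rewrite mulr_suml.
    rewrite exchange_big /=; apply: eq_bigr => j _; rewrite (Hal j Th cTh) mulr_sumr.
    by apply: eq_bigr => i _; rewrite mulrA.
  have be0 : forall i, be i = 0.
    apply: (arcs_independent h_tri r_gt0 K_disj center_gamma K_conn K_other K_inj NE) => e s'.
    have [Th cTh HTh] := mono_cocycle (fun j => nat_of_ord (e j)) s' Gamma_tri.
    transitivity (\sum_i be i * Th (h i)).
      apply: eq_bigr => i _; have [M M0 hM] := arc_lip h_tri i; congr (_ * _).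
      by rewrite (HTh _ M)// => t t01; apply: CX; apply: (arc_sub h_tri (i := i)); exists t.
    rewrite comb// -[RHS](lam0 (e, s')); apply: eq_bigr => j _; congr (_ * _).
    by have [M0 cM] := HMc j; rewrite (HTh _ (Mc j))//; exact: cX.
  pose P : 'M[R]_m := \matrix_(j, k) Psi k (c j).
  pose Z : 'M[R]_m := \matrix_(l, j) (z l j)%:~R.
  have ZP : Z *m P = 1%:M.
    apply/matrixP => l k'; rewrite !mxE eq_sym -Psif (Hz l _ (Psic k')).
    by apply: eq_bigr => j _; rewrite !mxE.
  have lP : (\row_j lam j) *m P = 0.
    apply/rowP => k'; rewrite !mxE.
    transitivity (\sum_j lam j * Psi k' (c j)); first by apply: eq_bigr => j _; rewrite !mxE.
    by rewrite -comb// big1// => i _; rewrite be0 mul0r.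
  move=> j; have := congr1 (fun w => w *m Z) lP.
  by rewrite mul0mx -mulmxA (mulmx1C ZP) mulmx1 => /rowP/(_ j); rewrite !mxE.
have [cardm [e e_inj He]] := select_columns Afree.
have n0 : (0 < n)%N by apply: leq_trans hn.
exists N; split.
  rewrite -NE lexx andbT ge_max; apply/andP; split; last by rewrite NE.
  by apply: floor_root_le => //; move: cardm; rewrite card_prod card_ffun !card_ord.
move=> d i; have [lam Hlam] := He (fun j => cint (mono d) i 0 1 (c j)).
exists (fun l => ([ffun j => nat_of_ord ((e l).1 j)], (e l).2)), lam; split.
- move=> x y [/ffunP E1 E2]; apply: e_inj; rewrite [e x]surjective_pairing [e y]surjective_pairing E2.
  by congr pair; apply/ffunP => j; apply: val_inj; have := E1 j; rewrite !ffunE.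
- by move=> l; apply/bigmax_leqP => j _; rewrite ffunE -ltnS.
move=> G /lipschitz_mapP[M M0 GM] Gab GX.
have gL := seg_lip M0 GM aab bab; have MM := mulr_gt0 M0 ba.
have gX t : t \in `[0, 1] -> X (seg G a b t).
  by move=> t01; apply: GX; exists (a + t * (b - a)) => //; exact: seg_in.
have [|zG HzG] := loop_class c_H1 ((path_inP _ _).2 (conj (lip_within_continuous MM gL) gX)).
  by rewrite /seg mul0r addr0 mul1r addrC subrK Gab.
have momE d' i' : moment a b G d' i' = \sum_j (zG j)%:~R * cint (mono d') i' 0 1 (c j).
  rewrite -[LHS]/(cint (mono d') i' a b G) (cint_seg ab M0 GM).
  have [Th cTh HTh] := mono_cocycle d' i' Gamma_tri.
  rewrite -(HTh _ _ MM gL gX) (HzG _ cTh); apply: eq_bigr => j _; congr (_ * _).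
  by have [Mj cM] := HMc j; rewrite (HTh _ (Mc j))//; exact: cX.
rewrite momE; under [RHS]eq_bigr do rewrite momE mulr_sumr.
rewrite exchange_big /=; apply: eq_bigr => j _; rewrite Hlam mulr_sumr.
apply: eq_bigr => l _; rewrite mulrCA; congr (_ * (_ * _)).
rewrite /A /=; congr (cint _ _ _ _ _); apply/funext => x.
by apply: eq_bigr => j' _; rewrite ffunE.
Qed.
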